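(* Let $G$ be a graph without isolated vertices. There is a constant $C>0$ depending only on $G$ such that, for every nonnegative random variable $X$ with $\mathbb{E}[X^2]<\infty$ that is not almost surely zero, every sequence $(p_n)$ in $(0,1)$ and every $n\ge v_G$, the renormalized weight $\widetilde W^G_n$ of the subgraphs of $\mathbb{G}(n,p_n)$ isomorphic to $G$ satisfies $$ d_W\big(\widetilde W^G_n,\mathcal N\big)\le C\,\frac{\sqrt{\mathbb{E}[(X-\mathbb{E}[X])^4]}+(1-p_n)(\mathbb{E}[X])^2}{\mathrm{Var}[X]+(1-p_n)(\mathbb{E}[X])^2}\Big((1-p_n)\min_{\substack{H\subset G\\ e_H\ge1}}n^{v_H}p_n^{e_H}\Big)^{-1/2}, $$ where the right-hand side is $+\infty$ if $\mathbb{E}[X^4]=\infty$.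
   Context: Graphs are finite and simple; $v_H$ and $e_H$ denote the numbers of vertices and edges of a graph $H$, and $H\subset G$ means that $H$ is a (not necessarily induced) subgraph of $G$. $G$ is fixed and has at least one vertex. $\mathbb{G}(n,p_n)$ is the Erdős–Rényi random graph obtained by independently retaining each edge of the complete graph $K_n$ on $n$ vertices with probability $p_n$. Every edge is assigned an independent copy of the random weight $X$, independently of the random graph. The weight of a graph is the sum of the weights of its edges, and $W_n^G$ is the combined weight of the (not necessarily induced) subgraphs of $\mathbb{G}(n,p_n)$ isomorphic to $G$, i.e. $W_n^G=\sum_{G'}\mathbf 1_{\{G'\subset\mathbb{G}(n,p_n)\}}\sum_{e\in E(G')}X_e$, where the sum is over all subgraphs $G'$ of $K_n$ isomorphic to $G$ and $X_e$ is the weight of the edge $e$. The renormalization is $\widetilde W_n^G=(W_n^G-\mathbb{E}[W_n^G])/\sqrt{\mathrm{Var}[W_n^G]}$. $\mathcal N$ is a standard normal random variable, and $d_W(X,Y)=\sup_{h\in \mathrm{Lip}(1)}|\mathbb{E}[h(X)]-\mathbb{E}[h(Y)]|$ is the Wasserstein distance between laws, where $\mathrm{Lip}(1)$ is the class of real-valued Lipschitz functions on $\mathbb{R}$ with Lipschitz constant at most $1$. *)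

(* Defs.v *)
From HB Require Import structures.
From mathcomp Require Import all_boot all_order all_algebra.
From mathcomp Require Import all_classical all_reals all_analysis.

Set Implicit Arguments.
Unset Strict Implicit.
Unset Printing Implicit Defensive.

Import Order.TTheory GRing.Theory Num.Theory.
Import numFieldNormedType.Exports.

Local Open Scope classical_set_scope.
Local Open Scope ring_scope.

(* Edges of the complete graph on V. *)
Definition edge (V : finType) := {e : {set V} | #|e| == 2}.

(* A finite simple graph whose vertices lie in V, given by its vertex set and
   its edge set.  Since the vertex set need not be all of V, [sgraph 'I_n] is
   exactly the type of subgraphs of K_n. *)
Definition sgraph (V : finType) :=
  {H : {set V} * {set edge V} | [forall e in H.2, val e \subset H.1]}.

Section Graphs.
Variables (V W : finType).

Definition verts (G : sgraph V) : {set V} := (val G).1.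
Definition edges (G : sgraph V) : {set edge V} := (val G).2.

Definition no_isolated (G : sgraph V) : bool :=
  [forall v in verts G, exists e in edges G, v \in val e].

Definition subgraph (H G : sgraph V) : bool :=
  (verts H \subset verts G) && (edges H \subset edges G).

Fact spanning_subproof (F : {set edge V}) :
  [forall e in ([set: V]%SET, F).2, val e \subset ([set: V]%SET, F).1].
Proof. by apply/forall_inP => e _; apply: finset.subsetT. Qed.

(* The graph with vertex set V and edge set F. *)
Definition spanning (F : {set edge V}) : sgraph V :=
  exist _ ([set: V]%SET, F) (spanning_subproof F).

End Graphs.

(* Only the values of f on the vertices of G matter. *)
Definition graph_iso (V W : finType) (G : sgraph V) (H : sgraph W) : bool :=
  [exists f : {ffun V -> W},
    [&& dinjectiveb f (mem (verts G)),
        [set f x | x in verts G]%SET == verts H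
      & [set [set f x | x in \val e]%SET | e : edge V in edges G]%SET
          == [set \val e | e : edge W in edges H]%SET]].

Section Probability.
Context {d : measure_display} {T : measurableType d} {R : realType}.
Variable P : probability T R.

(* Mutual independence of a finite family of sigma-algebras. *)
Definition mutually_independent (I : finType) (F : I -> set (set T)) : Prop :=
  forall (J : {set I}) (A : I -> set T),
    (forall i, i \in J -> F i (A i)) ->
    P (\bigcap_(i in [set` J]) A i) = (\prod_(i in J) P (A i))%E.

Definition mean (X : T -> R) : R := fine ('E_P[X])%E.
Definition var (X : T -> R) : R := fine ('V_P[X])%E.

Definition renormalized (X : T -> R) : T -> R :=
  fun t => (X t - mean X) / Num.sqrt (var X).

End Probability.

Definition sigma_rv {d d' : measure_display} {T : measurableType d}
    {T' : measurableType d'} (X : T -> T') : set (set T) :=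
  preimage_set_system setT X measurable.

Definition wasserstein {d d' : measure_display} {T : measurableType d}
    {T' : measurableType d'} {R : realType}
    (P : probability T R) (X : T -> R) (Q : probability T' R) (Y : T' -> R)
    : \bar R :=
  ereal_sup [set `| 'E_P[h \o X] - 'E_Q[h \o Y] |%E
            | h in [set h : R^o -> R^o | 1.-lipschitz h]].

(* [b e t] tells whether the edge e of K_n is retained in the outcome t. *)
Definition random_graph (n : nat) (T : Type) (b : edge 'I_n -> T -> bool)
    (t : T) : sgraph 'I_n :=
  spanning [set e | b e t]%SET.

(* G' ranges over the subgraphs of K_n isomorphic to G. *)
Definition subgraph_weight (R : realType) (V : finType) (G : sgraph V) (n : nat)
    (T : Type) (b : edge 'I_n -> T -> bool) (Xe : edge 'I_n -> T -> R)
    (t : T) : R :=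
  \sum_(G' : sgraph 'I_n | graph_iso G G')
    (subgraph G' (random_graph b t))%:R * \sum_(e in edges G') Xe e t.

(* The minimum of n^{v_H} p^{e_H} over the subgraphs H of G with at least one
   edge; the initial value is the term H = G, so this is the plain minimum as
   soon as G has an edge. *)
Definition min_subgraph_count (R : realType) (V : finType) (G : sgraph V)
    (n : nat) (p : R) : R :=
  \big[Order.min/n%:R ^+ #|verts G| * p ^+ #|edges G|]_(H : sgraph V |
      subgraph H G && (1 <= #|edges H|)%N)
    (n%:R ^+ #|verts H| * p ^+ #|edges H|).

(* Main.v *)
Require Import Defs.
From HB Require Import structures.
From mathcomp Require Import all_boot all_order all_algebra.
From mathcomp Require Import all_classical all_reals all_analysis.
From mathcomp Require Import measurable_realfun ring lra.

(** The weight of the copies of G is, up to an additive constant, the sum S of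
    the centered contributions of all copies of G in K_n. The contribution of a
    copy depends only on its own edges, so S is a sum of variables with a local
    dependence structure, and the bound follows from Stein's method.

    Stein's equation. For a 1-Lipschitz h and a standard normal Z, the equation
    f' (x) - x f (x) = h (x) - E [h (Z)] has a solution f such that f and f' are
    bounded and f' is Lipschitz, with constants that do not depend on h
    ([stein_solution]). All three bounds come from one monotonicity argument
    ([tail_le]): if (u phi)' = r phi and r x >= - K x beyond a, then u a <= K.
    Applied to f it bounds f; applied to an increment v of f it bounds x v x,
    and with it the increments of f'.

    Local dependence. Removing from W = S / s, for s the standard deviation of
    S, the copies that share an edge with one or two given copies makes the rest
    independent of these copies ([indep_mean]). A Taylor expansion of f then
    bounds E [f' (W) - W f (W)] by K / s^3 times a sum, over connected triples of
    copies, of absolute third moments ([stein_local_dependence]).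

    Counting. Let N = n^v p^k, for v and k the numbers of vertices and edges of
    G, and let psi be the minimum of n^(v_H) p^(e_H) in the statement. Sorting
    the copies that meet a given set of edges by the subgraph of G that is sent
    into this set shows that the sum of p to the number of edges of the union,
    over connected triples, is at most of order N^3 / psi^2 ([sum_triples_le]).
    Conversely, by the Cauchy-Schwarz inequality, the number of pairs of copies
    that share a copy of the minimizing subgraph is large enough for the same
    sum over pairs to be at least of order N^2 / psi ([sum_pairs_ge]).

    Moments. Let m be the mean of X, s1^2 its variance, u the square root of its
    fourth central moment, r^2 = 1 - p and tau^2 = s1^2 + r^2 m^2. Third moments
    of contributions are of order (u + r^2 m^2) tau / r times p to the number of
    edges of the union; the factor 1 - p in front of m comes from the deviation
    of the indicator that a copy is present from its mean ([mean_abs_contrib3]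
    and [error_terms_le]). Covariances of copies that meet are at least tau^2
    times the same power of p, so s^2 is at least of order tau^2 N^2 / psi. The
    error is therefore at most of order
    (u + r^2 m^2) (tau / r) (N^3 / psi^2) / (tau^3 N^3 / psi^(3/2)) =
    ((u + r^2 m^2) / tau^2) (r^2 psi)^(-1/2), which is the bound claimed
    ([copies_sum_stein_bound]). *)

Set Implicit Arguments.
Unset Strict Implicit.
Unset Printing Implicit Defensive.

Import Order.TTheory GRing.Theory Num.Theory.
Import numFieldNormedType.Exports.

Local Open Scope classical_set_scope.
Local Open Scope ring_scope.

(** * The standard normal density *)

Section NormalDensity.
Context {R : realType}.
Local Notation mu := (@lebesgue_measure R).
Local Notation phi := (normal_pdf (0 : R) 1).
Local Notation N := (normal_prob (0 : R) 1).

Lemma normal_pdf_exp (m x : R) :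
  normal_pdf m 1 x = normal_peak 1 * expR (- (x - m) ^+ 2 / 2).
Proof. by rewrite normal_pdfE ?oner_neq0// /normal_fun expr1n. Qed.

Lemma phi_gt0 x : 0 < phi x.
Proof. by rewrite normal_pdf_exp mulr_gt0 ?expR_gt0// normal_peak_gt0// oner_neq0. Qed.

Lemma phiN x : phi (- x) = phi x.
Proof. by rewrite !normal_pdf_exp !subr0 sqrrN. Qed.

Lemma is_derive_phi (x : R) : is_derive x (1:R) phi (- x * phi x).
Proof.
have -> : phi = fun y : R => normal_peak 1 * expR (- y ^+ 2 / 2).
  by apply/funext => y; rewrite normal_pdf_exp subr0.
apply: is_derive_eq.
by rewrite /GRing.scale/=; field.
Qed.

(** The Radon-Nikodym derivative of the normal law is its density only almost
    everywhere, so the change of variables has to be followed by an almost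
    everywhere comparison of the integrands. *)
Lemma ge0_integral_normal_prob (f : R -> \bar R) :
  (forall x, (0 <= f x)%E) -> measurable_fun [set: R] f ->
  (\int[N]_x f x = \int[mu]_x (f x * (phi x)%:E))%E.
Proof.
move=> f0 mf.
have dom := @normal_prob_dominates R 0 1.
rewrite -(Radon_Nikodym_SigmaFinite.change_of_variables dom)//.
have irn := Radon_Nikodym_SigmaFinite.f_integrable dom.
have mphi : measurable_fun [set: R] (fun x => (phi x)%:E).
  by apply/measurable_EFinP; exact: measurable_normal_pdf.
apply: ae_eq_integral => //.
- by apply: emeasurable_funM => //; exact: (measurable_int mu).
- by apply: emeasurable_funM.
apply: ae_eqe_mul2l; apply: integral_ae_eq => // E _ mE.
by rewrite -Radon_Nikodym_SigmaFinite.f_integral.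
Qed.

Lemma integral_normal_prob (f : R -> R) : mu.-integrable setT (fun x => (f x * phi x)%:E) ->
  measurable_fun [set: R] f ->
  N.-integrable setT (EFin \o f) /\
  (\int[N]_x (f x)%:E = \int[mu]_x (f x * phi x)%:E)%E.
Proof.
move=> fi mf; have iN : N.-integrable setT (EFin \o f).
  apply/integrableP; split; first exact/measurable_EFinP.
  rewrite ge0_integral_normal_prob//; last first.
    by apply: measurableT_comp => //; apply/measurable_EFinP.
  move/integrableP : fi => -[_]; congr (_ < _)%E; apply: eq_integral => x _ /=.
  by rewrite -EFinM normrM (ger0_norm (normal_pdf_ge0 _ _ x)).
split=> //.
have mphi : measurable_fun [set: R] (fun x => (phi x)%:E).
  by apply/measurable_EFinP; exact: measurable_normal_pdf.
rewrite integralE [RHS]integralE.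
have mfe : measurable_fun [set: R] (EFin \o f) by exact/measurable_EFinP.
rewrite !ge0_integral_normal_prob//; last 2 first.
  exact: measurable_funeneg.
  exact: measurable_funepos.
congr (_ - _)%E; apply: eq_integral => x _; rewrite ?funeposE ?funenegE /=.
  by rewrite -!EFin_max -EFinM maxr_pMl ?normal_pdf_ge0// mul0r.
by rewrite -mulNr -!EFin_max -EFinM maxr_pMl ?normal_pdf_ge0// mul0r.
Qed.

(** Completing the square in exp (x - x^2/2) and exp (- x - x^2/2) turns this
    bound into one of |x| phi(x) by the densities of the normal laws centered at
    1 and -1. *)
Lemma norm_exp (x : R) : `|x| <= expR x + expR (- x).
Proof.
have h (y : R) : y <= expR y by have := expR_ge1Dx y; lra.
have := h x; have := h (- x); have := expR_gt0 x; have := expR_gt0 (- x).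
by move=> *; rewrite ler_norml; apply/andP; split; lra.
Qed.

Lemma integrable_norm_phi : mu.-integrable setT (fun x => (`|x| * phi x)%:E).
Proof.
pose b := fun x : R => (expR (1 / 2) * (normal_pdf 1 1 x + normal_pdf (-1) 1 x)).
apply: (@le_integrable _ _ _ mu setT measurableT _ (EFin \o b)).
- apply/measurable_EFinP; apply: measurable_funM; first exact: normr_measurable.
  exact: measurable_normal_pdf.
- move=> x _ /=; rewrite lee_fin !normrM normr_id.
  rewrite (ger0_norm (normal_pdf_ge0 _ _ _)) (ger0_norm (expR_ge0 _)) ger0_norm; last first.
    by rewrite addr_ge0 ?normal_pdf_ge0.
  apply: (le_trans (ler_wpM2r (normal_pdf_ge0 _ _ _) (norm_exp x))).
  rewrite le_eqVlt; apply/orP; left; apply/eqP.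
  rewrite !normal_pdf_exp !(mulrDl, mulrDr) !(mulrCA (expR _)) -!expRD.
  by congr (_ * expR _ + _ * expR _); field.
- rewrite [X in _.-integrable _ X](_ : _ = (fun x => (expR (1/2))%:E *
      ((fun x => (normal_pdf 1 1 x)%:E) \+ (fun x => (normal_pdf (-1) 1 x)%:E)) x))%E; last first.
    by apply/funext => x; rewrite /b /= EFinM EFinD.
  by apply: integrableZl => //; apply: integrableD => //; exact: integrable_normal_pdf.
Qed.

Lemma continuous_phi : continuous phi.
Proof. by apply: continuous_normal_pdf; rewrite oner_neq0. Qed.

Lemma phi_le x : phi x <= phi 0.
Proof.
rewrite !normal_pdf_exp ler_wpM2l ?normal_peak_ge0// ler_expR subrr !subr0.
by have := sqr_ge0 x; lra.
Qed.

Lemma cvg_phi : phi n%:R @[n --> \oo] --> (0 : R).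
Proof.
(* exp (n^2/2) >= 1 + n^2/2 >= (n+1)/2, so phi(n) is at most 2 phi(0)/(n+1). *)
apply: (@squeeze_cvgr _ _ _ _ (fun=> 0) (fun n : nat => (2 * phi 0) * n.+1%:R^-1)).
- apply: nearW => n; rewrite normal_pdf_ge0/= !normal_pdf_exp.
  rewrite !subr0 expr0n/= oppr0 mul0r expR0 mulr1.
  rewrite mulrAC mulrC ler_wpM2r ?normal_peak_ge0//.
  rewrite mulNr expRN -[leRHS]invrK lef_pV2 ?posrE ?expR_gt0 ?invr_gt0 ?divr_gt0//.
  rewrite invf_div; apply: le_trans (expR_ge1Dx _).
  by rewrite -natr1; move: (n%:R : R) => z; nra.
- exact: cvg_cst.
- rewrite -[X in _ --> X](mulr0 (2 * phi 0)); apply: cvgM; first exact: cvg_cst.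
  exact: cvg_harmonic.
Qed.

End NormalDensity.

Section MeanValue.
Context {R : realType}.

Lemma mean_value (f df : R -> R) (a b : R) :
  (forall x, is_derive x (1 : R) f (df x)) ->
  exists c, [/\ f b - f a = df c * (b - a), `|c - a| <= `|b - a| & `|c - b| <= `|b - a|].
Proof.
move=> fd.
have fc (c d : R) : {within `[c, d], continuous f}.
  apply: derivable_within_continuous => x _.
  exact: (@ex_derive _ _ _ _ _ _ _ (fd x)).
have [ab|/ltW ba] := lerP a b.
- have [|c] := @MVT_segment R f df a b ab; first exact: fc.
  rewrite in_itv/= => /andP[ac cb] E; exists c; split=> //.
    by rewrite !ger0_norm ?subr_ge0// lerD2r.
  by rewrite distrC !ger0_norm ?subr_ge0// lerD2l lerN2.
- have [|c] := @MVT_segment R f df b a ba; first exact: fc.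
  rewrite in_itv/= => /andP[bc ca] E; exists c; split.
    by rewrite -[LHS]opprB E -mulrN opprB.
    by rewrite distrC !ger0_norm ?subr_ge0// lerD2l lerN2.
  by rewrite ger0_norm ?subr_ge0// lerD2r.
Qed.

Lemma measurable_is_derive (f df : R -> R) :
  (forall x, is_derive x (1 : R) f (df x)) -> measurable_fun [set: R] f.
Proof.
move=> fd; apply: continuous_measurable_fun => x.
apply: differentiable_continuous; apply/derivable1_diffP.
exact: (@ex_derive _ _ _ _ _ _ _ (fd x)).
Qed.

Lemma lip_continuous (f : R -> R) (K : R) :
  (forall x y, `|f x - f y| <= K * `|x - y|) -> continuous f.
Proof.
move=> fl x; have K0 : 0 <= K.
  by have := fl 1 0; rewrite subr0 normr1 mulr1; exact: le_trans.
apply/cvgrPdist_le => e e0; near=> y.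
have K1 : 0 < K + 1 by rewrite ltr_wpDl.
apply: le_trans (fl x y) _.
apply: (@le_trans _ _ ((K + 1) * `|x - y|)); first by rewrite ler_wpM2r// lerDl.
rewrite mulrC -ler_pdivlMr//; near: y.
by apply: cvgr_dist_le; [exact: cvg_id|rewrite divr_gt0 ?ltr_wpDl].
Unshelve. all: by end_near. Qed.

Lemma derive_ge0_le (f df : R -> R) (a b : R) : a <= b ->
  (forall x, a <= x -> is_derive x (1 : R) f (df x)) ->
  (forall x, a <= x -> 0 <= df x) -> f a <= f b.
Proof.
move=> ab fd df0.
have [||c] := @MVT_segment R f df a b ab.
- by move=> x; rewrite in_itv/= => /andP[/ltW ax _]; exact: (fd x ax).
- apply: derivable_within_continuous => x; rewrite in_itv/= => /andP[ax _].
  exact: (@ex_derive _ _ _ _ _ _ _ (fd x ax)).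
- rewrite in_itv/= => /andP[ac _] E.
  by rewrite -subr_ge0 E mulr_ge0 ?df0// subr_ge0.
Qed.

End MeanValue.

(** * Stein's equation *)

Section SteinTail.
Context {R : realType}.
Local Notation phi := (normal_pdf (0 : R) 1).

(** The derivative of - phi is x phi, so the lower bound on r says that
    (u - K) phi is nondecreasing on [a, +oo[; it vanishes at infinity, hence it
    is nonpositive at a. This replaces estimates of Mills' ratio. *)
Lemma tail_le (u r : R -> R) (a K : R) :
  (forall x, a <= x -> is_derive x (1 : R) (u \* phi) (r x * phi x)) ->
  (forall x, a <= x -> - (K * x) <= r x) ->
  u n%:R * phi n%:R @[n --> \oo] --> (0 : R) -> u a <= K.
Proof.
move=> ud rK u0.
pose D := (u \* phi) - (K *: phi).
have Dd x : a <= x -> is_derive x (1 : R) D (r x * phi x - K * (- x * phi x)).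
  by move=> ax; apply: is_deriveB; [exact: ud|apply: is_deriveZ; exact: is_derive_phi].
have Dge x : a <= x -> 0 <= r x * phi x - K * (- x * phi x).
  move=> ax; rewrite mulNr mulrN opprK mulrA -mulrDl mulr_ge0 ?normal_pdf_ge0//.
  by have := rK x ax; lra.
have D0 : D n%:R @[n --> \oo] --> (0 : R).
  rewrite -[X in _ --> X](subrr 0) -[X in 0 - X](mulr0 K).
  by apply: cvgB => //; apply: cvgM; [exact: cvg_cst|exact: cvg_phi].
have Da : D a <= 0.
  apply: (cvgr_to_ge D0); near=> n.
  apply: (derive_ge0_le _ Dd Dge).
  by near: n; exact: nbhs_infty_ger.
move: Da; rewrite /D /= subr_le0.
by rewrite [X in _ <= X -> _]/GRing.scale /= ler_pM2r ?phi_gt0.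
Unshelve. all: by end_near. Qed.

Lemma tail_bound (u r : R -> R) (a K : R) :
  (forall x, a <= x -> is_derive x (1 : R) (u \* phi) (r x * phi x)) ->
  (forall x, a <= x -> `|r x| <= K * x) ->
  u n%:R * phi n%:R @[n --> \oo] --> (0 : R) -> `|u a| <= K.
Proof.
move=> ud rK u0; rewrite ler_norml; apply/andP; split.
- rewrite lerNl; apply: (@tail_le (\- u) (\- r)).
  + move=> x ax; rewrite [X in is_derive _ _ X _](_ : _ = - (u \* phi)); last first.
      by apply/funext => y; rewrite /= mulNr.
    by rewrite /= mulNr; apply: is_deriveN; exact: ud.
  + by move=> x /rK; rewrite ler_norml /= lerN2 => /andP[].
  + rewrite (_ : (fun n => _) = (fun n => - (u n%:R * phi n%:R))); last first.
      by apply/funext => n; rewrite /= mulNr.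
    rewrite [X in X @ _ --> _](_ : _ = (fun n => - 1 * (u n%:R * phi n%:R))); last first.
      by apply/funext => n; rewrite mulN1r.
    by rewrite -[X in _ --> X](mulr0 (-1)); apply: cvgM => //; exact: cvg_cst.
- apply: (tail_le ud) => // x /rK; rewrite ler_norml => /andP[]//.
Qed.

(** For a negative a the tail on the left is used, by reflection. *)
Lemma stein_tail_bound (u r : R -> R) (a K : R) :
  (forall x, is_derive x (1 : R) (u \* phi) (r x * phi x)) ->
  u n%:R * phi n%:R @[n --> \oo] --> (0 : R) ->
  u (- n%:R) * phi (- n%:R) @[n --> \oo] --> (0 : R) ->
  (forall x, `|a| <= `|x| -> `|r x| <= K * `|x|) -> `|u a| <= K.
Proof.
move=> ud u0 u0N rK; have [a0|/ltW a0] := lerP 0 a.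
- apply: (@tail_bound u r) => // x ax.
  have x0 := le_trans a0 ax.
  by rewrite -[X in _ * X]ger0_norm// rK// !ger0_norm.
- rewrite -[a]opprK; apply: (@tail_bound (fun x => u (- x)) (fun x => - r (- x))) => //.
  + move=> x ax.
    rewrite [X in is_derive _ _ X _](_ : _ = (u \* phi) \o -%R); last first.
      by apply/funext => y; rewrite /= phiN.
    have -> : - r (- x) * phi x = (r (- x) * phi (- x)) * - 1 by rewrite phiN; ring.
    have := ud (- x); move=> udx.
    by apply: is_derive1_comp.
  + move=> x ax; have x0 : 0 <= x by apply: le_trans ax; rewrite oppr_ge0.
    by rewrite normrN -[X in _ * X](ger0_norm x0) -[`|x|]normrN rK// !normrN (ger0_norm x0) ler0_norm.
  + by under eq_fun do rewrite -phiN.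
Qed.

End SteinTail.

Section SteinSolution.
Context {R : realType}.
Local Notation mu := (@lebesgue_measure R).
Local Notation phi := (normal_pdf (0 : R) 1).
Local Notation N := (normal_prob (0 : R) 1).

Let c0 : R := \int[mu]_x (`|x| * phi x).

Let c0_ge0 : 0 <= c0.
Proof. by apply: Rintegral_ge0 => x _; rewrite mulr_ge0 ?normal_pdf_ge0. Qed.

Variable h : R -> R.
Hypothesis hlip : forall x y, `|h x - h y| <= `|x - y|.

Let continuous_h : continuous h.
Proof.
by apply: (@lip_continuous _ h 1) => x y; rewrite mul1r.
Qed.

Let measurable_h : measurable_fun [set: R] h.
Proof. exact: continuous_measurable_fun. Qed.

Let measurable_phi : measurable_fun [set: R] phi.
Proof. exact: measurable_normal_pdf. Qed.

Let integrable_phi : mu.-integrable setT (fun x => (phi x)%:E).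
Proof. exact: integrable_normal_pdf. Qed.

Let integrable_hphi : mu.-integrable setT (fun x => (h x * phi x)%:E).
Proof.
apply: (@le_integrable _ _ _ mu setT measurableT _
  (fun x => (`|h 0| * phi x)%:E + (`|x| * phi x)%:E)%E).
- by apply/measurable_EFinP; exact: measurable_funM.
- move=> x _; rewrite -EFinD !abse_EFin lee_fin -mulrDl !normrM.
  rewrite (ger0_norm (normal_pdf_ge0 _ _ x)) ler_wpM2r ?normal_pdf_ge0//.
  rewrite [leRHS]ger0_norm ?addr_ge0//.
  have := hlip x 0; rewrite subr0; have := ler_normD (h x - h 0) (h 0).
  by rewrite subrK; lra.
- apply: integrableD => //; last exact: integrable_norm_phi.
  by under eq_fun do rewrite EFinM; exact: integrableZl.
Qed.

Let Nh : R := fine 'E_N[h].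

Let Nh_int : N.-integrable setT (EFin \o h) /\ Nh = \int[mu]_x (h x * phi x).
Proof.
have [? E] := integral_normal_prob integrable_hphi measurable_h; split => //.
by rewrite /Nh unlock E.
Qed.

Let g x := h x - Nh.

Let integral_phi : \int[mu]_x (phi x) = 1.
Proof. by rewrite /Rintegral integral_normal_pdf. Qed.

Let integrable_cphi (c : R) : mu.-integrable setT (fun x => (c * phi x)%:E).
Proof. by under eq_fun do rewrite EFinM; exact: integrableZl. Qed.

Let integral_cphi (c : R) : \int[mu]_x (c * phi x) = c.
Proof. by rewrite RintegralZl ?integral_phi ?mulr1. Qed.

Let integrable_gphi : mu.-integrable setT (fun x => (g x * phi x)%:E).
Proof.
under eq_fun do rewrite mulrBl EFinB.
by apply: integrableB => //; exact: integrable_cphi.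
Qed.

Let integral_gphi : \int[mu]_x (g x * phi x) = 0.
Proof.
under eq_Rintegral do rewrite mulrBl.
rewrite RintegralB//; last exact: integrable_cphi.
by rewrite integral_cphi; have [_ <-] := Nh_int; rewrite subrr.
Qed.

Let g_le x : `|g x| <= `|x| + c0.
Proof.
have -> : g x = \int[mu]_y ((h x - h y) * phi y).
  under eq_Rintegral do rewrite mulrBl.
  rewrite RintegralB//; last exact: integrable_cphi.
  by rewrite integral_cphi; have [_ <-] := Nh_int.
have i1 : mu.-integrable setT (EFin \o (fun y => (h x - h y) * phi y)).
  rewrite /comp; under eq_fun do rewrite mulrBl EFinB.
  by apply: integrableB => //; exact: integrable_cphi.
have i2 : mu.-integrable setT (EFin \o (fun y => `|x| * phi y + `|y| * phi y)).
  rewrite /comp; under eq_fun do rewrite EFinD.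
  by apply: integrableD => //; exact: integrable_norm_phi.
apply: le_trans (le_normr_Rintegral _ _) _ => //.
have -> : `|x| + c0 = \int[mu]_y (`|x| * phi y + `|y| * phi y).
  rewrite RintegralD//; first by rewrite integral_cphi.
  - exact: integrable_cphi.
  - exact: integrable_norm_phi.
apply: le_Rintegral => //; first exact: integrable_norm i1.
move=> y _; rewrite -mulrDl normrM (ger0_norm (normal_pdf_ge0 _ _ y)).
rewrite ler_wpM2r ?normal_pdf_ge0//; apply: le_trans (hlip x y) _.
exact: ler_normB.
Qed.

(** The function f = F / phi solves f' - x f = g because F' = g phi. It is
    bounded because F also vanishes at +oo, the function g phi having integral
    0. *)
Let F x : R := \int[mu]_(t in `]-oo, x]) (g t * phi t).

Let is_derive_F x : is_derive x (1 : R) F (g x * phi x).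
Proof.
have [||||dF FE] := @continuous_FTC1 R (fun t => g t * phi t) -oo%O x (x + 1).
- by rewrite ltrDl.
- by apply: (integrableS _ _ _ integrable_gphi).
- by rewrite ltNyr.
- apply: cvgM; last exact: continuous_phi.
  by apply: cvgB; [exact: continuous_h|exact: cvg_cst].
apply: DeriveDef => //.
by rewrite -FE derive1E.
Qed.

(** Dominated convergence, with l the limit of the indicators of ]-oo, x_n]: it
    is 1 for x_n going to +oo and 0 for x_n going to -oo. *)
Let F_cvg_seq (x_ : nat -> R) (l : R -> R) :
  (forall t, \forall n \near \oo, (t <= x_ n)%R%:R = l t) ->
  F (x_ n) @[n --> \oo] --> \int[mu]_t (l t * (g t * phi t)).
Proof.
move=> xl.
have -> : (fun n => F (x_ n)) = (fun n => \int[mu]_t ((t <= x_ n)%R%:R * (g t * phi t))).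
  apply/funext => n; rewrite /F Rintegral_mkcond; apply: eq_Rintegral => t _.
  by rewrite patchE mem_setE in_itv/=; case: (t <= x_ n); rewrite (mul1r, mul0r).
have igp : mu.-integrable setT (fun x => `|g x * phi x|%:E).
  exact: integrable_norm integrable_gphi.
pose f_ n t := ((t <= x_ n)%R%:R * (g t * phi t))%:E.
have mf n : measurable_fun [set: R] (f_ n).
  apply/measurable_EFinP/measurable_funM => //.
    rewrite (_ : (fun t => _) = \1_(`]-oo, x_ n])).
      by apply: measurable_indic; exact: measurable_itv.
    by apply/funext => t; rewrite indicE mem_setE in_itv.
  by apply: measurable_funM => //; exact: measurable_funB.
have fcvg t : f_ ^~ t @ \oo --> (l t * (g t * phi t))%:E.
  apply: cvg_near_cst; near=> n; rewrite /f_; congr (_ * _)%:E.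
  by near: n; exact: xl.
have fle n t : (`|f_ n t| <= `|g t * phi t|%:E)%E.
  rewrite /f_ abse_EFin lee_fin normrM normr_nat ler_piMl//.
  by case: (t <= x_ n).
have mlim := emeasurable_fun_cvg _ _ mf (fun x _ => fcvg x).
have [||il _ /=] := @dominated_convergence _ (measurableTypeR R) R mu setT
  measurableT f_ _ _ mf mlim _ igp.
- by apply: aeW => t _; exact: fcvg.
- by apply: aeW => t n _; exact: fle.
rewrite /Rintegral => Fl; apply: fine_cvg; rewrite fineK//.
exact: integrable_fin_num.
Unshelve. all: by end_near. Qed.

Let F_cvgy : F n%:R @[n --> \oo] --> (0 : R).
Proof.
rewrite -integral_gphi; under [X in _ --> X]eq_Rintegral do rewrite -[X in X * _]mul1r -mulrA.
apply: F_cvg_seq => t; near=> n.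
suff -> : t <= n%:R by [].
by near: n; exact: nbhs_infty_ger.
Unshelve. all: by end_near. Qed.

Let F_cvgNy : F (- n%:R) @[n --> \oo] --> (0 : R).
Proof.
have -> : 0 = \int[mu]_t (0 * (g t * phi t)).
  by under eq_Rintegral do rewrite mul0r; rewrite Rintegral_cst// mul0r.
apply: F_cvg_seq => t; near=> n.
suff /lt_geF -> : - n%:R < t by [].
rewrite ltrNl; near: n; exact: nbhs_infty_gtr.
Unshelve. all: by end_near. Qed.

Let f x := F x / phi x.
Let f' x := g x + x * f x.

Let phi_neq0 x : phi x != 0.
Proof. by rewrite gt_eqF// phi_gt0. Qed.

Let fphi : f \* phi = F.
Proof. by apply/funext => x; rewrite /f /= divfK. Qed.

Let is_derive_f x : is_derive x (1 : R) f (f' x).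
Proof.
have -> : f = F * (fun y => (phi y)^-1) by [].
have dphi := is_derive_phi x.
have dV := is_deriveV (phi_neq0 x) dphi.
apply: is_derive_eq.
  exact: is_deriveM.
rewrite /f' /f /GRing.scale/=; field; exact: phi_neq0.
Qed.

Let K1 := (1 + c0) * (1 + 2 * phi 0 / phi 1).

Let f_le_far x : 1 <= `|x| -> `|f x| <= 1 + c0.
Proof.
move=> x1; apply: (@stein_tail_bound _ f g).
- by move=> y; rewrite fphi; exact: is_derive_F.
- by under eq_fun do rewrite -/((f \* phi) _) fphi.
- by under eq_fun do rewrite -/((f \* phi) _) fphi.
move=> y xy; apply: le_trans (g_le y) _.
rewrite mulrDl mul1r lerD2l ler_peMr//; exact: le_trans xy.
Qed.

Let f_le x : `|f x| <= K1.
Proof.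
have p0 := phi_gt0 (0 : R); have p1 := phi_gt0 (1 : R); have c0g := c0_ge0.
have K1E : K1 = (1 + c0) + (1 + c0) * (2 * phi 0 / phi 1) by rewrite /K1; ring.
have q0 : 0 <= (1 + c0) * (2 * phi 0 / phi 1).
  by rewrite mulr_ge0 ?addr_ge0// divr_ge0 ?mulr_ge0// ltW.
have [x1|/ltW x1] := lerP 1 `|x|.
  by apply: le_trans (f_le_far x1) _; rewrite K1E lerDl.
(* On [-1, 1] the tail bound degenerates; there F is within a bounded distance
   of F 1, and phi is at least phi 1. *)
have [z [E zx zx1]] := mean_value x 1 is_derive_F.
have phi1x : phi 1 <= phi x.
  rewrite !normal_pdf_exp ler_wpM2l ?normal_peak_ge0// ler_expR !subr0.
  have : `|x| ^+ 2 <= 1 by rewrite expr_le1.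
  by rewrite real_normK ?num_real// expr1n; lra.
have gle (y : R) : `|y| <= 1 -> `|g y * phi y| <= (1 + c0) * phi 0.
  move=> y1; rewrite normrM (ger0_norm (normal_pdf_ge0 _ _ y)).
  apply: ler_pM => //; rewrite ?normal_pdf_ge0 ?phi_le//.
  by apply: le_trans (g_le y) _; rewrite lerD2r.
have z1 : `|z| <= 1.
  move: x1 zx zx1; rewrite !ler_norml => /andP[x1 x2]; rewrite (@ger0_norm _ (1 - x)) ?subr_ge0//.
  by move=> /andP[? ?] /andP[? ?]; apply/andP; split; lra.
have F1 : `|F 1| <= (1 + c0) * phi 1.
  rewrite -fphi /= normrM (ger0_norm (ltW p1)) ler_wpM2r ?(ltW p1)//.
  by apply: f_le_far; rewrite normr1.
have Fx : `|F x| <= (1 + c0) * phi 1 + (1 + c0) * phi 0 * 2.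
  have -> : F x = F 1 - (g z * phi z) * (1 - x) by rewrite -E; ring.
  apply: le_trans (ler_normB _ _) _; apply: lerD => //.
  rewrite normrM; apply: ler_pM => //; first exact: gle.
  move: x1; rewrite ler_norml => /andP[? ?]; rewrite ger0_norm ?subr_ge0//; lra.
rewrite /f normrM normfV (ger0_norm (ltW (phi_gt0 x))) ler_pdivrMr ?phi_gt0//.
apply: le_trans Fx _; apply: le_trans (_ : K1 * phi 1 <= _).
  rewrite le_eqVlt; apply/orP; left; apply/eqP; rewrite /K1; field.
  exact: phi_neq0.
by rewrite ler_wpM2l// K1E addr_ge0// addr_ge0.
Qed.

(** The derivative f' = g + x f cannot be differentiated again, h being only
    Lipschitz. Its increments are controlled through v z = f (z + e) - f z,
    which satisfies v' - z v = r with a right-hand side r of order |e|: the tail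
    bound applies to v and gives |x v x| <= sup |r|. *)
Let f'_lip x y : `|f' x - f' y| <= 2 * (K1 + 1) * `|x - y|.
Proof.
pose e := y - x; pose M := `|e| * (K1 + 1).
pose v z := f (z + e) - f z.
pose r z := e * f (z + e) + (h (z + e) - h z).
have c0g := c0_ge0.
have K10 : 0 <= K1 by apply: le_trans (f_le 0).
have rM z : `|r z| <= M.
  rewrite /r /M mulrDr mulr1; apply: le_trans (ler_normD _ _) _; apply: lerD.
    by rewrite normrM ler_wpM2l// f_le.
  by apply: le_trans (hlip _ _) _; rewrite addrAC subrr add0r.
have v_le z : `|v z| <= K1 + K1 by apply: le_trans (ler_normB _ _) _; apply: lerD.
have dv z : is_derive z (1 : R) v (z * v z + r z).
  have dshift : is_derive z (1 : R) (fun y => f (y + e)) (f' (z + e)).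
    have -> : (fun y => f (y + e)) = f \o (fun y => y + e) by [].
    have dadd : is_derive z (1 : R) (fun y => y + e) 1.
      have -> : (fun y : R => y + e) = id + cst e by [].
      by apply: is_derive_eq; rewrite addr0.
    by rewrite -[f' _]mulr1; apply: is_derive1_comp.
  have -> : v = (fun y => f (y + e)) - f by [].
  have -> : z * v z + r z = f' (z + e) - f' z by rewrite /f' /v /r /g; ring.
  exact: is_deriveB.
have dvphi z : is_derive z (1 : R) (v \* phi) (r z * phi z).
  have -> : v \* phi = v * phi by [].
  have dphi := is_derive_phi z.
  by apply: is_derive_eq; rewrite /GRing.scale/=; ring.
have vphi0 : v n%:R * phi n%:R @[n --> \oo] --> (0 : R).
  apply: norm_cvg0; apply: (@squeeze_cvgr _ _ _ _ (fun=> 0) (fun n : nat => (K1 + K1) * phi n%:R)).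
  - apply: nearW => n; rewrite normr_ge0/= normrM (ger0_norm (normal_pdf_ge0 _ _ _)).
    by rewrite ler_wpM2r ?normal_pdf_ge0.
  - exact: cvg_cst.
  - by rewrite -[X in _ --> X](mulr0 (K1 + K1)); apply: cvgM; [exact: cvg_cst|exact: cvg_phi].
have vphi0N : v (- n%:R) * phi (- n%:R) @[n --> \oo] --> (0 : R).
  apply: norm_cvg0; apply: (@squeeze_cvgr _ _ _ _ (fun=> 0) (fun n : nat => (K1 + K1) * phi n%:R)).
  - apply: nearW => n; rewrite normr_ge0/= normrM (ger0_norm (normal_pdf_ge0 _ _ _)) phiN.
    by rewrite ler_wpM2r ?normal_pdf_ge0.
  - exact: cvg_cst.
  - by rewrite -[X in _ --> X](mulr0 (K1 + K1)); apply: cvgM; [exact: cvg_cst|exact: cvg_phi].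
have xv : `|x * v x| <= M.
  have [->|x0] := eqVneq x 0.
    by rewrite mul0r normr0 mulr_ge0// addr_ge0.
  have x0' : 0 < `|x| by rewrite normr_gt0.
  rewrite normrM mulrC -ler_pdivlMr//.
  apply: (stein_tail_bound dvphi vphi0 vphi0N) => z xz.
  apply: le_trans (rM z) _; rewrite -mulrA ler_peMr//.
    by rewrite mulr_ge0// addr_ge0.
  by rewrite mulrC ler_pdivlMr// mul1r.
have -> : f' x - f' y = - (x * v x + r x).
  by rewrite /f' /v /r /g /e subrKC; ring.
rewrite normrN; apply: le_trans (ler_normD _ _) _.
have -> : 2 * (K1 + 1) * `|x - y| = M + M by rewrite /M /e (distrC y); ring.
exact: lerD.
Qed.

Let f'_le x : `|f' x| <= 2 * K1 + 2 * (K1 + 1).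
Proof.
have K10 : 0 <= K1 by apply: le_trans (f_le 0).
have [z [E _ zx]] := mean_value (x + 1) x is_derive_f.
have -> : f' x = f' x - f' z - (f x - f (x + 1)) by rewrite E; ring.
apply: le_trans (ler_normB _ _) _; rewrite addrC; apply: lerD.
  by apply: le_trans (ler_normB _ _) _; rewrite mulr_natl; apply: lerD; exact: f_le.
apply: le_trans (f'_lip x z) _; rewrite ler_piMr ?mulr_ge0 ?addr_ge0//.
rewrite distrC; apply: le_trans zx _.
by rewrite opprD addNKr normrN1.
Qed.

Lemma stein_solution_h :
  let K := 4 * ((1 + \int[mu]_x (`|x| * phi x)) * (1 + 2 * phi 0 / phi 1)) + 2 in
  N.-integrable setT (EFin \o h) /\
  exists f f' : R -> R,
    [/\ forall x, is_derive x (1 : R) f (f' x),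
        forall x, f' x - x * f x = h x - fine 'E_N[h],
        forall x, `|f x| <= K,
        forall x, `|f' x| <= K
      & forall x y, `|f' x - f' y| <= K * `|x - y|].
Proof.
move=> K; split; first by have [] := Nh_int.
have K10 : 0 <= K1 by apply: le_trans (f_le 0).
have KE : K = 4 * K1 + 2 by [].
exists f, f'; split.
- exact: is_derive_f.
- by move=> x; rewrite /f' addrK.
- by move=> x; apply: le_trans (f_le x) _; rewrite KE; lra.
- by move=> x; apply: le_trans (f'_le x) _; rewrite KE; lra.
- by move=> x y; apply: le_trans (f'_lip x y) _; rewrite ler_wpM2r// KE; lra.
Qed.

End SteinSolution.

(** The supremum over h in the Wasserstein distance is why K has to be uniform
    in h. *)
Theorem stein_solution (R : realType) : exists2 K : R, 0 < K &
  forall h : R -> R, (forall x y, `|h x - h y| <= `|x - y|) ->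
  (normal_prob (0 : R) 1).-integrable setT (EFin \o h) /\
  exists f f' : R -> R,
    [/\ forall x, is_derive x (1 : R) f (f' x),
        forall x, f' x - x * f x = h x - fine 'E_(normal_prob (0 : R) 1)[h],
        forall x, `|f x| <= K,
        forall x, `|f' x| <= K
      & forall x y, `|f' x - f' y| <= K * `|x - y|].
Proof.
eexists; last by move=> h; exact: stein_solution_h.
rewrite ltr_wpDl// mulr_ge0// mulr_ge0// addr_ge0//.
  by apply: Rintegral_ge0 => x _; rewrite mulr_ge0 ?normal_pdf_ge0.
by rewrite divr_ge0// ?mulr_ge0// normal_pdf_ge0.
Qed.

(** * Variables with a finite third moment *)

Section Moments.
Context {d : measure_display} {T : measurableType d} {R : realType}.
Variable P : probability T R.
Implicit Types f g h : T -> R.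

Definition L1 f := P.-integrable setT (EFin \o f).

Lemma L1_measurable f : L1 f -> measurable_fun [set: T] f.
Proof. by move=> /integrableP[/measurable_EFinP]. Qed.

Lemma mean_EFin f : L1 f -> 'E_P[f]%E = (mean P f)%:E.
Proof. by move=> fi; rewrite /mean unlock fineK// integrable_fin_num. Qed.

Lemma meanE f : mean P f = \int[P]_x f x.
Proof. by rewrite /mean unlock. Qed.

Lemma L1_dom f g : measurable_fun [set: T] f -> (forall t, `|f t| <= g t) ->
  L1 g -> L1 f.
Proof.
move=> mf fg; apply: le_integrable => //; first exact/measurable_EFinP.
move=> t _; rewrite /= lee_fin; apply: le_trans (fg t) _; exact: ler_norm.
Qed.

Lemma L1_cst (c : R) : L1 (fun=> c).
Proof. exact: finite_measure_integrable_cst. Qed.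

Lemma L1D f g : L1 f -> L1 g -> L1 (fun t => f t + g t).
Proof. by move=> fi gi; exact: (integrableD measurableT fi gi). Qed.

Lemma L1B f g : L1 f -> L1 g -> L1 (fun t => f t - g t).
Proof. by move=> fi gi; exact: (integrableB measurableT fi gi). Qed.

Lemma L1Z (c : R) f : L1 f -> L1 (fun t => c * f t).
Proof.
move=> fi; rewrite /L1 (_ : _ \o _ = (fun t => c%:E * (EFin \o f) t)%E).
  exact: integrableZl.
by apply/funext => t /=; rewrite EFinM.
Qed.

Lemma L1_norm f : L1 f -> L1 (fun t => `|f t|).
Proof. by move=> fi; exact: integrable_norm. Qed.

Lemma L1_sum (I : Type) (r : seq I) (Q : pred I) (F : I -> T -> R) :
  (forall i, Q i -> L1 (F i)) -> L1 (fun t => \sum_(i <- r | Q i) F i t).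
Proof.
move=> Fi; elim: r => [|i r IH].
  by under eq_fun do rewrite big_nil; exact: L1_cst.
under eq_fun do rewrite big_cons.
by case Qi: (Q i) => //; apply: L1D => //; exact: Fi.
Qed.

Lemma mean_cst (c : R) : mean P (fun=> c) = c.
Proof. by rewrite /mean (_ : (fun=> c) = cst c)// expectation_cst. Qed.

Lemma meanD f g : L1 f -> L1 g -> mean P (fun t => f t + g t) = mean P f + mean P g.
Proof. by move=> fi gi; rewrite !meanE RintegralD. Qed.

Lemma meanB f g : L1 f -> L1 g -> mean P (fun t => f t - g t) = mean P f - mean P g.
Proof. by move=> fi gi; rewrite !meanE RintegralB. Qed.

Lemma meanZ (c : R) f : L1 f -> mean P (fun t => c * f t) = c * mean P f.
Proof. by move=> fi; rewrite !meanE RintegralZl. Qed.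

Lemma mean_sum (I : Type) (r : seq I) (Q : pred I) (F : I -> T -> R) :
  (forall i, Q i -> L1 (F i)) ->
  mean P (fun t => \sum_(i <- r | Q i) F i t) = \sum_(i <- r | Q i) mean P (F i).
Proof.
move=> Fi; elim: r => [|i r IH].
  by under eq_fun do rewrite big_nil; rewrite big_nil mean_cst.
under eq_fun do rewrite big_cons.
rewrite big_cons; case Qi: (Q i) => //; rewrite meanD ?IH//; first exact: Fi.
exact: L1_sum.
Qed.

Lemma le_mean f g : L1 f -> L1 g -> (forall t, f t <= g t) -> mean P f <= mean P g.
Proof. by move=> fi gi fg; rewrite !meanE; apply: le_Rintegral. Qed.

Lemma mean_ge0 f : (forall t, 0 <= f t) -> 0 <= mean P f.
Proof. by move=> f0; rewrite meanE; apply: Rintegral_ge0. Qed.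

Lemma norm_mean_le f : L1 f -> `|mean P f| <= mean P (fun t => `|f t|).
Proof. by move=> fi; rewrite !meanE; apply: le_normr_Rintegral. Qed.

(** Measurability is required separately since it does not follow from that of
    the third power of the absolute value. *)
Definition L3 f := measurable_fun [set: T] f /\ L1 (fun t => `|f t| ^+ 3).

Lemma L3_measurable f : L3 f -> measurable_fun [set: T] f. Proof. by case. Qed.

Lemma measurable_norm3 f : measurable_fun [set: T] f ->
  measurable_fun [set: T] (fun t => `|f t| ^+ 3).
Proof.
move=> mf; apply: (@measurable_funX _ _ _ _ (fun t => `|f t|)).
by apply: measurableT_comp => //; exact: normr_measurable.
Qed.

Lemma L3_dom f g : measurable_fun [set: T] f -> (forall t, `|f t| <= g t) ->
  L3 g -> L3 f.
Proof.
move=> mf fg [mg gi]; split=> //; apply: L1_dom gi; first exact: measurable_norm3.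
move=> t; rewrite ger0_norm ?exprn_ge0//; apply: lerXn2r; rewrite ?nnegrE//.
by apply: le_trans (fg t) _; exact: ler_norm.
Qed.

Lemma L3_cst (c : R) : L3 (fun=> c).
Proof. by split=> //; exact: L1_cst. Qed.

Lemma L3Z (c : R) f : L3 f -> L3 (fun t => c * f t).
Proof.
move=> [mf fi]; split; first exact: measurable_funM.
by under eq_fun do rewrite normrM exprMn; exact: L1Z.
Qed.

Lemma L3N f : L3 f -> L3 (fun t => - f t).
Proof. by move=> /(L3Z (-1)); under eq_fun do rewrite mulN1r. Qed.

Lemma L3_norm f : L3 f -> L3 (fun t => `|f t|).
Proof.
move=> [mf fi]; split; last by under eq_fun do rewrite normr_id.
by apply: measurableT_comp => //; exact: normr_measurable.
Qed.

Lemma L3D f g : L3 f -> L3 g -> L3 (fun t => f t + g t).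
Proof.
move=> [mf fi] [mg gi]; split; first exact: measurable_funD.
have := L1Z 4 (L1D fi gi); apply: L1_dom.
  exact/measurable_norm3/measurable_funD.
move=> t; rewrite ger0_norm ?exprn_ge0//.
apply: (@le_trans _ _ ((`|f t| + `|g t|) ^+ 3)).
  by apply: lerXn2r; rewrite ?nnegrE ?addr_ge0// ler_normD.
have := normr_ge0 (f t); have := normr_ge0 (g t).
move: `|f t| `|g t| => x y y0 x0.
have -> : 4 * (x ^+ 3 + y ^+ 3) = (x + y) ^+ 3 + 3 * ((x + y) * (x - y) ^+ 2) by ring.
by rewrite lerDl mulr_ge0// mulr_ge0 ?addr_ge0// sqr_ge0.
Qed.

Lemma L3B f g : L3 f -> L3 g -> L3 (fun t => f t - g t).
Proof. by move=> fi /L3N gi; exact: L3D. Qed.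

Lemma L3_sum (I : Type) (r : seq I) (Q : pred I) (F : I -> T -> R) :
  (forall i, Q i -> L3 (F i)) -> L3 (fun t => \sum_(i <- r | Q i) F i t).
Proof.
move=> Fi; elim: r => [|i r IH].
  by under eq_fun do rewrite big_nil; exact: L3_cst.
under eq_fun do rewrite big_cons.
by case Qi: (Q i) => //; apply: L3D => //; exact: Fi.
Qed.

(** The largest of the three factors bounds the product; this is what makes
    products of three variables with a third moment integrable. *)
Lemma young3 (x y z : R) : `|x * y * z| <= `|x| ^+ 3 + `|y| ^+ 3 + `|z| ^+ 3.
Proof.
rewrite !normrM; have := normr_ge0 x; have := normr_ge0 y; have := normr_ge0 z.
move: `|x| `|y| `|z| => {x y z} a b c c0 b0 a0.
have h (u v w : R) : 0 <= u -> 0 <= v -> 0 <= w -> v <= u -> w <= u ->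
    u * v * w <= u ^+ 3.
  by move=> u0 v0 w0 vu wu; rewrite !exprSr mul1r; apply: ler_pM => //; [exact: mulr_ge0|exact: ler_pM].
have := exprn_ge0 3 a0; have := exprn_ge0 3 b0; have := exprn_ge0 3 c0.
move=> c3 b3 a3; have [ab|/ltW ba] := lerP a b.
  have [bc|/ltW cb] := lerP b c.
    by have := h c a b c0 a0 b0 (le_trans ab bc) bc; rewrite -mulrA mulrC; lra.
  by have := h b a c b0 a0 c0 ab cb; rewrite (mulrC b a); lra.
have [ac|/ltW ca] := lerP a c.
  by have := h c a b c0 a0 b0 ac (le_trans ba ac); rewrite -mulrA mulrC; lra.
by have := h a b c a0 b0 c0 ba ca; lra.
Qed.

Lemma L1_mul3 f g h : L3 f -> L3 g -> L3 h -> L1 (fun t => f t * g t * h t).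
Proof.
move=> [mf fi] [mg gi] [mh hi]; have := L1D (L1D fi gi) hi; apply: L1_dom.
  by apply: measurable_funM => //; exact: measurable_funM.
by move=> t; exact: young3.
Qed.

Lemma L1_mul2 f g : L3 f -> L3 g -> L1 (fun t => f t * g t).
Proof.
by move=> fi gi; have := L1_mul3 fi gi (L3_cst 1); under eq_fun do rewrite mulr1.
Qed.

Lemma L3_L1 f : L3 f -> L1 f.
Proof. by move=> fi; have := L1_mul2 fi (L3_cst 1); under eq_fun do rewrite mulr1. Qed.

Lemma L3M_bounded f g (K : R) : L3 f -> measurable_fun [set: T] g ->
  (forall t, `|g t| <= K) -> L3 (fun t => f t * g t).
Proof.
move=> fi mg gK; apply: L3_dom (L3Z K (L3_norm fi)).
  by apply: measurable_funM => //; exact: L3_measurable.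
by move=> t; rewrite normrM mulrC ler_wpM2r.
Qed.

Lemma L3_bounded g (K : R) : measurable_fun [set: T] g ->
  (forall t, `|g t| <= K) -> L3 g.
Proof. by move=> mg gK; apply: L3_dom (L3_cst K). Qed.

End Moments.

(** * Grouping independent sigma-algebras *)

Section Independence.
Context {d : measure_display} {T : measurableType d} {R : realType}.
Variable P : probability T R.
Variables (E : finType) (F : E -> set (set T)).
Hypothesis F_sigma : forall i, sigma_algebra setT (F i).
Hypothesis F_meas : forall i, F i `<=` measurable.
Hypothesis F_indep : mutually_independent P F.

Definition family_union (J : {set E}) : set (set T) := \bigcup_(i in [set` J]) F i.

(** Measurability for the generated sigma-algebra makes the stability of this
    notion under sums, products and composition that of measurability. *)
Definition depends_on (J : {set E}) (U : T -> R) : Prop :=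
  measurable_fun [set: g_sigma_algebraType (family_union J)] (U : g_sigma_algebraType (family_union J) -> R).

(** A pi-system that generates the same sigma-algebra as the union of the F i
    and on which independence is the product rule. *)
Let cyl (J : {set E}) : set (set T) :=
  [set A | exists2 a : E -> set T, (forall i, i \in J -> F i (a i)) &
     A = \bigcap_(i in [set` J]) a i].

Let cylI J : setI_closed (cyl J).
Proof.
move=> _ _ [a Fa ->] [b Fb ->]; exists (fun i => a i `&` b i); last by rewrite bigcapI.
move=> i iJ; have := Fa i iJ; have := Fb i iJ.
rewrite -(sigma_algebra_id (F_sigma i)) => Bi Ai.
exact: (@measurableI _ (g_sigma_algebraType (F i))).
Qed.

Let cylT J : cyl J setT.
Proof.
exists (fun=> setT); last by rewrite bigcapT.
by move=> i _; have [F0 FC _] := F_sigma i; rewrite -(setD0 setT); exact: FC.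
Qed.

Let cyl_measurable J : cyl J `<=` measurable.
Proof.
move=> _ [a Fa ->]; apply: fin_bigcap_measurable => //.
by move=> i iJ; apply: (@F_meas i); exact: Fa.
Qed.

Let sub_cyl J : family_union J `<=` cyl J.
Proof.
move=> A [i iJ Ai]; exists (fun j => if j == i then A else setT).
  move=> j _; case: eqP => [->//|_].
  by have [F0 FC _] := F_sigma j; rewrite -(setD0 setT); exact: FC.
rewrite predeqE => t; split=> [At j _|/(_ i iJ)]; first by case: ifP.
by rewrite eqxx.
Qed.

Let indep_cyl (J K : {set E}) A B : (forall i, i \in J -> i \notin K) -> cyl J A -> cyl K B ->
  P (A `&` B) = (P A * P B)%E.
Proof.
move=> JK [a Fa ->] [b Fb ->].
pose c i := if i \in J then a i else b i.
have Fc i : i \in J :|: K -> F i (c i).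
  by rewrite inE /c; case: ifP => [iJ _|_ /= iK]; [exact: Fa|exact: Fb].
have cJ i : i \in J -> c i = a i by rewrite /c => ->.
have cK i : i \in K -> c i = b i.
  by move=> iK; rewrite /c; case: ifP => // /JK; rewrite iK.
have -> : \bigcap_(i in [set` J]) a i `&` \bigcap_(i in [set` K]) b i =
    \bigcap_(i in [set` (J :|: K)%SET]) c i.
  rewrite predeqE => t; split=> [[ta tb] i /=|tc].
    by rewrite inE => /orP[iJ|iK]; [rewrite cJ//; exact: ta|rewrite cK//; exact: tb].
  split=> i iJ.
    by rewrite -cJ//; apply: tc; rewrite /= inE iJ.
  by rewrite -cK//; apply: tc; rewrite /= inE iJ orbT.
have dJK : fintype.disjoint (mem J) (mem K).
  by rewrite disjoint_subset; apply/fintype.subsetP => i iJ; rewrite inE; exact: JK.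
rewrite F_indep// (eq_bigl [predU J & K]); last by move=> i; rewrite !inE.
rewrite bigU//=; congr (_ * _)%E.
  rewrite -F_indep; last by move=> i iJ; rewrite cJ//; exact: Fa.
  by congr (P _); apply: eq_bigcapr => i iJ; rewrite cJ.
rewrite -F_indep; last by move=> i iK; rewrite cK//; exact: Fb.
by congr (P _); apply: eq_bigcapr => i iK; rewrite cK.
Qed.

(** For a fixed B both sides are finite measures in A, and two finite measures
    that agree on a pi-system agree on the sigma-algebra that it generates. *)
Let extend_pi (G : set (set T)) (B : set T) : G `<=` measurable -> setI_closed G ->
  G setT -> measurable B -> (forall A, G A -> P (A `&` B) = (P A * P B)%E) ->
  forall A, <<s G >> A -> P (A `&` B) = (P A * P B)%E.
Proof.
move=> Gm GI GT mB GB A sA.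
have PB0 : 0 <= fine (P B) by rewrite fine_ge0.
have PBE : (P B = (NngNum PB0)%:num%:E)%E by rewrite /= fineK// fin_num_measure.
rewrite muleC PBE.
apply: (@g_sigma_algebra_measure_unique _ _ _ G Gm (fun=> setT) _ _
  (mrestr P mB) (mscale (NngNum PB0) P)) => //.
- by rewrite bigcup_const.
- move=> C GC; transitivity (P (C `&` B)) => //.
  by rewrite GB// muleC; exact: (congr1 (fun z => z * P C)%E PBE).
- move=> _; apply: (@le_lt_trans _ _ 1%E); last exact: ltry.
  by apply: probability_le1; rewrite setTI.
Qed.

(** The product rule is extended from cylinders to one generated sigma-algebra
    after the other. *)
Lemma indep_generated (J K : {set E}) (A B : set T) : (forall i, i \in J -> i \notin K) ->
  <<s family_union J >> A -> <<s family_union K >> B -> P (A `&` B) = (P A * P B)%E.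
Proof.
move=> JK sA sB.
have sub L : <<s family_union L >> `<=` <<s cyl L >>.
  apply: smallest_sub; first exact: smallest_sigma_algebra.
  by move=> C CL; apply: sub_sigma_algebra; exact: sub_cyl.
have scyl L : <<s cyl L >> `<=` measurable.
  by apply: smallest_sub; [exact: sigma_algebra_measurable|exact: cyl_measurable].
apply: (extend_pi (@cyl_measurable J) (@cylI J) (cylT J)); last exact: sub.
  by apply: (scyl K); exact: sub.
move=> A' cA'; rewrite setIC muleC.
apply: (extend_pi (@cyl_measurable K) (@cylI K) (cylT K)); last exact: sub.
  exact: cyl_measurable cA'.
by move=> B' cB'; rewrite setIC muleC; exact: (indep_cyl JK).
Qed.

Lemma family_union_measurable J : <<s family_union J >> `<=` measurable.
Proof.
apply: smallest_sub; first exact: sigma_algebra_measurable.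
by move=> A [i _]; exact: F_meas.
Qed.

Lemma depends_on_measurable J U : depends_on J U -> measurable_fun [set: T] U.
Proof.
move=> mU _ A mA; rewrite setTI; apply: (@family_union_measurable J).
by have := mU measurableT A mA; rewrite setTI.
Qed.

Lemma depends_on_sub (J K : {set E}) U : J \subset K -> depends_on J U -> depends_on K U.
Proof.
move=> /fintype.subsetP JK dU _ A mA.
suff : <<s family_union J >> `<=` <<s family_union K >>.
  by apply; exact: dU.
apply: smallest_sub; first exact: smallest_sigma_algebra.
by move=> B [i iJ FB]; apply: sub_sigma_algebra; exists i => //; exact: JK.
Qed.

Lemma depends_on_gen (J : {set E}) i U : i \in J ->
  (forall A : set R, measurable A -> F i (U @^-1` A)) -> depends_on J U.
Proof.
by move=> iJ FU _ A mA; apply: sub_sigma_algebra; exists i => //; rewrite setTI; exact: FU.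
Qed.

Lemma depends_on_cst (J : {set E}) (c : R) : depends_on J (fun=> c).
Proof. exact: measurable_cst. Qed.

Lemma depends_onD (J : {set E}) U V : depends_on J U -> depends_on J V ->
  depends_on J (fun t => U t + V t).
Proof. by move=> dU dV; exact: measurable_funD. Qed.

Lemma depends_onM (J : {set E}) U V : depends_on J U -> depends_on J V ->
  depends_on J (fun t => U t * V t).
Proof. by move=> dU dV; exact: measurable_funM. Qed.

Lemma depends_on_comp (J : {set E}) (g : R -> R) U : measurable_fun [set: R] g ->
  depends_on J U -> depends_on J (fun t => g (U t)).
Proof. by move=> mg dU; exact: (@measurableT_comp _ _ _ _ _ _ g). Qed.

Lemma depends_on_sum (I : Type) (r : seq I) (Q : pred I) (J : {set E}) (U : I -> T -> R) :
  (forall i, Q i -> depends_on J (U i)) ->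
  depends_on J (fun t => \sum_(i <- r | Q i) U i t).
Proof.
move=> dU; elim: r => [|i r IH].
  by under eq_fun do rewrite big_nil; exact: depends_on_cst.
under eq_fun do rewrite big_cons.
by case Qi: (Q i) => //; apply: depends_onD => //; exact: dU.
Qed.

Lemma depends_on_prod (I : Type) (r : seq I) (Q : pred I) (J : {set E}) (U : I -> T -> R) :
  (forall i, Q i -> depends_on J (U i)) ->
  depends_on J (fun t => \prod_(i <- r | Q i) U i t).
Proof.
move=> dU; elim: r => [|i r IH].
  by under eq_fun do rewrite big_nil; exact: depends_on_cst.
under eq_fun do rewrite big_cons.
by case Qi: (Q i) => //; apply: depends_onM => //; exact: dU.
Qed.

(** The law of the pair (U, V) is the product of the laws of U and V, since the
    two agree on rectangles; the claim is then Fubini's theorem for the function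
    (x, y) |-> x y. *)
Lemma indep_mean (J K : {set E}) (U V : T -> R) : (forall i, i \in J -> i \notin K) ->
  depends_on J U -> depends_on K V ->
  L1 P U -> L1 P V -> L1 P (fun t => U t * V t) ->
  mean P (fun t => U t * V t) = mean P U * mean P V.
Proof.
move=> JK dU dV iU iV iUV.
have mU := depends_on_measurable dU; have mV := depends_on_measurable dV.
pose U' : {RV P >-> R} := mfun_Sub (mem_set mU).
pose V' : {RV P >-> R} := mfun_Sub (mem_set mV).
have mW : measurable_fun [set: T] (fun t => (U t, V t)) by exact: measurable_fun_pair.
pose W' : {RV P >-> (R * R)%type} := mfun_Sub (mem_set mW).
pose m1 := distribution P U'; pose m2 := distribution P V'; pose m := distribution P W'.
have mE X : measurable X -> (m1 \x m2)%E X = m X.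
  apply: product_measure_unique => A B mA mB.
  change (P (U @^-1` A `&` V @^-1` B) = P (U @^-1` A) * P (V @^-1` B))%E.
  apply: (indep_generated JK).
    by have := dU measurableT A mA; rewrite setTI.
  by have := dV measurableT B mB; rewrite setTI.
have mxy : measurable_fun [set: R * R] (fun z : R * R => z.1 * z.2).
  by apply: measurable_funM.
have ixy : (m1 \x m2)%E.-integrable setT (fun z : R * R => (z.1 * z.2)%:E).
  apply/integrableP; split; first exact/measurable_EFinP.
  rewrite (eq_measure_integral m); last by move=> A mA _; exact: mE.
  rewrite /m /distribution ge0_integral_pushforward//=; last first.
    by apply/measurable_EFinP/measurableT_comp => //; exact: normr_measurable.
  by have /integrableP[] := iUV.
rewrite /mean unlock.
have -> : (\int[P]_w (U w * V w)%:E = \int[m]_z (z.1 * z.2)%:E)%E.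
  rewrite /m /distribution integral_pushforward//=.
    exact/measurable_EFinP.
rewrite (eq_measure_integral (m1 \x m2)%E); last first.
  by move=> A mA _; exact: (esym (mE A mA)).
rewrite -integral12_prod_meas1//.
have EU : (\int[m1]_x x%:E = (mean P U)%:E)%E.
  by rewrite -mean_EFin// unlock /m1 /distribution integral_pushforward//=.
have EV : (\int[m2]_x x%:E = (mean P V)%:E)%E.
  by rewrite -mean_EFin// unlock /m2 /distribution integral_pushforward//=.
have i1 : m1.-integrable setT (EFin : R -> \bar R).
  by apply: integrable_pushforward.
have i2 : m2.-integrable setT (EFin : R -> \bar R).
  by apply: integrable_pushforward.
transitivity (fine (\int[m1]_x (x%:E * (mean P V)%:E))%E).
  by congr fine; apply: eq_integral => x _; rewrite -EV -integralZl.
by rewrite integralZr// EU -EFinM /= /mean unlock.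
Qed.

End Independence.

(** * Stein's method under local dependence *)

Section LocalDependence.
Context {d : measure_display} {T : measurableType d} {R : realType}.
Variable P : probability T R.
Variables (E : finType) (F : E -> set (set T)).
Hypothesis F_sigma : forall i, sigma_algebra setT (F i).
Hypothesis F_meas : forall i, F i `<=` measurable.
Hypothesis F_indep : mutually_independent P F.

Variables (I : finType) (supp : I -> {set E}) (xi : I -> T -> R).
Hypothesis xi_supp : forall i, depends_on F (supp i) (xi i).
Hypothesis xi_L3 : forall i, L3 P (xi i).
Hypothesis xi_mean : forall i, mean P (xi i) = 0.

Definition touches : rel I := fun i j => supp i :&: supp j != finset.set0.

Let touchesN i j e : ~~ touches i j -> e \in supp i -> e \notin supp j.
Proof.
rewrite negbK => /eqP ij0 ei; apply/negP => ej.
by have := finset.in_set0 e; rewrite -ij0 inE ei ej.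
Qed.

Let S t := \sum_i xi i t.
(** The part of the sum that is independent of xi i, and the part that is
    independent of the pair (xi i, xi j). *)
Let away1 i t := \sum_(j | ~~ touches i j) xi j t.
Let away2 i j t := \sum_(k | ~~ (touches i k || touches j k)) xi k t.

Let S_split (Q : pred I) t : S t = \sum_(j | Q j) xi j t + \sum_(j | ~~ Q j) xi j t.
Proof. by rewrite /S (bigID Q). Qed.

Let xi_L1 i : L1 P (xi i). Proof. exact: L3_L1. Qed.

Let L3_comp (g : R -> R) (K : R) (V : T -> R) : measurable_fun [set: R] g ->
  (forall x, `|g x| <= K) -> measurable_fun [set: T] V -> L3 P (fun t => g (V t)).
Proof.
move=> mg gK mV; apply: (L3_bounded P _ (fun t => gK (V t))).
exact: (@measurableT_comp _ _ _ _ _ _ g).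
Qed.

Let sum_L3 (Q : pred I) : L3 P (fun t => \sum_(j | Q j) xi j t).
Proof. exact: L3_sum. Qed.

Let indep_away1 i (g : R -> R) (K : R) : measurable_fun [set: R] g ->
  (forall x, `|g x| <= K) -> mean P (fun t => xi i t * g (away1 i t)) = 0.
Proof.
move=> mg gK; pose V := \bigcup_(j | ~~ touches i j) supp j.
have iaw : L3 P (fun t => g (away1 i t)).
  by apply: (L3_comp mg gK); exact: L3_measurable (sum_L3 _).
rewrite (indep_mean F_sigma F_meas F_indep (J := supp i) (K := V)).
- by rewrite xi_mean mul0r.
- move=> e ei; apply/negP => /finset.bigcupP[j ij ej].
  by move: (touchesN ij ei); rewrite ej.
- exact: xi_supp.
- apply: depends_on_comp mg _; apply: depends_on_sum => j ij.
  exact: (depends_on_sub (finset.bigcup_sup j ij) (@xi_supp j)).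
- exact: xi_L1.
- exact: L3_L1.
- exact: L1_mul2.
Qed.

Let indep_pair i j : ~~ touches i j -> mean P (fun t => xi i t * xi j t) = 0.
Proof.
move=> ij; rewrite (indep_mean F_sigma F_meas F_indep (J := supp i) (K := supp j)).
- by rewrite xi_mean mul0r.
- by move=> e; exact: touchesN.
- exact: xi_supp.
- exact: xi_supp.
- exact: xi_L1.
- exact: xi_L1.
- exact: L1_mul2.
Qed.

Let indep_away2 i j (g : R -> R) (K : R) : measurable_fun [set: R] g ->
  (forall x, `|g x| <= K) ->
  mean P (fun t => xi i t * xi j t * g (away2 i j t)) =
  mean P (fun t => xi i t * xi j t) * mean P (fun t => g (away2 i j t)).
Proof.
move=> mg gK; pose V := \bigcup_(k | ~~ (touches i k || touches j k)) supp k.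
have iaw : L3 P (fun t => g (away2 i j t)).
  by apply: (L3_comp mg gK); exact: L3_measurable (sum_L3 _).
apply: (indep_mean F_sigma F_meas F_indep (J := supp i :|: supp j) (K := V)).
- move=> e; rewrite inE => eij; apply/negP => /finset.bigcupP[k].
  rewrite negb_or => /andP[ik jk] ek.
  by move: eij => /orP[/(touchesN ik)|/(touchesN jk)]; rewrite ek.
- apply: depends_onM.
    exact: (depends_on_sub (finset.subsetUl _ _) (@xi_supp i)).
  exact: (depends_on_sub (finset.subsetUr _ _) (@xi_supp j)).
- apply: depends_on_comp mg _; apply: depends_on_sum => k ijk.
  exact: (depends_on_sub (finset.bigcup_sup k ijk) (@xi_supp k)).
- exact: L1_mul2.
- exact: L3_L1.
- exact: L1_mul3.
Qed.

Variables (f f' : R -> R) (K : R).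
Hypothesis fd : forall x, is_derive x (1 : R) f (f' x).
Hypothesis f_le : forall x, `|f x| <= K.
Hypothesis f'_le : forall x, `|f' x| <= K.
Hypothesis f'_lip : forall x y, `|f' x - f' y| <= K * `|x - y|.

Let K_ge0 : 0 <= K. Proof. exact: le_trans (f_le 0). Qed.

Let measurable_f : measurable_fun [set: R] f.
Proof. exact: measurable_is_derive fd. Qed.

Let measurable_f' : measurable_fun [set: R] f'.
Proof. exact: continuous_measurable_fun (lip_continuous f'_lip). Qed.

Let taylor2 x y : `|f y - f x - (y - x) * f' y| <= K * (y - x) ^+ 2.
Proof.
have [c [fE _ cy]] := mean_value x y fd.
have -> : f y - f x - (y - x) * f' y = (f' c - f' y) * (y - x) by rewrite fE; ring.
rewrite normrM -[(y - x) ^+ 2]ger0_norm ?sqr_ge0// normrX expr2 mulrA.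
rewrite ler_wpM2r//; apply: le_trans (f'_lip c y) _.
by rewrite ler_wpM2l.
Qed.

Let s := Num.sqrt (mean P (fun t => S t ^+ 2)).
Hypothesis s_gt0 : 0 < mean P (fun t => S t ^+ 2).

Let s0 : 0 < s. Proof. by rewrite sqrtr_gt0. Qed.
Let s2 : s ^+ 2 = mean P (fun t => S t ^+ 2).
Proof. by rewrite sqr_sqrtr// ltW. Qed.

Let W t := S t / s.

Let m3 i j k := mean P (fun t => `|xi i t * xi j t * xi k t|).
Let m2 i j := mean P (fun t => `|xi i t * xi j t|).
Let m1 i := mean P (fun t => `|xi i t|).

Let mS : measurable_fun [set: T] S. Proof. exact: L3_measurable (sum_L3 _). Qed.
Let mW : measurable_fun [set: T] W. Proof. exact: measurable_funM. Qed.

Let fW_L3 : L3 P (fun t => f (W t)). Proof. exact: L3_comp mW. Qed.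
Let f'W_L3 : L3 P (fun t => f' (W t)). Proof. exact: L3_comp mW. Qed.

(** By independence E [xi_i f (V)] = 0 for V = away1_i / s. Expanding
    f (V) - f (W) to first order at W gives f' (W) times the variables that were
    removed, with a remainder of second order because f' is Lipschitz. *)
Let stein_first i :
  `|mean P (fun t => xi i t * f (W t)) -
    s^-1 * \sum_(j | touches i j) mean P (fun t => xi i t * xi j t * f' (W t))|
  <= K / s ^+ 2 * \sum_(j | touches i j) \sum_(k | touches i k) m3 i j k.
Proof.
pose Z t := \sum_(j | touches i j) xi j t.
pose V t := away1 i t / s.
have mg : measurable_fun [set: R] (fun x => f (x / s)).
  by apply: (@measurableT_comp _ _ _ _ _ _ f) => //; exact: measurable_funM.
have iV : L3 P (fun t => f (V t)).
  by apply: L3_comp => //; apply: measurable_funM => //; exact: L3_measurable (sum_L3 _).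
have ZL3 : L3 P Z by exact: sum_L3.
have WV t : W t - V t = s^-1 * Z t.
  by rewrite /W /V (S_split (touches i)) /away1 -mulrBl addrK mulrC.
have -> : \sum_(j | touches i j) mean P (fun t => xi i t * xi j t * f' (W t)) =
    mean P (fun t => xi i t * Z t * f' (W t)).
  rewrite -mean_sum; last by move=> j _; exact: L1_mul3.
  by congr (mean P _); apply/funext => t; rewrite -mulr_suml -mulr_sumr.
have E0 : mean P (fun t => xi i t * f (V t)) = 0.
  exact: (indep_away1 i mg (fun x => f_le _)).
have -> : mean P (fun t => xi i t * f (W t)) -
    s^-1 * mean P (fun t => xi i t * Z t * f' (W t)) =
  mean P (fun t => xi i t * f (W t) - xi i t * f (V t) - s^-1 * (xi i t * Z t * f' (W t))).
  rewrite meanB.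
  - rewrite meanB; [|exact: L1_mul2|exact: L1_mul2].
    by rewrite E0 subr0 meanZ//; exact: L1_mul3.
  - by apply: L1B; exact: L1_mul2.
  - by apply: L1Z; exact: L1_mul3.
apply: le_trans (norm_mean_le _) _.
  by apply: L1B; [apply: L1B; exact: L1_mul2|apply: L1Z; exact: L1_mul3].
apply: (@le_trans _ _ (mean P (fun t => K / s ^+ 2 *
    \sum_(j | touches i j) \sum_(k | touches i k) `|xi i t * xi j t * xi k t|))).
  apply: le_mean.
  - by apply: L1_norm; apply: L1B; [apply: L1B; exact: L1_mul2|apply: L1Z; exact: L1_mul3].
  - apply: L1Z; apply: L1_sum => j _; apply: L1_sum => k _.
    by apply: L1_norm; exact: L1_mul3.
  move=> t.
  have -> : xi i t * f (W t) - xi i t * f (V t) - s^-1 * (xi i t * Z t * f' (W t)) =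
      xi i t * (f (W t) - f (V t) - (W t - V t) * f' (W t)) by rewrite WV; ring.
  rewrite normrM; apply: le_trans (ler_wpM2l (normr_ge0 _) (taylor2 _ _)) _.
  rewrite WV exprMn exprVn.
  have -> : `|xi i t| * (K * (s ^- 2 * Z t ^+ 2)) = K / s ^+ 2 * `|xi i t * Z t * Z t|.
    by rewrite -[xi i t * Z t * Z t]mulrA normrM -expr2 (ger0_norm (sqr_ge0 (Z t))); ring.
  rewrite ler_wpM2l ?divr_ge0 ?sqr_ge0//.
  have -> : xi i t * Z t * Z t =
      \sum_(j | touches i j) \sum_(k | touches i k) xi i t * xi j t * xi k t.
    rewrite -mulrA mulr_suml mulr_sumr; apply: eq_bigr => j _.
    by rewrite !mulr_sumr; apply: eq_bigr => k _; rewrite mulrA.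
  apply: le_trans (ler_norm_sum _ _ _) _; apply: ler_sum => j _.
  exact: ler_norm_sum.
rewrite meanZ; last first.
  by apply: L1_sum => j _; apply: L1_sum => k _; apply: L1_norm; exact: L1_mul3.
rewrite mean_sum; last first.
  by move=> j _; apply: L1_sum => k _; apply: L1_norm; exact: L1_mul3.
rewrite le_eqVlt; apply/orP; left; apply/eqP; congr (_ * _); apply: eq_bigr => j _.
by rewrite mean_sum// => k _; apply: L1_norm; exact: L1_mul3.
Qed.

(** Replacing W by away2_(i,j) / s makes f' independent of xi_i xi_j; the
    replacement costs K / s times the variables that were removed. *)
Let stein_second i j :
  `|mean P (fun t => xi i t * xi j t * f' (W t)) -
    mean P (fun t => xi i t * xi j t) * mean P (fun t => f' (W t))|
  <= K / s * \sum_(k | touches i k || touches j k) (m3 i j k + m2 i j * m1 k).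
Proof.
pose Q k := touches i k || touches j k.
pose Z t := \sum_(k | Q k) xi k t.
pose V t := away2 i j t / s.
have mg : measurable_fun [set: R] (fun x => f' (x / s)).
  by apply: (@measurableT_comp _ _ _ _ _ _ f') => //; exact: measurable_funM.
have iV : L3 P (fun t => f' (V t)).
  by apply: L3_comp => //; apply: measurable_funM => //; exact: L3_measurable (sum_L3 _).
have ZL3 : L3 P Z by exact: sum_L3.
have WV t : `|f' (W t) - f' (V t)| <= K / s * `|Z t|.
  apply: le_trans (f'_lip _ _) _.
  rewrite /W /V (S_split Q) /away2 -mulrBl addrK normrM normfV (gtr0_norm s0).
  by rewrite (mulrC `|_|) mulrA.
have ind := indep_away2 i j mg (fun x => f'_le _).
have -> : mean P (fun t => xi i t * xi j t * f' (W t)) -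
    mean P (fun t => xi i t * xi j t) * mean P (fun t => f' (W t)) =
   mean P (fun t => xi i t * xi j t * f' (W t) - xi i t * xi j t * f' (V t)) -
   mean P (fun t => xi i t * xi j t) * mean P (fun t => f' (W t) - f' (V t)).
  rewrite (meanB (L1_mul3 (xi_L3 i) (xi_L3 j) f'W_L3) (L1_mul3 (xi_L3 i) (xi_L3 j) iV)).
  rewrite (meanB (L3_L1 f'W_L3) (L3_L1 iV)).
  by rewrite /V ind; ring.
have ZLE : mean P (fun t => `|Z t|) <= \sum_(k | Q k) m1 k.
  rewrite -mean_sum; last by move=> k _; exact: L1_norm.
  apply: le_mean; [exact/L1_norm/L3_L1|by apply: L1_sum => k _; exact: L1_norm|].
  by move=> t; exact: ler_norm_sum.
apply: le_trans (ler_normB _ _) _.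
rewrite big_split/= mulrDr; apply: lerD.
- apply: le_trans (norm_mean_le _) _; first by apply: L1B; exact: L1_mul3.
  rewrite -mean_sum; last by move=> k _; apply: L1_norm; exact: L1_mul3.
  rewrite -meanZ; last by apply: L1_sum => k _; apply: L1_norm; exact: L1_mul3.
  apply: le_mean.
  + by apply: L1_norm; apply: L1B; exact: L1_mul3.
  + by apply: L1Z; apply: L1_sum => k _; apply: L1_norm; exact: L1_mul3.
  move=> t; rewrite -mulrBr normrM.
  apply: le_trans (ler_wpM2l (normr_ge0 _) (WV t)) _.
  rewrite mulrCA ler_wpM2l ?divr_ge0 ?(ltW s0)//.
  by rewrite -normrM mulr_sumr ler_norm_sum.
- rewrite normrM -mulr_sumr mulrCA; apply: ler_pM => //.
    exact: norm_mean_le (L1_mul2 _ _).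
  apply: le_trans (norm_mean_le _) _; first by apply: L1B; exact: L3_L1.
  apply: le_trans (_ : K / s * mean P (fun t => `|Z t|) <= _).
    rewrite -meanZ; last by apply: L1_norm; exact: L3_L1.
    apply: le_mean => //; first by apply: L1_norm; apply: L1B; exact: L3_L1.
    by apply: L1Z; apply: L1_norm; exact: L3_L1.
  by rewrite ler_wpM2l// divr_ge0// ltW.
Qed.

(** Variables that do not touch are uncorrelated, so s^2 is the sum of the
    covariances of the touching pairs. Hence E [f' (W)] is s^-2 times the sum of
    E [xi_i xi_j] E [f' (W)] over these pairs, to be compared term by term with
    E [W f (W)] = s^-1 times the sum of the E [xi_i f (W)]. *)
Lemma stein_local_dependence :
  `|mean P (fun t => f' (W t)) - mean P (fun t => W t * f (W t))| <=
  K / s ^+ 3 * \sum_i \sum_(j | touches i j) \sum_(k | touches i k || touches j k)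
    (2 * m3 i j k + m2 i j * m1 k).
Proof.
pose a := mean P (fun t => f' (W t)).
pose c i j := mean P (fun t => xi i t * xi j t).
pose b i j := mean P (fun t => xi i t * xi j t * f' (W t)).
have m3_ge0 i j k : 0 <= m3 i j k by exact: mean_ge0.
have E1 : mean P (fun t => W t * f (W t)) = s^-1 * \sum_i mean P (fun t => xi i t * f (W t)).
  rewrite -mean_sum; last by move=> i _; exact: L1_mul2.
  rewrite -meanZ; last by apply: L1_sum => i _; exact: L1_mul2.
  by congr (mean P _); apply/funext => t; rewrite -mulr_suml mulrA (mulrC s^-1).
have E2 : a = s^-1 * (s^-1 * (\sum_i \sum_(j | touches i j) c i j * a)).
  have -> : \sum_i \sum_(j | touches i j) c i j * a = s ^+ 2 * a.
    rewrite s2.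
    have -> : (fun t => S t ^+ 2) = (fun t => \sum_i \sum_j xi i t * xi j t).
      apply/funext => t; rewrite expr2 /S mulr_suml; apply: eq_bigr => i _.
      by rewrite mulr_sumr.
    rewrite mean_sum; last by move=> i _; apply: L1_sum => j _; exact: L1_mul2.
    rewrite mulr_suml; apply: eq_bigr => i _.
    rewrite mean_sum; last by move=> j _; exact: L1_mul2.
    rewrite [in RHS](bigID (touches i))/= [X in _ + X]big1 ?addr0 ?mulr_suml//.
    by move=> j ij; exact: indep_pair.
  by field; rewrite gt_eqF.
have -> : mean P (fun t => f' (W t)) - mean P (fun t => W t * f (W t)) =
   s^-1 * (\sum_i (s^-1 * \sum_(j | touches i j) (c i j * a - b i j)
      - (mean P (fun t => xi i t * f (W t)) - s^-1 * \sum_(j | touches i j) b i j))).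
  rewrite E1 -/a [X in X - _]E2 -mulrBr; congr (_ * _).
  rewrite mulr_sumr -sumrB; apply: eq_bigr => i _.
  by rewrite sumrB; ring.
rewrite normrM normfV (gtr0_norm s0).
have -> : K / s ^+ 3 = s^-1 * (K / s ^+ 2) by field; rewrite gt_eqF.
rewrite -mulrA ler_wpM2l ?invr_ge0 ?(ltW s0)// mulr_sumr.
apply: le_trans (ler_norm_sum _ _ _) _; apply: ler_sum => i _.
apply: le_trans (ler_normB _ _) _.
have -> : \sum_(j | touches i j) \sum_(k | touches i k || touches j k)
     (2 * m3 i j k + m2 i j * m1 k) =
   \sum_(j | touches i j) \sum_(k | touches i k || touches j k) (m3 i j k + m2 i j * m1 k) +
   \sum_(j | touches i j) \sum_(k | touches i k || touches j k) m3 i j k.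
  rewrite -big_split/=; apply: eq_bigr => j _; rewrite -big_split/=; apply: eq_bigr => k _.
  by ring.
rewrite mulrDr; apply: lerD.
  rewrite normrM normfV (gtr0_norm s0).
  have -> : K / s ^+ 2 = s^-1 * (K / s) by field; rewrite gt_eqF.
  rewrite -mulrA ler_wpM2l ?invr_ge0 ?(ltW s0)// mulr_sumr.
  apply: le_trans (ler_norm_sum _ _ _) _; apply: ler_sum => j _.
  by rewrite distrC; exact: stein_second.
apply: le_trans (stein_first i) _.
rewrite ler_wpM2l ?divr_ge0 ?sqr_ge0//; apply: ler_sum => j _.
rewrite [leLHS]big_mkcond [leRHS]big_mkcond; apply: ler_sum => k _.
by case: (touches i k) => //=; case: ifP.
Qed.

End LocalDependence.

(** * Counting copies of a graph *)

Lemma leq_expl (m n k : nat) : (m <= n)%N -> (m ^ k <= n ^ k)%N.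
Proof. by case: k => [//|k] mn; rewrite leq_exp2r. Qed.

Section Copies.
Variables (V : finType) (G : sgraph V) (n : nat) (x0 : 'I_n).
Local Open Scope nat_scope.
Local Notation v := #|verts G|.

Lemma edge_sub_verts (W : finType) (H : sgraph W) (a : edge W) :
  a \in edges H -> val a \subset verts H.
Proof. by move=> aH; have /forall_inP := valP H; apply. Qed.

Lemma sgraph_eq (W : finType) (H1 H2 : sgraph W) :
  verts H1 = verts H2 -> edges H1 = edges H2 -> H1 = H2.
Proof.
move=> E1 E2; apply: val_inj; move: E1 E2; rewrite /verts /edges.
by case: (val H1) (val H2) => [? ?] [? ?] /= -> ->.
Qed.

(** Pinning f outside the vertices of G makes f a function of the v_G values
    that matter, so that copies are counted by counting maps. *)
Definition embeds (H : sgraph 'I_n) (f : {ffun V -> 'I_n}) : bool :=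
  [&& dinjectiveb f (mem (verts G)),
      [set f x | x in verts G]%SET == verts H,
      [set [set f x | x in \val a]%SET | a : edge V in edges G]%SET
          == [set \val a | a : edge 'I_n in edges H]%SET
    & [forall x, (x \notin verts G) ==> (f x == x0)]].

Lemma embeds_exists H : graph_iso G H -> exists f, embeds H f.
Proof.
move=> /existsP[f /and3P[fi fv fe]].
pose g := [ffun x => if x \in verts G then f x else x0].
have gf x : x \in verts G -> g x = f x by rewrite ffunE => ->.
exists g; apply/and4P; split.
- apply/dinjectiveP => x y xG yG; rewrite !gf//.
  by have /dinjectiveP := fi; exact.
- by rewrite -(eqP fv); apply/eqP/eq_in_imset => x xG; rewrite gf.
- rewrite -(eqP fe); apply/eqP/eq_in_imset => a aG.
  apply: eq_in_imset => x xa; rewrite gf//.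
  by apply: (fintype.subsetP (edge_sub_verts aG)).
- by apply/forallP => x; apply/implyP => xG; rewrite ffunE (negbTE xG).
Qed.

(** Sends each copy to one map that embeds G onto it, so that copies are counted
    as maps; the map determines the copy. *)
Definition witness (H : sgraph 'I_n) : {ffun V -> 'I_n} :=
  odflt [ffun=> x0] [pick f | embeds H f].

Lemma witnessP H : graph_iso G H -> embeds H (witness H).
Proof.
rewrite /witness => /embeds_exists[f fH]; case: pickP => //= /(_ f).
by rewrite fH.
Qed.

Lemma embeds_inj H f : embeds H f -> {in verts G &, injective f}.
Proof. by move=> /and4P[/dinjectiveP]. Qed.

Lemma embeds_verts H f : embeds H f -> verts H = [set f x | x in verts G]%SET.
Proof. by move=> /and4P[_ /eqP]. Qed.

Lemma embeds_edges H f : embeds H f ->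
  [set \val a | a : edge 'I_n in edges H]%SET =
  [set [set f x | x in \val a]%SET | a : edge V in edges G]%SET.
Proof. by move=> /and4P[_ _ /eqP]. Qed.

Lemma embeds_out H f x : embeds H f -> x \notin verts G -> f x = x0.
Proof. by move=> /and4P[_ _ _ /forallP/(_ x)/implyP fx] /fx/eqP. Qed.

Lemma embeds_determines H1 H2 f : embeds H1 f -> embeds H2 f -> H1 = H2.
Proof.
move=> f1 f2; apply: sgraph_eq; first by rewrite (embeds_verts f1) (embeds_verts f2).
by apply: (imset_inj val_inj); rewrite (embeds_edges f1) (embeds_edges f2).
Qed.

Lemma witness_inj : {in graph_iso G &, injective witness}.
Proof.
move=> H1 H2 /witnessP w1 /witnessP + E; rewrite -E; exact: embeds_determines.
Qed.

Lemma embeds_edge_inj H f : embeds H f ->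
  {in edges G &, injective (fun a : edge V => [set f x | x in \val a]%SET)}.
Proof.
move=> fH a b aG bG ab; apply: val_inj; have fi := embeds_inj fH.
have sa := edge_sub_verts aG; have sb := edge_sub_verts bG.
apply/setP => x; apply/idP/idP => xa.
  have : f x \in [set f y | y in val b]%SET by rewrite -ab; apply: imset_f.
  move=> /imsetP[y yb E]; suff -> : x = y by [].
  by apply: fi => //; [exact: (fintype.subsetP sa)|exact: (fintype.subsetP sb)].
have : f x \in [set f y | y in val a]%SET by rewrite ab; apply: imset_f.
move=> /imsetP[y yb E]; suff -> : x = y by [].
by apply: fi => //; [exact: (fintype.subsetP sb)|exact: (fintype.subsetP sa)].
Qed.

Lemma card_copy_edges (H : sgraph 'I_n) : graph_iso G H -> #|edges H| = #|edges G|.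
Proof.
move=> /witnessP wH; rewrite -(card_imset _ val_inj) (embeds_edges wH).
by rewrite card_in_imset//; exact: (embeds_edge_inj wH).
Qed.

Definition trace (L : {set edge 'I_n}) (f : {ffun V -> 'I_n}) : {set edge V} :=
  [set a in edges G | [set f x | x in \val a]%SET \in [set val l | l in L]%SET]%SET.

Lemma card_trace L H f : embeds H f -> #|trace L f| = #|edges H :&: L|.
Proof.
move=> fH; rewrite -(card_imset (mem (edges H :&: L)) val_inj).
have -> : [set val a | a : edge 'I_n in edges H :&: L]%SET =
   [set [set f x | x in \val a]%SET | a : edge V in trace L f]%SET.
  apply/setP => A; apply/imsetP/imsetP.
  - move=> [a]; rewrite inE => /andP[aH aL] ->.
    have : val a \in [set \val a | a : edge 'I_n in edges H]%SET by apply: imset_f.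
    rewrite (embeds_edges fH) => /imsetP[b bG E]; exists b => //.
    by rewrite inE bG /= -E; apply: imset_f.
  - move=> [b]; rewrite inE => /andP[bG /imsetP[l lL E]] ->.
    have : [set f x | x in \val b]%SET \in [set \val a | a : edge 'I_n in edges H]%SET.
      by rewrite (embeds_edges fH); apply: (imset_f (fun a : edge V => [set f x | x in \val a]%SET)).
    move=> /imsetP[a aH E']; exists l => //; rewrite inE lL andbT.
    by have -> : l = a by apply: val_inj; rewrite /= -E -E'.
rewrite card_in_imset// => a b; rewrite !inE => /andP[aG _] /andP[bG _].
exact: (embeds_edge_inj fH).
Qed.

Definition touched (W : finType) (F : {set edge W}) : {set W} := (\bigcup_(a in F) val a)%SET.

Lemma card_touched (W : finType) (L : {set edge W}) : #|touched L| <= 2 * #|L|.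
Proof.
have -> : 2 * #|L| = \sum_(l in L) #|val l|.
  rewrite (eq_bigr (fun=> 2)) => [|l _]; last exact/eqP/(valP l).
  by rewrite sum_nat_const mulnC.
rewrite /touched; elim/big_ind2: _ => [|A a B b Aa Bb|//].
  by rewrite cards0.
by apply: leq_trans (leq_add Aa Bb); exact: leq_card_setU.
Qed.

Lemma touched_sub (F : {set edge V}) : F \subset edges G -> touched F \subset verts G.
Proof.
move=> /fintype.subsetP FG; apply/bigcupsP => a /FG; exact: edge_sub_verts.
Qed.

(** The vertices of G in A have #|Y| possible images and the others n; outside
    G there is no choice. *)
Lemma leq_card_fun_family (A : {set V}) (Y : {set 'I_n}) (S : {set sgraph 'I_n}) :
  A \subset verts G ->
  {in S, forall H, graph_iso G H} ->
  {in S, forall H, {in A, forall x, witness H x \in Y}} ->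
  #|S| <= #|Y| ^ #|A| * n ^ (v - #|A|).
Proof.
move=> AG Siso SY.
pose B0 x : pred 'I_n := fun y => if x \in A then y \in Y else if x \in verts G then true else y == x0.
rewrite -(card_in_imset (f := witness)); last first.
  by move=> H1 H2 H1S H2S; apply: witness_inj; exact: Siso.
apply: (@leq_trans #|(family B0 : {pred {ffun V -> 'I_n}})|).
  apply: subset_leq_card; apply/fintype.subsetP => f /imsetP[H HS ->].
  apply/familyP => x; change (B0 x (witness H x)); rewrite /B0.
  case: ifP => [xA|_]; first exact: SY.
  case: ifP => [//|/negbT xG].
  by rewrite (embeds_out (witnessP (Siso _ HS)) xG).
rewrite card_family foldrE big_map big_enum/=.
rewrite (bigID (mem A))/= leq_mul//.
  rewrite (eq_bigr (fun=> #|Y|)); last first.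
    by move=> x xA; apply: eq_card => y; change (B0 x y = (y \in Y)); rewrite /B0 xA.
  by rewrite prod_nat_const.
rewrite (bigID (mem (verts G)))/= [X in _ * X]big1; last first.
  move=> x /andP[xA xG]; rewrite -[RHS](card1 x0); apply: eq_card => y.
  by change (B0 x y = (y == x0)); rewrite /B0 (negbTE xA) (negbTE xG).
rewrite muln1 (eq_bigr (fun=> n)); last first.
  move=> x /andP[xA xG]; rewrite -[RHS]card_ord; apply: eq_card => y.
  by change (B0 x y = true); rewrite /B0 (negbTE xA) xG.
rewrite prod_nat_const -(cardsDS AG) leq_eqVlt; apply/orP; left; apply/eqP.
by congr (_ ^ _); apply: eq_card => x; rewrite !inE unfold_in.
Qed.

Lemma card_copies_le : #|[set H : sgraph 'I_n | graph_iso G H]%SET| <= n ^ v.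
Proof.
have := @leq_card_fun_family finset.set0 finset.set0 [set H | graph_iso G H]%SET.
rewrite !cards0 expn0 mul1n subn0; apply; first exact: finset.sub0set.
  by move=> H; rewrite inE.
by move=> H _ x; rewrite inE.
Qed.

(** The vertices touched by F are sent to endpoints of edges of L, of which there
    are at most 2 #|L|. *)
Lemma card_trace_class (L : {set edge 'I_n}) (F : {set edge V}) : F \subset edges G ->
  #|[set H : sgraph 'I_n | graph_iso G H & trace L (witness H) == F]%SET|
  <= (2 * #|L|) ^ #|touched F| * n ^ (v - #|touched F|).
Proof.
move=> FG; apply: (@leq_trans (#|touched L| ^ #|touched F| * n ^ (v - #|touched F|))); last first.
  by rewrite leq_mul2r leq_expl ?card_touched ?orbT.
apply: leq_card_fun_family; first exact: touched_sub.
  by move=> H; rewrite inE => /andP[].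
move=> H; rewrite inE => /andP[_ /eqP HF] x /finset.bigcupP[a aF xa].
move: aF; rewrite -HF inE => /andP[_ /imsetP[l lL E]].
apply/finset.bigcupP; exists l => //.
by rewrite -E; apply: imset_f.
Qed.

End Copies.

(** The copy is obtained from the order-preserving matching of two
    enumerations. *)
Lemma copy_on (V : finType) (G : sgraph V) (n : nat) (x0 : 'I_n) (A : {set 'I_n}) :
  #|A| = #|verts G| -> exists2 H : sgraph 'I_n, graph_iso G H & verts H = A.
Proof.
move=> cA; pose f : {ffun V -> 'I_n} :=
  [ffun x => nth x0 (enum A) (index x (enum (verts G)))].
have idx x : x \in verts G -> (index x (enum (verts G)) < size (enum A))%N.
  by move=> xG; rewrite -cardE cA cardE index_mem mem_enum.
have fi : {in verts G &, injective f}.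
  move=> x y xG yG; rewrite !ffunE => /eqP.
  rewrite nth_uniq ?idx ?enum_uniq// => /eqP E.
  rewrite -(nth_index x (s := enum (verts G)) (x := x)) ?mem_enum// E nth_index ?mem_enum//.
have fA : [set f x | x in verts G]%SET = A.
  apply/eqP; rewrite eqEcard card_in_imset// cA leqnn andbT.
  apply/fintype.subsetP => _ /imsetP[x xG ->]; rewrite ffunE -mem_enum.
  by rewrite mem_nth// idx.
pose E := [set b : edge 'I_n | val b \in
   [set [set f x | x in \val a]%SET | a : edge V in edges G]%SET]%SET.
have subE : [forall b in (A, E).2, val b \subset (A, E).1].
  apply/forall_inP => b; rewrite inE => /imsetP[a aG ->].
  rewrite -fA; apply: imsetS; exact: edge_sub_verts.
exists (exist _ (A, E) subE) => //; apply/existsP; exists f; apply/and3P; split.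
- by apply/dinjectiveP.
- by rewrite fA.
- apply/eqP/setP => B; apply/idP/imsetP => [BG|[b]].
    have c2 : #|B| == 2.
      move: BG => /imsetP[a aG ->]; rewrite card_in_imset ?(valP a)// => x y xa ya.
      have sa := fintype.subsetP (edge_sub_verts aG).
      by apply: fi; exact: sa.
    by exists (exist _ B c2) => //; rewrite inE.
  by rewrite inE => bG ->.
Qed.

(** Copies with distinct vertex sets are distinct, so there are at least C(n, v)
    of them; and n^v v! <= n (n-1) ... (n-v+1) v^v holds factor by factor, because
    n (v - i) <= (n - i) v. *)
Lemma card_copies_ge (V : finType) (G : sgraph V) (n : nat) (x0 : 'I_n) :
  (#|verts G| <= n)%N ->
  (n ^ #|verts G| <= #|[set H : sgraph 'I_n | graph_iso G H]%SET| * #|verts G| ^ #|verts G|)%N.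
Proof.
set v := #|verts G| => vn; set C := [set H : sgraph 'I_n | graph_iso G H]%SET.
have bC : ('C(n, v) <= #|C|)%N.
  have := card_draws 'I_n v; rewrite card_ord => <-.
  apply: leq_trans (leq_imset_card (@verts _) (mem C)).
  apply: subset_leq_card; apply/fintype.subsetP => A; rewrite inE => /eqP cA.
  have [H HG <-] := copy_on x0 cA.
  by apply: imset_f; rewrite inE.
have key : (n ^ v * v`! <= n ^_ v * v ^ v)%N.
  rewrite -ffactnn !ffact_prod -{1}[v in (n ^ v)%N](card_ord v) -prod_nat_const.
  rewrite -[X in (_ * v ^ X)%N](card_ord v) -prod_nat_const -!big_split/=.
  apply: leq_prod => i _; rewrite mulnBr mulnBl leq_sub2l//.
  by rewrite (mulnC n) leq_mul2l vn orbT.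
rewrite -(leq_pmul2r (fact_gt0 v)); apply: leq_trans key _.
rewrite -bin_ffact -!mulnA (mulnC (v ^ v)%N) mulnA (mulnA #|C|) leq_mul2r leq_mul2r bC.
by rewrite !orbT.
Qed.

Lemma sum_constant (R : realType) (I : finType) (Q : pred I) (c : R) :
  \sum_(i | Q i) c = #|[set i | Q i]%SET|%:R * c.
Proof. by rewrite mulr_natl -sumr_const; apply: eq_bigl => i; rewrite inE. Qed.

Section MinCount.
Variables (R : realType) (V : finType) (G : sgraph V) (n : nat) (p : R).
Hypothesis p01 : 0 < p <= 1.
Hypothesis n_gt0 : (0 < n)%N.
Hypothesis G_edge : (0 < #|edges G|)%N.

Local Notation v := #|verts G|.
Local Notation N := (n%:R ^+ v * p ^+ #|edges G|).
Local Notation psi := (min_subgraph_count G n p).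

Let p0 : 0 < p. Proof. by case/andP: p01. Qed.
Let n0 : 0 < n%:R :> R. Proof. by rewrite ltr0n. Qed.

Lemma min_subgraph_count_attained : exists H : sgraph V,
  [/\ subgraph H G, (0 < #|edges H|)%N & psi = n%:R ^+ #|verts H| * p ^+ #|edges H|].
Proof.
rewrite /min_subgraph_count; elim/big_rec: _ => [|H y /andP[HG eH] IH].
  by exists G; split=> //; rewrite /subgraph !fintype.subxx.
have [_|_] := leP (n%:R ^+ #|verts H| * p ^+ #|edges H|) y; last exact: IH.
by exists H.
Qed.

Lemma min_subgraph_count_gt0 : 0 < psi.
Proof.
have [H [_ _ ->]] := min_subgraph_count_attained.
by rewrite mulr_gt0 ?exprn_gt0.
Qed.

Lemma min_subgraph_count_le (F : {set edge V}) : F \subset edges G -> F != finset.set0 ->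
  psi <= n%:R ^+ #|touched F| * p ^+ #|F|.
Proof.
move=> FG F0.
have subF : [forall a in (touched F, F).2, val a \subset (touched F, F).1].
  by apply/forall_inP => a aF; apply: finset.bigcup_sup.
pose HF : sgraph V := exist _ (touched F, F) subF.
have := @bigmin_le_cond _ _ _ (n%:R ^+ v * p ^+ #|edges G|) HF
  (fun H => subgraph H G && (0 < #|edges H|)%N)
  (fun H => n%:R ^+ #|verts H| * p ^+ #|edges H|).
by apply; rewrite /subgraph touched_sub//= FG/= card_gt0.
Qed.

(** Sort the copies H by the nonempty subgraph F of G that their embedding sends
    into L. There are at most (2 #|L|)^v_F n^(v_G - v_F) copies in the class of F,
    each of weight p^(e_G - e_F), and
    n^(v_G - v_F) p^(e_G - e_F) = N / (n^v_F p^e_F) <= N / psi. *)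
Lemma sum_meeting_le (x0 : 'I_n) (L : {set edge 'I_n}) :
  \sum_(H : sgraph 'I_n | graph_iso G H && (edges H :&: L != finset.set0))
     p ^+ #|edges H :\: L|
  <= (2 ^ #|edges G| * (2 * #|L|).+1 ^ v)%:R * (N / psi).
Proof.
pose Q (F : {set edge V}) := (F \subset edges G) && (F != finset.set0).
pose tr H := trace G L (witness G x0 H).
have trG H : tr H \subset edges G by apply/fintype.subsetP => a; rewrite inE => /andP[].
have trE H : graph_iso G H -> #|tr H| = #|edges H :&: L|.
  by move=> HG; apply: card_trace (witnessP x0 HG).
have NP : 0 <= N / psi.
  by rewrite divr_ge0 ?mulr_ge0 ?exprn_ge0 ?ltW ?min_subgraph_count_gt0.
rewrite (partition_big tr Q) /=; last first.
  by move=> H /andP[HG HL]; rewrite /Q trG -card_gt0 trE// card_gt0.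
apply: (@le_trans _ _ (\sum_(F : {set edge V} | F \subset edges G)
    ((2 * #|L|).+1 ^ v)%:R * (N / psi))); last first.
  rewrite sum_constant (_ : [set F | _]%SET = powerset (edges G)); last first.
    by apply/setP => F; rewrite !inE.
  by rewrite card_powerset natrM !mulrA.
rewrite [leRHS](bigID (fun F => F != finset.set0))/=.
rewrite ler_wpDr ?sumr_ge0//; first by move=> F _; rewrite mulr_ge0.
apply: ler_sum => F /andP[FG F0].
have uv : (#|touched F| <= v)%N by exact/subset_leq_card/touched_sub.
have Fe : (#|F| <= #|edges G|)%N by exact: subset_leq_card.
rewrite (eq_bigr (fun=> p ^+ (#|edges G| - #|F|))); last first.
  by move=> H /andP[/andP[HG _] /eqP <-]; rewrite trE// cardsD (card_copy_edges x0 HG).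
apply: (@le_trans _ _ (#|[set H : sgraph 'I_n | graph_iso G H & tr H == F]%SET|%:R
    * p ^+ (#|edges G| - #|F|))).
  rewrite sum_constant ler_wpM2r ?exprn_ge0 ?(ltW p0)// ler_nat.
  by apply: subset_leq_card; apply/fintype.subsetP => H; rewrite !inE => /andP[/andP[-> _] ->].
have -> : ((2 * #|L|).+1 ^ v)%:R * (N / psi) = ((2 * #|L|).+1 ^ v)%:R * N / psi :> R by rewrite mulrA.
apply: (@le_trans _ _ (((2 * #|L|) ^ #|touched F| * n ^ (v - #|touched F|))%:R
    * p ^+ (#|edges G| - #|F|))).
  by rewrite ler_wpM2r ?exprn_ge0 ?(ltW p0)// ler_nat card_trace_class.
rewrite natrM -!mulrA; apply: ler_pM => //.
- by rewrite mulr_ge0 ?exprn_ge0// ltW ?p0.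
- rewrite ler_nat; apply: (@leq_trans ((2 * #|L|).+1 ^ #|touched F|)); first exact: leq_expl.
  by rewrite leq_pexp2l.
rewrite mulrA ler_pdivlMr ?min_subgraph_count_gt0//.
apply: (@le_trans _ _ ((n ^ (v - #|touched F|))%:R * p ^+ (#|edges G| - #|F|) *
   (n%:R ^+ #|touched F| * p ^+ #|F|))).
  by rewrite ler_wpM2l ?mulr_ge0 ?exprn_ge0 ?(ltW p0)// min_subgraph_count_le.
rewrite natrX mulrACA -!exprD !subnK//.
Qed.

Let ple1 k m : (k <= m)%N -> p ^+ m <= p ^+ k.
Proof. by case/andP: p01 => _ p1 km; apply: ler_wiXn2l => //; exact: ltW. Qed.

Lemma sum_copies_le (x0 : 'I_n) :
  \sum_(H : sgraph 'I_n | graph_iso G H) p ^+ #|edges H| <= N.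
Proof.
rewrite (eq_bigr (fun=> p ^+ #|edges G|)); last first.
  by move=> H HG; rewrite (card_copy_edges x0 HG).
rewrite sum_constant ler_wpM2r ?exprn_ge0 ?(ltW p0)//.
by rewrite -natrX ler_nat; exact: card_copies_le.
Qed.

(** Each of the two meeting conditions costs a factor of order 1 / psi compared
    with N^3, by the preceding bound applied to the edges already chosen, at most
    2 e_G of them. *)
Lemma sum_triples_le (x0 : 'I_n) :
  \sum_(i : sgraph 'I_n | graph_iso G i)
   \sum_(j | graph_iso G j && (edges i :&: edges j != finset.set0))
   \sum_(k | graph_iso G k && ((edges i :|: edges j) :&: edges k != finset.set0))
     p ^+ #|edges i :|: edges j :|: edges k|
  <= ((2 ^ #|edges G| * (4 * #|edges G|).+1 ^ v) ^ 2)%:R * (N ^+ 3 / psi ^+ 2).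
Proof.
pose K := (2 ^ #|edges G| * (4 * #|edges G|).+1 ^ v)%:R : R.
have psi0 := min_subgraph_count_gt0.
have K0 : 0 <= K by [].
have NP : 0 <= N / psi.
  by rewrite divr_ge0 ?mulr_ge0 ?exprn_ge0 ?ltW.
have KN : 0 <= K * (N / psi) by exact: mulr_ge0.
have meet (L : {set edge 'I_n}) : (#|L| <= 2 * #|edges G|)%N ->
  \sum_(k : sgraph 'I_n | graph_iso G k && (L :&: edges k != finset.set0)) p ^+ #|L :|: edges k|
  <= K * (N / psi) * p ^+ #|L|.
  move=> Le; rewrite (eq_bigr (fun k : sgraph 'I_n => p ^+ #|edges k :\: L| * p ^+ #|L|)); last first.
    move=> k _; rewrite -exprD; congr (_ ^+ _).
    rewrite -(cardsID L (L :|: edges k)) addnC; congr (_ + _)%N; apply: eq_card => a;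
    by rewrite !inE; case: (a \in L); case: (a \in edges k).
  rewrite -mulr_suml ler_wpM2r ?exprn_ge0 ?(ltW p0)//.
  rewrite (eq_bigl (fun k : sgraph 'I_n => graph_iso G k && (edges k :&: L != finset.set0))); last first.
    by move=> k; rewrite finset.setIC.
  apply: le_trans (sum_meeting_le x0 L) _; rewrite ler_wpM2r// ler_nat.
  by rewrite leq_mul2l leq_expl ?orbT// ltnS -[4%N]/(2 * 2)%N -mulnA leq_mul2l.
apply: (@le_trans _ _ (\sum_(i : sgraph 'I_n | graph_iso G i) (K * (N / psi)) ^+ 2 * p ^+ #|edges i|)).
  apply: ler_sum => i iG.
  apply: (@le_trans _ _ (\sum_(j : sgraph 'I_n | graph_iso G j && (edges i :&: edges j != finset.set0))
      K * (N / psi) * p ^+ #|edges i :|: edges j|)).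
    apply: ler_sum => j /andP[jG _]; apply: meet.
    apply: leq_trans (leq_card_setU _ _) _.
    by rewrite (card_copy_edges x0 iG) (card_copy_edges x0 jG) mul2n addnn.
  rewrite -mulr_sumr expr2 -[leRHS]mulrA ler_wpM2l ?KN//.
  by apply: meet; rewrite (card_copy_edges x0 iG) leq_pmull.
rewrite -mulr_sumr.
apply: le_trans (ler_wpM2l _ (sum_copies_le x0)) _; first by rewrite exprn_ge0// KN.
rewrite le_eqVlt; apply/orP; left; apply/eqP; rewrite natrX -/K.
move: psi0; move: psi N => x y x0'.
by move: K {K0 NP KN meet} => z; field; rewrite gt_eqF.
Qed.

Lemma cauchy_schwarz_card (J : finType) (Y : {set J}) (a : J -> R) :
  (\sum_(y in Y) a y) ^+ 2 <= #|Y|%:R * \sum_(y in Y) a y ^+ 2.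
Proof.
have [->|Y0] := eqVneq Y finset.set0; first by rewrite !big_set0 expr0n/= mulr0.
have c0 : 0 < #|Y|%:R :> R by rewrite ltr0n card_gt0.
pose M := \sum_(y in Y) a y; pose m := M / #|Y|%:R.
have : 0 <= \sum_(y in Y) (a y - m) ^+ 2 by apply: sumr_ge0 => y _; rewrite sqr_ge0.
under eq_bigr do rewrite sqrrB -mulrnAr.
rewrite big_split/= sumrB -mulr_suml sumr_const -/M -[m ^+ 2 *+ _]mulr_natl => h.
have -> : #|Y|%:R * \sum_(y in Y) a y ^+ 2 = M ^+ 2 + #|Y|%:R *
    (\sum_(y in Y) a y ^+ 2 - M * (m *+ 2) + #|Y|%:R * m ^+ 2).
  by rewrite /m; field; rewrite gt_eqF.
by rewrite lerDl mulr_ge0.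
Qed.

(** Let H0 attain the minimum. Two copies whose embeddings agree on the vertices
    of H0 share at least e_H0 edges. There are at most n^v_H0 restrictions of
    embeddings to these vertices, so that, by the Cauchy-Schwarz inequality, at
    least #|C|^2 / n^v_H0 pairs agree there, where C is the set of all copies. *)
Lemma sum_pairs_ge (x0 : 'I_n) : (v <= n)%N ->
  (v%:R ^+ (2 * v))^-1 * (N ^+ 2 / psi) <=
  \sum_(i : sgraph 'I_n | graph_iso G i)
   \sum_(j | graph_iso G j && (edges i :&: edges j != finset.set0))
     p ^+ #|edges i :|: edges j|.
Proof.
move=> vn; have [H0 [/andP[V0 E0] e0 psiE]] := min_subgraph_count_attained.
have v0 : (0 < v)%N.
  rewrite lt0n cards_eq0; apply: contraL G_edge => /eqP vE.
  rewrite -leqNgt leqn0 cards_eq0 -finset.subset0; apply/fintype.subsetP => a aG.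
  have := edge_sub_verts aG; rewrite vE finset.subset0 => /eqP aE.
  by have := valP a; rewrite /= aE cards0.
pose w := witness G x0.
pose h (H : sgraph 'I_n) : {ffun V -> 'I_n} := [ffun x => if x \in verts H0 then w H x else x0].
pose C := [set H : sgraph 'I_n | graph_iso G H]%SET.
pose Y := [set h H | H in C]%SET.
pose cl y := [set H : sgraph 'I_n | graph_iso G H && (h H == y)]%SET.
have cY : (#|Y| <= n ^ #|verts H0|)%N.
  rewrite -[X in (X ^ _)%N]card_ord -(card_pffun_on x0 (mem (verts H0)) (predT : pred 'I_n)).
  apply: subset_leq_card; apply/fintype.subsetP => _ /imsetP[H _ ->].
  apply/pffun_onP; split; last by [].
  by apply/fintype.subsetP => x; rewrite inE ffunE; case: ifP => // _; rewrite eqxx.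
have CE : #|C|%:R = \sum_(y in Y) #|cl y|%:R :> R.
  rewrite -natr_sum; congr _%:R; rewrite -sum1_card.
  rewrite (partition_big h (mem Y)) /=; last by move=> H HC; apply: imset_f.
  by apply: eq_bigr => y _; rewrite -sum1_card; apply: eq_bigl => H; rewrite !inE.
have meet i j : graph_iso G i -> graph_iso G j -> h i = h j ->
    (#|edges H0| <= #|edges i :&: edges j|)%N.
  move=> iG jG hij; have wi := witnessP x0 iG; have wj := witnessP x0 jG.
  rewrite -(card_trace (edges j) wi); apply: subset_leq_card.
  apply/fintype.subsetP => a aH; rewrite inE (fintype.subsetP E0 _ aH)/=.
  have -> : [set witness G x0 i x | x in \val a]%SET = [set witness G x0 j x | x in \val a]%SET.
    apply: eq_in_imset => x xa; have := congr1 (fun g : {ffun V -> 'I_n} => g x) hij.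
    by rewrite !ffunE (fintype.subsetP (edge_sub_verts aH) _ xa).
  rewrite (embeds_edges wj); apply: (imset_f (fun a : edge V => [set witness G x0 j x | x in \val a]%SET)).
  exact: (fintype.subsetP E0).
apply: (@le_trans _ _ (\sum_(i : sgraph 'I_n | graph_iso G i)
    \sum_(j : sgraph 'I_n | graph_iso G j && (h i == h j)) p ^+ (2 * #|edges G| - #|edges H0|))); last first.
  apply: ler_sum => i iG; rewrite [leLHS]big_mkcond [leRHS]big_mkcond; apply: ler_sum => j _.
  case jG : (graph_iso G j) => //=; case: eqP => [hij|_]; last first.
    by case: ifP => // _; rewrite exprn_ge0// ltW ?p0.
  have m := meet _ _ iG jG hij.
  have -> : edges i :&: edges j != finset.set0 by rewrite -card_gt0; apply: leq_trans m.
  apply: ple1; rewrite cardsU (card_copy_edges x0 iG) (card_copy_edges x0 jG) mul2n addnn.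
  exact: leq_sub2l.
have -> : \sum_(i : sgraph 'I_n | graph_iso G i)
    \sum_(j : sgraph 'I_n | graph_iso G j && (h i == h j)) p ^+ (2 * #|edges G| - #|edges H0|) =
    p ^+ (2 * #|edges G| - #|edges H0|) * \sum_(y in Y) #|cl y|%:R ^+ 2.
  rewrite (partition_big h (mem Y)) /=; last by move=> H HC; apply: imset_f; rewrite inE.
  rewrite mulr_sumr; apply: eq_bigr => y _.
  rewrite (eq_bigr (fun=> p ^+ (2 * #|edges G| - #|edges H0|) * #|cl y|%:R)).
    by rewrite sum_constant (expr2 #|cl y|%:R) mulrCA.
  move=> i /andP[iG /eqP hi]; rewrite sum_constant mulrC; congr (_ * _%:R).
  by apply: eq_card => j; rewrite !inE hi eq_sym.
have C1 := card_copies_ge x0 vn; rewrite -/C in C1.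
have vv0 : 0 < v%:R :> R by rewrite ltr0n.
have C2 : n%:R ^+ v / v%:R ^+ v <= #|C|%:R :> R.
  by rewrite ler_pdivrMr ?exprn_gt0// -!natrX -natrM ler_nat.
have C3 : (n%:R ^+ v / v%:R ^+ v) ^+ 2 <= n%:R ^+ #|verts H0| * \sum_(y in Y) #|cl y|%:R ^+ 2 :> R.
  apply: (@le_trans _ _ (#|C|%:R ^+ 2)).
    by apply: lerXn2r; rewrite ?nnegrE ?divr_ge0 ?exprn_ge0.
  rewrite CE; apply: le_trans (cauchy_schwarz_card _ _) _.
  rewrite ler_wpM2r//; first by apply: sumr_ge0 => y _; rewrite exprn_ge0.
  by rewrite -natrX ler_nat.
have e0G : (#|edges H0| <= 2 * #|edges G|)%N.
  by apply: leq_trans (subset_leq_card E0) _; rewrite leq_pmull.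
have pe0 : 0 < p ^+ #|edges H0| by rewrite exprn_gt0.
have nv0 : 0 < n%:R ^+ #|verts H0| :> R by rewrite exprn_gt0.
have -> : (v%:R ^+ (2 * v))^-1 * (N ^+ 2 / psi) =
   p ^+ (2 * #|edges G| - #|edges H0|) * ((n%:R ^+ v / v%:R ^+ v) ^+ 2 / n%:R ^+ #|verts H0|).
  have -> : p ^+ (2 * #|edges G| - #|edges H0|) = (p ^+ #|edges G|) ^+ 2 / p ^+ #|edges H0|.
    by apply: (mulIf (lt0r_neq0 pe0)); rewrite -exprD subnK// divfK ?gt_eqF// -exprM mulnC.
  rewrite psiE mulnC exprM.
  have : 0 < v%:R ^+ v :> R by rewrite exprn_gt0.
  move: pe0 nv0; move: (p ^+ #|edges H0|) (n%:R ^+ #|verts H0|) (v%:R ^+ v) (n%:R ^+ v) (p ^+ #|edges G|).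
  by move=> x y z t s x0' y0 z0; field; rewrite !gt_eqF.
rewrite ler_wpM2l ?exprn_ge0 ?(ltW p0)//.
by rewrite ler_pdivrMr// [leRHS]mulrC.
Qed.

End MinCount.

(** * Moments of the contribution of a copy *)

Lemma one_sub_exp_le (R : realType) (p : R) (k : nat) : 0 <= p <= 1 ->
  1 - p ^+ k <= k%:R * (1 - p).
Proof.
move=> /andP[p0 p1]; elim: k => [|k IH]; first by rewrite expr0 subrr mul0r.
rewrite exprS -natr1 mulrDl mul1r.
have q1 : p ^+ k <= 1 by rewrite exprn_ile1.
have : p * (1 - p ^+ k) <= 1 - p ^+ k by rewrite ler_piMl// subr_ge0.
by lra.
Qed.

Section WeightedIndicators.
Context {d : measure_display} {T : measurableType d} {R : realType}.
Variable P : probability T R.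
Variables (U : finType) (F : U + U -> set (set T)).
Hypothesis F_sigma : forall i, sigma_algebra setT (F i).
Hypothesis F_meas : forall i, F i `<=` measurable.
Hypothesis F_indep : mutually_independent P F.

Variables (b : U -> T -> bool) (Y : U -> T -> R) (p s2 s1 s3 : R).
Hypothesis p01 : 0 < p <= 1.
Hypothesis b_event : forall e, F (inl e) [set t | b e t].
Hypothesis b_prob : forall e, P [set t | b e t] = p%:E.
Hypothesis Y_F : forall e (A : set R), measurable A -> F (inr e) (Y e @^-1` A).
Hypothesis Y_L3 : forall e, L3 P (Y e).
Hypothesis Y_mean : forall e, mean P (Y e) = 0.
Hypothesis Y_var : forall e, mean P (fun t => Y e t ^+ 2) = s2.
Hypothesis Y_abs : forall e, mean P (fun t => `|Y e t|) <= s1.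
Hypothesis Y_abs3 : forall e, mean P (fun t => `|Y e t| ^+ 3) <= s3.

Local Notation depends := (@depends_on _ T R _ F).

Let p0 : 0 < p. Proof. by case/andP: p01. Qed.
Let p1 : p <= 1. Proof. by case/andP: p01. Qed.
Let pX0 k : 0 <= p ^+ k. Proof. by rewrite exprn_ge0// ltW. Qed.
Let ple k m : (k <= m)%N -> p ^+ m <= p ^+ k.
Proof. by move=> km; apply: ler_wiXn2l => //; exact: ltW. Qed.

Let bside (A : {set U}) : {set U + U} := [set inl e | e in A]%SET.
Let xside (A : {set U}) : {set U + U} := [set inr e | e in A]%SET.

Definition ind (A : {set U}) (t : T) : R := [forall e in A, b e t]%:R.

Definition weight (A : {set U}) (t : T) : R := \sum_(e in A) Y e t.

Definition abs_weight (A : {set U}) (t : T) : R := \sum_(e in A) `|Y e t|.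

Lemma ind_ge0 A t : 0 <= ind A t. Proof. by rewrite ler0n. Qed.
Lemma ind_le1 A t : ind A t <= 1. Proof. by rewrite /ind; case: [forall _ in _, _]. Qed.

Lemma ind_setU A B t : ind (A :|: B) t = ind A t * ind B t.
Proof.
rewrite /ind -natrM mulnb; congr (nat_of_bool _)%:R.
apply/forall_inP/andP => [AB|[/forall_inP hA /forall_inP hB] e].
  by split; apply/forall_inP => e eA; apply: AB; rewrite inE eA ?orbT.
by rewrite inE => /orP[/hA|/hB].
Qed.

Lemma indE A : ind A = \1_(\bigcap_(i in [set` bside A]) (fun i => if i is inl e then [set t | b e t] else setT) i).
Proof.
apply/funext => t; rewrite indicE; congr (nat_of_bool _)%:R.
apply/idP/idP => [/forall_inP bA|].
  by rewrite inE => i /= /imsetP[e eA ->]; exact: bA.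
rewrite inE => h; apply/forall_inP => e eA.
by apply: (h (inl e)); rewrite /= imset_f.
Qed.

Let ind_event A : measurable
  (\bigcap_(i in [set` bside A]) (fun i => if i is inl e then [set t | b e t] else setT) i).
Proof.
apply: fin_bigcap_measurable => // -[e|e] _; last exact: measurableT.
exact: (F_meas (b_event e)).
Qed.

Lemma ind_depends A : depends (bside A) (ind A).
Proof.
have -> : ind A = (fun t => \prod_(e in A) (b e t)%:R).
  apply/funext => t; rewrite /ind.
  case: (boolP [forall e in A, b e t]) => [/forall_inP bA|].
    by rewrite big1// => e /bA ->.
  rewrite negb_forall_in => /exists_inP[e eA /negbTE be].
  by rewrite (bigD1 e)//= be mul0r.
apply: depends_on_prod => e eA.
have -> : (fun t => (b e t)%:R) = \1_[set t | b e t] :> (T -> R).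
  by apply/funext => t; rewrite indicE; congr (nat_of_bool _)%:R; apply/idP/idP; rewrite inE.
apply: measurable_indic; apply: sub_sigma_algebra; exists (inl e); last exact: b_event.
by rewrite /= imset_f.
Qed.

Lemma measurable_ind A : measurable_fun [set: T] (ind A).
Proof. by rewrite indE; exact: measurable_indic. Qed.

Lemma ind_L3 A : L3 P (ind A).
Proof.
apply: (L3_bounded _ (@measurable_ind A) (K := 1)) => t.
by rewrite ger0_norm ?ind_ge0// ind_le1.
Qed.

Lemma mean_ind A : mean P (ind A) = p ^+ #|A|.
Proof.
rewrite indE /mean expectation_indic// F_indep; last first.
  by move=> i /imsetP[e eA ->].
rewrite big_imset/=; last by move=> e e' _ _ [].
rewrite (eq_bigr (fun=> p%:E)); last by move=> e _; exact: b_prob.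
by rewrite prodEFin/= prodr_const.
Qed.

Let Y_depends e (A : {set U}) : e \in A -> depends (xside A) (Y e).
Proof. by move=> eA; apply: (depends_on_gen (i := inr e)); [rewrite imset_f|exact: Y_F]. Qed.

Lemma weight_depends A : depends (xside A) (weight A).
Proof. by apply: depends_on_sum => e eA; exact: Y_depends. Qed.

Lemma abs_weight_depends A : depends (xside A) (abs_weight A).
Proof.
apply: depends_on_sum => e eA; apply: (depends_on_comp (g := Num.norm)); last exact: Y_depends.
exact: normr_measurable.
Qed.

Lemma weight_L3 A : L3 P (weight A).
Proof. by apply: L3_sum => e _. Qed.

Lemma abs_weight_L3 A : L3 P (abs_weight A).
Proof. by apply: L3_sum => e _; exact: L3_norm. Qed.

Lemma abs_weight_ge0 A t : 0 <= abs_weight A t.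
Proof. by apply: sumr_ge0. Qed.

Lemma mean_weight A : mean P (weight A) = 0.
Proof.
by rewrite mean_sum => [|e _]; [rewrite big1|exact: L3_L1].
Qed.

Let widen_b A : bside A \subset bside [set: U]%SET.
Proof. by apply: imsetS; exact: finset.subsetT. Qed.
Let widen_x A : xside A \subset xside [set: U]%SET.
Proof. by apply: imsetS; exact: finset.subsetT. Qed.

Lemma mean_mul_sides (V Z : T -> R) :
  depends (bside [set: U]%SET) V -> depends (xside [set: U]%SET) Z ->
  L1 P V -> L1 P Z -> L1 P (fun t => V t * Z t) ->
  mean P (fun t => V t * Z t) = mean P V * mean P Z.
Proof.
apply: (indep_mean F_sigma F_meas F_indep).
by move=> i /imsetP[e _ ->]; apply/negP => /imsetP[].
Qed.

Let indb A : depends (bside [set: U]%SET) (ind A).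
Proof. exact: (depends_on_sub (widen_b A) (@ind_depends A)). Qed.
Let weightx A : depends (xside [set: U]%SET) (weight A).
Proof. exact: (depends_on_sub (widen_x A) (@weight_depends A)). Qed.
Let absx A : depends (xside [set: U]%SET) (abs_weight A).
Proof. exact: (depends_on_sub (widen_x A) (@abs_weight_depends A)). Qed.

Lemma mean_weight_mul A B :
  mean P (fun t => weight A t * weight B t) = #|A :&: B|%:R * s2.
Proof.
have -> : (fun t => weight A t * weight B t) =
    (fun t => \sum_(e in A) \sum_(e' in B) Y e t * Y e' t).
  apply/funext => t; rewrite /weight mulr_suml; apply: eq_bigr => e _.
  by rewrite mulr_sumr.
rewrite mean_sum; last by move=> e _; apply: L1_sum => e' _; exact: L1_mul2.
have YY e e' : mean P (fun t => Y e t * Y e' t) = (e == e')%:R * s2.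
  have [<-|ee'] := eqVneq e e'; first by rewrite mul1r -(Y_var e).
  rewrite mul0r (indep_mean F_sigma F_meas F_indep (J := [set inr e]%SET) (K := [set inr e']%SET)).
  - by rewrite !Y_mean mul0r.
  - by move=> i; rewrite !inE => /eqP ->; apply/eqP => -[] /eqP; rewrite (negbTE ee').
  - by apply: (depends_on_gen (i := inr e)); [rewrite inE|exact: Y_F].
  - by apply: (depends_on_gen (i := inr e')); [rewrite inE|exact: Y_F].
  - exact: L3_L1.
  - exact: L3_L1.
  - exact: L1_mul2.
rewrite (eq_bigr (fun e => (e \in B)%:R * s2)); last first.
  move=> e eA; rewrite mean_sum; last by move=> e' _; exact: L1_mul2.
  rewrite (eq_bigr (fun e' => (e == e')%:R * s2)); last by move=> e' _; exact: YY.
  rewrite -mulr_suml; congr (_ * _); rewrite -natr_sum; congr _%:R.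
  case: (boolP (e \in B)) => eB; last first.
    by rewrite big1// => e' e'B; case: eqP => // ee'; rewrite -ee' (negbTE eB) in e'B.
  rewrite (bigD1 e)//= eqxx big1// => e' /andP[_ /negbTE e'e].
  by rewrite eq_sym e'e.
rewrite -mulr_suml; congr (_ * _); rewrite -natr_sum; congr _%:R.
rewrite -sum1_card [RHS](eq_bigl (fun e => (e \in A) && (e \in B))); last first.
  by move=> e; rewrite inE.
by rewrite [RHS]big_mkcondr; apply: eq_bigr => e _; case: (e \in B).
Qed.

Lemma mean_abs_weight A : mean P (abs_weight A) <= #|A|%:R * s1.
Proof.
rewrite mean_sum => [|e _]; last exact/L1_norm/L3_L1.
rewrite mulr_natl -sumr_const; apply: ler_sum => e _; exact: Y_abs.
Qed.

Let Y_mul2 e e' : mean P (fun t => `|Y e t| * `|Y e' t|) <= s2.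
Proof.
have sqr_L1 a : L1 P (fun t => Y a t ^+ 2).
  by under eq_fun do rewrite expr2; exact: L1_mul2.
apply: (@le_trans _ _ (mean P (fun t => 2^-1 * (Y e t ^+ 2 + Y e' t ^+ 2)))).
  apply: le_mean; first by apply: L1_mul2; exact: L3_norm.
    by apply: L1Z; exact: L1D.
  move=> t; have := sqr_ge0 (`|Y e t| - `|Y e' t|).
  rewrite sqrrB !real_normK ?num_real//; lra.
rewrite meanZ; last exact: L1D.
by rewrite meanD// !Y_var; lra.
Qed.

Let Y_mul3 e e' e'' : mean P (fun t => `|Y e t| * `|Y e' t| * `|Y e'' t|) <= 3 * s3.
Proof.
have cube_L1 a : L1 P (fun t => `|Y a t| ^+ 3) by have [] := Y_L3 a.
apply: (@le_trans _ _ (mean P (fun t => `|Y e t| ^+ 3 + `|Y e' t| ^+ 3 + `|Y e'' t| ^+ 3))).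
  apply: le_mean; first by apply: L1_mul3; exact: L3_norm.
    by apply: L1D => //; exact: L1D.
  by move=> t; have := young3 (Y e t) (Y e' t) (Y e'' t); rewrite !normrM.
rewrite !meanD//; last exact: L1D.
by have := Y_abs3 e; have := Y_abs3 e'; have := Y_abs3 e''; lra.
Qed.

Lemma mean_abs_weight2 A B :
  mean P (fun t => abs_weight A t * abs_weight B t) <= (#|A| * #|B|)%:R * s2.
Proof.
have -> : (fun t => abs_weight A t * abs_weight B t) =
    (fun t => \sum_(e in A) \sum_(e' in B) `|Y e t| * `|Y e' t|).
  apply/funext => t; rewrite /abs_weight mulr_suml; apply: eq_bigr => e _.
  by rewrite mulr_sumr.
have L e e' : L1 P (fun t => `|Y e t| * `|Y e' t|) by apply: L1_mul2; exact: L3_norm.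
rewrite mean_sum; last by move=> e _; apply: L1_sum.
rewrite natrM -mulrA (mulr_natl _ #|A|) -sumr_const; apply: ler_sum => e _.
rewrite mean_sum// mulr_natl -sumr_const; apply: ler_sum => e' _; exact: Y_mul2.
Qed.

Lemma mean_abs_weight3 A B C :
  mean P (fun t => abs_weight A t * abs_weight B t * abs_weight C t)
  <= (#|A| * #|B| * #|C|)%:R * (3 * s3).
Proof.
have -> : (fun t => abs_weight A t * abs_weight B t * abs_weight C t) =
    (fun t => \sum_(e in A) \sum_(e' in B) \sum_(e'' in C) `|Y e t| * `|Y e' t| * `|Y e'' t|).
  apply/funext => t; rewrite /abs_weight !mulr_suml; apply: eq_bigr => e _.
  rewrite [in X in X * _]mulr_sumr mulr_suml; apply: eq_bigr => e' _.
  by rewrite mulr_sumr.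
have L e e' e'' : L1 P (fun t => `|Y e t| * `|Y e' t| * `|Y e'' t|).
  by apply: L1_mul3; exact: L3_norm.
rewrite mean_sum; last by move=> e _; apply: L1_sum => e' _; apply: L1_sum.
rewrite !natrM -!mulrA (mulr_natl _ #|A|) -sumr_const; apply: ler_sum => e _.
rewrite mean_sum; last by move=> e' _; apply: L1_sum.
rewrite (mulr_natl _ #|B|) -sumr_const; apply: ler_sum => e' _.
rewrite mean_sum// (mulr_natl _ #|C|) -sumr_const; apply: ler_sum => e'' _.
exact: Y_mul3.
Qed.

Definition dev (A : {set U}) (t : T) : R := `|ind A t - p ^+ #|A| |.

(** Dominates both ind A and dev A, and expands into indicators. In a product
    with several factors of either kind one dev is kept, for its factor 1 - p,
    and the others are replaced by slack. *)
Definition slack (A : {set U}) (t : T) : R := ind A t + p ^+ #|A|.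

Lemma devE A t : dev A t = (1 - p ^+ #|A|) * ind A t + p ^+ #|A| * (1 - ind A t).
Proof.
have q1 : p ^+ #|A| <= 1 by rewrite exprn_ile1// ltW.
rewrite /dev /ind; case: [forall _ in _, _] => /=.
  by rewrite ger0_norm ?subr_ge0//; ring.
by rewrite sub0r normrN ger0_norm//; ring.
Qed.

Lemma dev_ge0 A t : 0 <= dev A t. Proof. exact: normr_ge0. Qed.

Lemma dev_le_slack A t : dev A t <= slack A t.
Proof.
apply: le_trans (ler_normB _ _) _.
by rewrite !ger0_norm ?ind_ge0.
Qed.

Lemma ind_le_slack A t : ind A t <= slack A t. Proof. by rewrite lerDl. Qed.

Lemma slack_ge0 A t : 0 <= slack A t.
Proof. by rewrite addr_ge0// ind_ge0. Qed.

Let slackb A : depends (bside [set: U]%SET) (slack A).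
Proof. by apply: depends_onD; [exact: indb|exact: depends_on_cst]. Qed.

Let devb A : depends (bside [set: U]%SET) (dev A).
Proof.
apply: (depends_on_comp (g := Num.norm)); first exact: normr_measurable.
by apply: depends_onD; [exact: indb|exact: depends_on_cst].
Qed.

Lemma dev_L3 A : L3 P (dev A).
Proof. by apply/L3_norm/L3B; [exact: ind_L3|exact: L3_cst]. Qed.

Lemma slack_L3 A : L3 P (slack A).
Proof. by apply: L3D; [exact: ind_L3|exact: L3_cst]. Qed.

(** On the event that A is retained dev A is 1 - p^#|A|, and elsewhere the mean
    of ind L is at most that of having L retained but not all of A: both cases
    carry a factor 1 - p, which the theorem needs for p close to 1. *)
Lemma mean_dev_ind A L :
  mean P (fun t => dev A t * ind L t) <= 2 * #|A|%:R * (1 - p) * p ^+ #|A :|: L|.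
Proof.
have q1 : p ^+ #|A| <= 1 by rewrite exprn_ile1// ltW.
have -> : (fun t => dev A t * ind L t) = (fun t =>
    (1 - p ^+ #|A|) * ind (A :|: L) t + p ^+ #|A| * (ind L t - ind (A :|: L) t)).
  by apply/funext => t; rewrite devE ind_setU; ring.
have iL := L3_L1 (ind_L3 L); have iAL := L3_L1 (ind_L3 (A :|: L)).
rewrite meanD; [|exact: L1Z|by apply: L1Z; exact: L1B].
rewrite !meanZ//; last exact: L1B.
rewrite meanB// !mean_ind.
have h1 := one_sub_exp_le #|A| (_ : 0 <= p <= 1); have {}h1 := h1 ltac:(by rewrite ltW).
have AL : #|A :|: L| = (#|L| + #|A :\: L|)%N.
  rewrite -(cardsID L (A :|: L)); congr (_ + _)%N; apply: eq_card => a;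
  by rewrite !inE; case: (a \in L); case: (a \in A).
have h2 : p ^+ #|A| * (p ^+ #|L| - p ^+ #|A :|: L|) <= #|A|%:R * (1 - p) * p ^+ #|A :|: L|.
  have -> : p ^+ #|L| - p ^+ #|A :|: L| = p ^+ #|L| * (1 - p ^+ #|A :\: L|).
    by rewrite AL exprD; ring.
  rewrite mulrA -exprD [leRHS]mulrC; apply: ler_pM => //.
  - by rewrite subr_ge0 exprn_ile1// ltW.
  - by apply: ple; rewrite cardsU leq_subLR leq_addl.
  - apply: le_trans h1; rewrite lerD2l lerN2; apply: ple.
    exact/subset_leq_card/finset.subsetDl.
have h3 : (1 - p ^+ #|A|) * p ^+ #|A :|: L| <= #|A|%:R * (1 - p) * p ^+ #|A :|: L|.
  by rewrite ler_wpM2r.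
by apply: le_trans (lerD h3 h2) _; lra.
Qed.

(** Expanding the slacks leaves four terms of the preceding form, with L one of
    B :|: C, B, C and the empty set; the powers of p in front make up for the
    edges that are missing from A :|: L. *)
Lemma mean_dev_slack2 A B C :
  mean P (fun t => dev A t * slack B t * slack C t)
  <= 8 * #|A|%:R * (1 - p) * p ^+ #|A :|: B :|: C|.
Proof.
have L (L' : {set U}) : L1 P (fun t => dev A t * ind L' t).
  by apply: L1_mul2; [exact: dev_L3|exact: ind_L3].
have q1 : 0 <= 1 - p by rewrite subr_ge0.
have -> : (fun t => dev A t * slack B t * slack C t) = (fun t =>
    dev A t * ind (B :|: C) t + p ^+ #|C| * (dev A t * ind B t) +
    p ^+ #|B| * (dev A t * ind C t) + p ^+ #|B| * p ^+ #|C| * (dev A t * ind finset.set0 t)).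
  apply/funext => t; rewrite /slack ind_setU.
  have -> : ind finset.set0 t = 1.
    by rewrite /ind (_ : [forall _ in _, _])//; apply/forall_inP => e; rewrite inE.
  ring.
rewrite !meanD; do ?[exact: L1Z|exact: L|apply: L1D].
rewrite !meanZ; try exact: L.
have m0 := mean_dev_ind A finset.set0; have m1 := mean_dev_ind A B.
have m2 := mean_dev_ind A C; have m3 := mean_dev_ind A (B :|: C).
have bnd k L' x : x <= 2 * #|A|%:R * (1 - p) * p ^+ #|A :|: L'| ->
    (#|A :|: B :|: C| <= k + #|A :|: L'|)%N ->
    p ^+ k * x <= 2 * #|A|%:R * (1 - p) * p ^+ #|A :|: B :|: C|.
  move=> xle kle; apply: le_trans (ler_wpM2l (pX0 _) xle) _.
  rewrite mulrCA -exprD ler_wpM2l ?mulr_ge0//; exact: ple.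
have c1 : (#|A :|: B :|: C| <= #|C| + #|A :|: B|)%N.
  by rewrite cardsU leq_subLR addnC leq_addl.
have c2 : (#|A :|: B :|: C| <= #|B| + #|A :|: C|)%N.
  by rewrite finset.setUAC cardsU leq_subLR addnC leq_addl.
have c3 : (#|A :|: B :|: C| <= (#|B| + #|C|) + #|A :|: finset.set0|)%N.
  rewrite finset.setU0; apply: leq_trans c1 _.
  by rewrite [leqLHS]addnC [leqRHS]addnAC leq_add2r addnC leq_card_setU.
have b0 := bnd _ _ _ m0 c3; have b1 := bnd _ _ _ m1 c1; have b2 := bnd _ _ _ m2 c2.
rewrite finset.setUA in m3; rewrite exprD in b0.
by lra.
Qed.

(** The factors of the proofs below that depend only on which edges are retained;
    their products with weights have a mean that factors. *)
Let bounded_b (V : T -> R) :=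
  depends (bside [set: U]%SET) V /\ exists K, forall t, `|V t| <= K.

Let bounded_b_ind A : bounded_b (ind A).
Proof.
split; first exact: indb.
by exists 1 => t; rewrite ger0_norm ?ind_ge0 ?ind_le1.
Qed.

Let bounded_b_slack A : bounded_b (slack A).
Proof.
split; first exact: slackb.
exists 2 => t; rewrite ger0_norm ?slack_ge0// /slack.
have := ind_le1 A t; have : p ^+ #|A| <= 1 by rewrite exprn_ile1// ltW.
by lra.
Qed.

Let bounded_b_dev A : bounded_b (dev A).
Proof.
split; first exact: devb.
have [_ [K sK]] := bounded_b_slack A.
exists K => t; rewrite ger0_norm ?dev_ge0//; apply: le_trans (dev_le_slack A t) _.
by apply: le_trans (sK t); exact: ler_norm.
Qed.

Let bounded_b_mul V Z : bounded_b V -> bounded_b Z -> bounded_b (fun t => V t * Z t).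
Proof.
move=> [dV [K VK]] [dZ [K' ZK]]; split; first exact: depends_onM.
by exists (K * K') => t; rewrite normrM; exact: ler_pM.
Qed.

Let bounded_b_measurable V : bounded_b V -> measurable_fun [set: T] V.
Proof. by move=> [dV _]; exact: (depends_on_measurable F_meas dV). Qed.

Let bounded_b_L1 V Z : bounded_b V -> L1 P Z -> L1 P (fun t => V t * Z t).
Proof.
move=> bV iZ; have mV := bounded_b_measurable bV; have [_ [K VK]] := bV.
apply: (L1_dom _ _ (L1Z K (L1_norm iZ))).
  by apply: measurable_funM => //; exact: L1_measurable iZ.
by move=> t; rewrite normrM ler_wpM2r.
Qed.

Let mean_bounded_b V Z : bounded_b V -> depends (xside [set: U]%SET) Z -> L1 P Z ->
  mean P (fun t => V t * Z t) = mean P V * mean P Z.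
Proof.
move=> bV dZ iZ; apply: mean_mul_sides => //; [by case: bV| |exact: bounded_b_L1].
have := bounded_b_L1 bV (L1_cst P 1); by under eq_fun do rewrite mulr1.
Qed.

(** With X e = m + Y e and c = #|A| m, a copy with edge set A contributes
    ind A * (weight A + c), of mean c p^#|A|; this is the difference. *)
Definition contrib (c : R) (A : {set U}) (t : T) : R :=
  ind A t * weight A t + c * (ind A t - p ^+ #|A|).

Let ind_weight_L3 A : L3 P (fun t => ind A t * weight A t).
Proof.
under eq_fun do rewrite mulrC.
apply: (L3M_bounded (K := 1) (weight_L3 A) (@measurable_ind A)) => t.
by rewrite ger0_norm ?ind_ge0 ?ind_le1.
Qed.

Lemma contrib_L3 c A : L3 P (contrib c A).
Proof.
by apply: L3D => //; apply: L3Z; apply: L3B; [exact: ind_L3|exact: L3_cst].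
Qed.

Lemma contrib_mean c A : mean P (contrib c A) = 0.
Proof.
rewrite meanD; [|exact: L3_L1|by apply/L3_L1/L3Z/L3B; [exact: ind_L3|exact: L3_cst]].
rewrite mean_bounded_b//; last exact/L3_L1/weight_L3.
rewrite mean_weight mulr0 add0r meanZ; last by apply: L1B; [exact/L3_L1/ind_L3|exact: L1_cst].
rewrite meanB; [|exact/L3_L1/ind_L3|exact: L1_cst].
by rewrite mean_ind mean_cst subrr mulr0.
Qed.

Lemma contrib_depends c A : depends (bside A :|: xside A) (contrib c A).
Proof.
have bA := depends_on_sub (finset.subsetUl (bside A) (xside A)) (@ind_depends A).
have xA := depends_on_sub (finset.subsetUr (bside A) (xside A)) (@weight_depends A).
apply: depends_onD; first exact: depends_onM.
apply: depends_onM; first exact: depends_on_cst.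
by apply: depends_onD => //; exact: depends_on_cst.
Qed.

Lemma contrib_cov c A B :
  mean P (fun t => contrib c A t * contrib c B t) =
  p ^+ #|A :|: B| * (#|A :&: B|%:R * s2) +
  c ^+ 2 * (p ^+ #|A :|: B| - p ^+ (#|A| + #|B|)).
Proof.
pose a := p ^+ #|A|; pose b' := p ^+ #|B|.
have -> : (fun t => contrib c A t * contrib c B t) = (fun t =>
   ind (A :|: B) t * (weight A t * weight B t) +
   c * ((ind (A :|: B) t - b' * ind A t) * weight A t) +
   c * ((ind (A :|: B) t - a * ind B t) * weight B t) +
   c ^+ 2 * (ind (A :|: B) t - b' * ind A t - a * ind B t + a * b')).
  by apply/funext => t; rewrite /contrib ind_setU -/a -/b'; ring.
have iA L := L3_L1 (ind_L3 L); have iw L := L3_L1 (weight_L3 L).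
have bb (x : R) L L' : bounded_b (fun t => ind L t - x * ind L' t).
  split; first by apply: depends_onD => //; rewrite /GRing.opp/=; apply: (depends_on_comp (g := -%R)) => //; apply: depends_onM => //; exact: depends_on_cst.
  exists (1 + `|x|) => t; apply: le_trans (ler_normB _ _) _; apply: lerD.
    by rewrite ger0_norm ?ind_ge0 ?ind_le1.
  by rewrite normrM ler_piMr// ger0_norm ?ind_ge0 ?ind_le1.
have L1a : L1 P (fun t => ind (A :|: B) t * (weight A t * weight B t)).
  by apply: bounded_b_L1 => //; apply: L1_mul2; exact: weight_L3.
have L1b : L1 P (fun t => c * ((ind (A :|: B) t - b' * ind A t) * weight A t)).
  by apply: L1Z; apply: bounded_b_L1.
have L1c : L1 P (fun t => c * ((ind (A :|: B) t - a * ind B t) * weight B t)).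
  by apply: L1Z; apply: bounded_b_L1.
have L1d : L1 P (fun t => ind (A :|: B) t - b' * ind A t - a * ind B t).
  by apply: L1B; [apply: L1B => //; exact: L1Z|exact: L1Z].
rewrite meanD; [|by apply: L1D => //; exact: L1D|by apply: L1Z; apply: L1D => //; exact: L1_cst].
rewrite meanD//; last exact: L1D.
rewrite meanD//.
rewrite mean_bounded_b//; last 2 first.
- exact: depends_onM.
- by apply: L1_mul2; exact: weight_L3.
rewrite [X in _ + X + _ + _]meanZ; last exact: bounded_b_L1.
rewrite [X in _ + X + _]meanZ; last exact: bounded_b_L1.
rewrite (mean_bounded_b (bb b' (A :|: B) A))// (mean_bounded_b (bb a (A :|: B) B))//.
rewrite mean_weight_mul !mean_weight !mulr0 !addr0 mean_ind; congr (_ + _).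
rewrite meanZ; last by apply: L1D => //; exact: L1_cst.
rewrite meanD//; last exact: L1_cst.
rewrite meanB//; [|by apply: L1B => //; exact: L1Z|exact: L1Z].
rewrite meanB//; last exact: L1Z.
rewrite (meanZ b' (iA A)) (meanZ a (iA B)) !mean_ind mean_cst exprD -/a -/b'; ring.
Qed.

Variable c : R.
Hypothesis c_ge0 : 0 <= c.

Let contrib_le A t : `|contrib c A t| <= ind A t * abs_weight A t + c * dev A t.
Proof.
apply: le_trans (ler_normD _ _) _; apply: lerD.
  by rewrite normrM (ger0_norm (ind_ge0 A t)) ler_wpM2l ?ind_ge0// ler_norm_sum.
by rewrite normrM (ger0_norm c_ge0).
Qed.

Let absw_L1 A : L1 P (abs_weight A). Proof. exact/L3_L1/abs_weight_L3. Qed.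
Let absw2_L1 A B : L1 P (fun t => abs_weight A t * abs_weight B t).
Proof. by apply: L1_mul2; exact: abs_weight_L3. Qed.
Let absw3_L1 A B C : L1 P (fun t => abs_weight A t * abs_weight B t * abs_weight C t).
Proof. by apply: L1_mul3; exact: abs_weight_L3. Qed.

Let slack0 t : slack finset.set0 t = 2.
Proof.
rewrite /slack cards0 expr0 /ind (_ : [forall _ in _, _]); first by rewrite -[2]/(1 + 1).
by apply/forall_inP => e; rewrite inE.
Qed.

Let dev_slack_L1 A B C : L1 P (fun t => dev A t * slack B t * slack C t).
Proof.
have : bounded_b (fun t => dev A t * slack B t * slack C t).
  by apply: bounded_b_mul => //; exact: bounded_b_mul.
by move=> /bounded_b_L1/(_ (L1_cst P 1)); under eq_fun do rewrite mulr1.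
Qed.

Lemma mean_dev A : mean P (dev A) <= 2 * #|A|%:R * (1 - p) * p ^+ #|A|.
Proof.
have := mean_dev_slack2 A finset.set0 finset.set0; rewrite !finset.setU0.
have -> : (fun t => dev A t * slack finset.set0 t * slack finset.set0 t) =
    (fun t => 4 * dev A t) by apply/funext => t; rewrite !slack0; ring.
by rewrite meanZ; [lra|exact/L3_L1/dev_L3].
Qed.

Lemma mean_dev_slack A B :
  mean P (fun t => dev A t * slack B t) <= 4 * #|A|%:R * (1 - p) * p ^+ #|A :|: B|.
Proof.
have := mean_dev_slack2 A B finset.set0; rewrite !finset.setU0.
have -> : (fun t => dev A t * slack B t * slack finset.set0 t) =
    (fun t => 2 * (dev A t * slack B t)) by apply/funext => t; rewrite !slack0; ring.
by rewrite meanZ; [lra|apply: L1_mul2; [exact: dev_L3|exact: slack_L3]].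
Qed.

Variable k : nat.

Lemma mean_abs_contrib (A : {set U}) : #|A| = k ->
  mean P (fun t => `|contrib c A t|) <= p ^+ k * (k%:R * s1 + 2 * k%:R * ((1 - p) * c)).
Proof.
move=> Ak.
apply: (@le_trans _ _ (mean P (fun t => ind A t * abs_weight A t + c * dev A t))).
  apply: le_mean => //; first exact/L1_norm/L3_L1/contrib_L3.
  by apply: L1D; [exact: bounded_b_L1|exact/L1Z/L3_L1/dev_L3].
rewrite meanD; [|exact: bounded_b_L1|exact/L1Z/L3_L1/dev_L3].
rewrite meanZ; last exact/L3_L1/dev_L3.
rewrite mean_bounded_b// mean_ind mulrDr; apply: lerD.
  by rewrite -Ak ler_wpM2l// mean_abs_weight.
have := ler_wpM2l c_ge0 (mean_dev A); rewrite Ak.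
by move=> /le_trans; apply; rewrite le_eqVlt; apply/orP; left; apply/eqP; ring.
Qed.

Let mono2 (D x u w : R) : 0 <= D -> x <= u -> 0 <= w -> D * x * w <= D * u * w.
Proof. by move=> D0 xu w0; rewrite ler_wpM2r// ler_wpM2l. Qed.

Let mono3 (D x u y v w : R) : 0 <= D -> 0 <= x -> x <= u -> 0 <= y -> y <= v -> 0 <= w ->
  D * x * y * w <= D * u * v * w.
Proof.
move=> D0 x0 xu y0 yv w0; rewrite ler_wpM2r// -!mulrA ler_wpM2l//.
exact: ler_pM.
Qed.

Lemma mean_abs_contrib2 (A B : {set U}) : #|A| = k -> #|B| = k ->
  mean P (fun t => `|contrib c A t * contrib c B t|) <=
  p ^+ #|A :|: B| * ((k * k)%:R * s2 + 4 * k%:R * ((1 - p) * (2 * (c * (k%:R * s1)) + c ^+ 2))).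
Proof.
move=> Ak Bk.
pose bnd t := ind (A :|: B) t * (abs_weight A t * abs_weight B t) +
  c * ((dev A t * slack B t) * abs_weight B t) +
  c * ((dev B t * slack A t) * abs_weight A t) + c ^+ 2 * (dev A t * slack B t).
have bds A' B' : bounded_b (fun t => dev A' t * slack B' t) by exact: bounded_b_mul.
have ids A' B' : L1 P (fun t => dev A' t * slack B' t).
  by apply: L1_mul2; [exact: dev_L3|exact: slack_L3].
have i1 : L1 P (fun t => ind (A :|: B) t * (abs_weight A t * abs_weight B t)).
  exact: bounded_b_L1.
have i2 A' B' : L1 P (fun t => (dev A' t * slack B' t) * abs_weight B' t).
  exact: bounded_b_L1.
apply: (@le_trans _ _ (mean P bnd)).
  apply: le_mean; first by apply/L1_norm/L1_mul2; exact: contrib_L3.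
    by apply: L1D; [apply: L1D; [apply: L1D|]|]; do ?[exact: L1Z|exact: i1].
  move=> t; rewrite normrM.
  apply: le_trans (ler_pM _ _ (contrib_le A t) (contrib_le B t)) _ => //.
  rewrite /bnd ind_setU.
  have dA := dev_ge0 A t; have dB := dev_ge0 B t.
  have yA := abs_weight_ge0 A t; have yB := abs_weight_ge0 B t.
  have h1 := mono2 dA (ind_le_slack B t) yB.
  have h2 := mono2 dB (ind_le_slack A t) yA.
  have h3 := ler_wpM2l dA (dev_le_slack B t).
  have c2 : 0 <= c ^+ 2 by rewrite sqr_ge0.
  have g1 := ler_wpM2l c_ge0 h1; have g2 := ler_wpM2l c_ge0 h2; have g3 := ler_wpM2l c2 h3.
  move: g1 g2 g3; move: (ind A t) (ind B t) (dev A t) (dev B t) (slack A t) (slack B t).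
  move: (abs_weight A t) (abs_weight B t) => w1 w2 j1 j2 d1 d2 u1 u2 g1 g2 g3.
  have -> : (j1 * w1 + c * d1) * (j2 * w2 + c * d2) =
    j1 * j2 * (w1 * w2) + c * (d1 * j2 * w2) + c * (d2 * j1 * w1) + c ^+ 2 * (d1 * d2) by ring.
  by lra.
rewrite /bnd meanD; [|by apply: L1D; [apply: L1D|]; do ?[exact: L1Z|exact: i1]|exact: L1Z].
rewrite meanD; [|by apply: L1D; do ?[exact: L1Z|exact: i1]|exact: L1Z].
rewrite meanD; [|exact: i1|exact: L1Z].
rewrite !meanZ//.
rewrite (mean_bounded_b (bounded_b_ind (A :|: B)) _ (absw2_L1 A B)); last exact: depends_onM.
rewrite (mean_bounded_b (bds A B) (@absx B) (absw_L1 B)).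
rewrite (mean_bounded_b (bds B A) (@absx A) (absw_L1 A)) mean_ind.
have yA := mean_abs_weight A; have yB := mean_abs_weight B.
have yAB := mean_abs_weight2 A B.
have dA := mean_dev_slack A B; have dB := mean_dev_slack B A.
rewrite finset.setUC in dB; rewrite ?Ak ?Bk in yA yB yAB dA dB.
have yA0 : 0 <= mean P (abs_weight A) by apply: mean_ge0 => t; exact: abs_weight_ge0.
have yB0 : 0 <= mean P (abs_weight B) by apply: mean_ge0 => t; exact: abs_weight_ge0.
have dA0 : 0 <= mean P (fun t => dev A t * slack B t).
  by apply: mean_ge0 => t; rewrite mulr_ge0 ?dev_ge0 ?slack_ge0.
have dB0 : 0 <= mean P (fun t => dev B t * slack A t).
  by apply: mean_ge0 => t; rewrite mulr_ge0 ?dev_ge0 ?slack_ge0.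
have h1 := ler_wpM2l (pX0 #|A :|: B|) yAB.
have h2 := ler_wpM2l c_ge0 (ler_pM dA0 yB0 dA yB).
have h3 := ler_wpM2l c_ge0 (ler_pM dB0 yA0 dB yA).
have h4 := ler_wpM2l (sqr_ge0 c) dA.
apply: le_trans (lerD (lerD (lerD h1 h2) h3) h4) _.
by rewrite le_eqVlt; apply/orP; left; apply/eqP; ring.
Qed.

(** Expanding the product of the three bounds ind * abs_weight + c * dev, the term
    without c gives the third moments of the weights and every other term keeps
    one dev, hence a factor 1 - p. *)
Lemma mean_abs_contrib3 (A B C : {set U}) : #|A| = k -> #|B| = k -> #|C| = k ->
  mean P (fun t => `|contrib c A t * contrib c B t * contrib c C t|) <=
  p ^+ #|A :|: B :|: C| * ((k * k * k)%:R * (3 * s3) +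
    8 * k%:R * ((1 - p) * (3 * (c * ((k * k)%:R * s2)) + 3 * (c ^+ 2 * (k%:R * s1)) + c ^+ 3))).
Proof.
move=> Ak Bk Ck.
pose y := abs_weight.
pose q A' B' C' t := dev A' t * slack B' t * slack C' t.
pose bnd t := ind (A :|: B :|: C) t * (y A t * y B t * y C t) +
  (c * (q A B C t * (y B t * y C t)) + c * (q B A C t * (y A t * y C t)) +
   c * (q C A B t * (y A t * y B t))) +
  (c ^+ 2 * (q A B C t * y C t) + c ^+ 2 * (q A B C t * y B t) + c ^+ 2 * (q B A C t * y A t)) +
  c ^+ 3 * q A B C t.
have bq A' B' C' : bounded_b (q A' B' C').
  by apply: bounded_b_mul => //; exact: bounded_b_mul.
have i0 : L1 P (fun t => ind (A :|: B :|: C) t * (y A t * y B t * y C t)).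
  exact: bounded_b_L1.
have i1 A' B' C' D E : L1 P (fun t => c * (q A' B' C' t * (y D t * y E t))).
  by apply: L1Z; exact: bounded_b_L1.
have i2 A' B' C' D : L1 P (fun t => c ^+ 2 * (q A' B' C' t * y D t)).
  by apply: L1Z; exact: bounded_b_L1.
have i3 A' B' C' : L1 P (q A' B' C') by exact: dev_slack_L1.
apply: (@le_trans _ _ (mean P bnd)).
  apply: le_mean; first by apply/L1_norm/L1_mul3; exact: contrib_L3.
    rewrite /bnd; apply: L1D; last exact: L1Z.
    apply: L1D; first by apply: L1D => //; apply: L1D => //; exact: L1D.
    by apply: L1D => //; exact: L1D.
  move=> t; rewrite !normrM.
  apply: le_trans (ler_pM _ _ (ler_pM _ _ (contrib_le A t) (contrib_le B t)) (contrib_le C t)) _ => //.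
  rewrite /bnd !ind_setU /q /y.
  have dA := dev_ge0 A t; have dB := dev_ge0 B t; have dC := dev_ge0 C t.
  have yA := abs_weight_ge0 A t; have yB := abs_weight_ge0 B t; have yC := abs_weight_ge0 C t.
  have IA := ind_ge0 A t; have IB := ind_ge0 B t; have IC := ind_ge0 C t.
  have lA := ind_le_slack A t; have lB := ind_le_slack B t; have lC := ind_le_slack C t.
  have eA := dev_le_slack A t; have eB := dev_le_slack B t; have eC := dev_le_slack C t.
  have c2 : 0 <= c ^+ 2 by rewrite sqr_ge0.
  have c3 : 0 <= c ^+ 3 by rewrite exprn_ge0.
  have g1 := ler_wpM2l c_ge0 (mono3 dA IB lB IC lC (mulr_ge0 yB yC)).
  have g2 := ler_wpM2l c_ge0 (mono3 dB IA lA IC lC (mulr_ge0 yA yC)).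
  have g3 := ler_wpM2l c_ge0 (mono3 dC IA lA IB lB (mulr_ge0 yA yB)).
  have g4 := ler_wpM2l c2 (mono3 dA dB eB IC lC yC).
  have g5 := ler_wpM2l c2 (mono3 dA IB lB dC eC yB).
  have g6 := ler_wpM2l c2 (mono3 dB IA lA dC eC yA).
  have g7 := ler_wpM2l c3 (mono3 dA dB eB dC eC ler01).
  move: g1 g2 g3 g4 g5 g6 g7.
  move: (ind A t) (ind B t) (ind C t) (dev A t) (dev B t) (dev C t) (slack A t) (slack B t) (slack C t).
  move: (abs_weight A t) (abs_weight B t) (abs_weight C t).
  move=> w1 w2 w3 j1 j2 j3 d1 d2 d3 u1 u2 u3 g1 g2 g3 g4 g5 g6 g7.
  have -> : (j1 * w1 + c * d1) * (j2 * w2 + c * d2) * (j3 * w3 + c * d3) =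
    j1 * j2 * j3 * (w1 * w2 * w3) + c * (d1 * j2 * j3 * (w2 * w3)) +
    c * (d2 * j1 * j3 * (w1 * w3)) + c * (d3 * j1 * j2 * (w1 * w2)) +
    c ^+ 2 * (d1 * d2 * j3 * w3) + c ^+ 2 * (d1 * j2 * d3 * w2) + c ^+ 2 * (d2 * j1 * d3 * w1) +
    c ^+ 3 * (d1 * d2 * d3 * 1) by ring.
  by lra.
have h0 : mean P (fun t => ind (A :|: B :|: C) t * (y A t * y B t * y C t)) <=
    p ^+ #|A :|: B :|: C| * ((k * k * k)%:R * (3 * s3)).
  rewrite mean_bounded_b//; last by apply: depends_onM => //; exact: depends_onM.
  rewrite mean_ind ler_wpM2l//; have := mean_abs_weight3 A B C; by rewrite Ak Bk Ck.
have mq (A' B' C' : {set U}) : #|A'| = k -> A' :|: B' :|: C' = A :|: B :|: C ->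
    mean P (q A' B' C') <= 8 * k%:R * (1 - p) * p ^+ #|A :|: B :|: C|.
  by move=> A'k <-; have := mean_dev_slack2 A' B' C'; rewrite A'k.
have q0 A' B' C' : 0 <= mean P (q A' B' C').
  by apply: mean_ge0 => t; rewrite !mulr_ge0 ?dev_ge0 ?slack_ge0.
have EB : B :|: A :|: C = A :|: B :|: C by rewrite (finset.setUC B).
have EC : C :|: A :|: B = A :|: B :|: C by rewrite -finset.setUA finset.setUC.
have h1 (A' B' C' D E : {set U}) : #|A'| = k -> #|D| = k -> #|E| = k ->
    A' :|: B' :|: C' = A :|: B :|: C ->
    mean P (fun t => c * (q A' B' C' t * (y D t * y E t))) <=
    c * ((8 * k%:R * (1 - p) * p ^+ #|A :|: B :|: C|) * ((k * k)%:R * s2)).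
  move=> A'k Dk Ek EA; rewrite meanZ; last exact: bounded_b_L1.
  rewrite ler_wpM2l// mean_bounded_b//; last exact: depends_onM.
  apply: ler_pM => //; [|exact: mq|by have := mean_abs_weight2 D E; rewrite Dk Ek].
  by apply: mean_ge0 => t; rewrite mulr_ge0 ?abs_weight_ge0.
have h2 (A' B' C' D : {set U}) : #|A'| = k -> #|D| = k ->
    A' :|: B' :|: C' = A :|: B :|: C ->
    mean P (fun t => c ^+ 2 * (q A' B' C' t * y D t)) <=
    c ^+ 2 * ((8 * k%:R * (1 - p) * p ^+ #|A :|: B :|: C|) * (k%:R * s1)).
  move=> A'k Dk EA; rewrite meanZ; last exact: bounded_b_L1.
  rewrite ler_wpM2l ?sqr_ge0// mean_bounded_b//.
  apply: ler_pM => //; [|exact: mq|by have := mean_abs_weight D; rewrite Dk].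
  by apply: mean_ge0 => t; exact: abs_weight_ge0.
have h3 : mean P (fun t => c ^+ 3 * q A B C t) <=
    c ^+ 3 * (8 * k%:R * (1 - p) * p ^+ #|A :|: B :|: C|).
  by rewrite meanZ// ler_wpM2l ?exprn_ge0//; exact: mq.
rewrite /bnd meanD; [|by apply: L1D; [apply: L1D => //; apply: L1D => //; exact: L1D|apply: L1D => //; exact: L1D]|exact: L1Z].
rewrite meanD; [|by apply: L1D => //; apply: L1D => //; exact: L1D|by apply: L1D => //; exact: L1D].
rewrite meanD//; last by apply: L1D => //; exact: L1D.
rewrite [X in _ + X + _ + _]meanD//; last exact: L1D.
rewrite [X in _ + (X + _) + _ + _]meanD//.
rewrite [X in _ + X + _]meanD//; last exact: L1D.
rewrite [X in _ + (X + _) + _]meanD//.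
have a1 := h1 A B C B C Ak Bk Ck erefl; have a2 := h1 B A C A C Bk Ak Ck EB.
have a3 := h1 C A B A B Ck Ak Bk EC.
have a4 := h2 A B C C Ak Ck erefl; have a5 := h2 A B C B Ak Bk erefl.
have a6 := h2 B A C A Bk Ak EB.
apply: le_trans (lerD (lerD (lerD h0 (lerD (lerD a1 a2) a3)) (lerD (lerD a4 a5) a6)) h3) _.
by rewrite le_eqVlt; apply/orP; left; apply/eqP; ring.
Qed.

End WeightedIndicators.

(** * Bounds by the second and fourth moments of the weight *)

Section MomentInequalities.
Context {d : measure_display} {T : measurableType d} {R : realType}.
Variable P : probability T R.

Lemma discriminant_le (a b c : R) : (forall x, 0 <= a - 2 * x * b + x ^+ 2 * c) ->
  b ^+ 2 <= a * c.
Proof.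
move=> h; have [c0|c0] := eqVneq c 0.
  have [->|b0] := eqVneq b 0; first by rewrite c0 mulr0 expr0n.
  have := h ((a + 1) / (2 * b)).
  have -> : a - 2 * ((a + 1) / (2 * b)) * b + ((a + 1) / (2 * b)) ^+ 2 * c = - 1.
    by rewrite c0; field.
  by rewrite lerNr oppr0 ler10.
have := h (b / c).
have -> : a - 2 * (b / c) * b + (b / c) ^+ 2 * c = (a * c - b ^+ 2) / c by field.
have cpos : 0 < c.
  rewrite lt_neqAle eq_sym c0/= leNgt; apply/negP => cneg.
  pose x := (`|b| + 1 + `|a|) / - c + 1.
  have := h x; have := h (- x).
  have nc : 0 < - c by rewrite oppr_gt0.
  have x1 : 1 <= x by rewrite lerDr divr_ge0 ?addr_ge0// ltW.
  have xc : `|b| + 1 + `|a| <= x * - c.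
    by rewrite /x mulrDl divfK ?gt_eqF// mul1r lerDl ltW.
  have h2 : (`|b| + 1 + `|a|) * 1 <= (x * - c) * x.
    by apply: ler_pM => //; rewrite !addr_ge0.
  have := ler_norm a; have := normr_ge0 b; rewrite sqrrN.
  by move: h2; rewrite expr2; lra.
by rewrite pmulr_lge0 ?invr_gt0// subr_ge0.
Qed.

Lemma cauchy_schwarz_mean (f g : T -> R) :
  L1 P (fun t => f t ^+ 2) -> L1 P (fun t => g t ^+ 2) -> L1 P (fun t => f t * g t) ->
  mean P (fun t => f t * g t) ^+ 2 <= mean P (fun t => f t ^+ 2) * mean P (fun t => g t ^+ 2).
Proof.
move=> if2 ig2 ifg; apply: discriminant_le => x.
have -> : mean P (fun t => f t ^+ 2) - 2 * x * mean P (fun t => f t * g t) +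
    x ^+ 2 * mean P (fun t => g t ^+ 2) = mean P (fun t => (f t - x * g t) ^+ 2).
  rewrite -(meanZ (2 * x) ifg) -(meanZ (x ^+ 2) ig2).
  rewrite -meanB//; last exact: L1Z.
  rewrite -meanD; [|by apply: L1B => //; exact: L1Z|exact: L1Z].
  by congr (mean P _); apply/funext => t; ring.
by apply: mean_ge0 => t; exact: sqr_ge0.
Qed.

Variable Z : T -> R.
Hypothesis mZ : measurable_fun [set: T] Z.
Hypothesis Z4 : L1 P (fun t => Z t ^+ 4).

Lemma fourth_moment_L3 : L3 P Z.
Proof.
split=> //; apply: (L1_dom (g := fun t => 1 + Z t ^+ 4)).
- exact: measurable_norm3.
- move=> t; rewrite normrX normr_id.
  have -> : Z t ^+ 4 = `|Z t| ^+ 4 by rewrite -normrX ger0_norm// exprn_even_ge0.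
  have := normr_ge0 (Z t); move: `|Z t| => x x0.
  have [x1|/ltW x1] := lerP x 1.
    by apply: (@le_trans _ _ 1); [rewrite exprn_ile1|rewrite lerDl exprn_ge0].
  by rewrite (exprS x 3) ler_wpDl// ler_peMl// exprn_ge0.
- by apply: L1D => //; exact: L1_cst.
Qed.

Let Z_L3 := fourth_moment_L3.
Let Z2 : L1 P (fun t => Z t ^+ 2).
Proof. by under eq_fun do rewrite expr2; exact: L1_mul2. Qed.
Let absZ2 : L1 P (fun t => `|Z t| ^+ 2).
Proof. by under eq_fun do rewrite real_normK ?num_real//. Qed.
Let Z2absE : mean P (fun t => `|Z t| ^+ 2) = mean P (fun t => Z t ^+ 2).
Proof. by congr (mean P _); apply/funext => t; rewrite real_normK ?num_real. Qed.
Let one2 : L1 P (fun=> 1 ^+ 2 : R). Proof. exact: L1_cst. Qed.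

Lemma abs_mean_le_sqrt : mean P (fun t => `|Z t|) <= Num.sqrt (mean P (fun t => Z t ^+ 2)).
Proof.
have i1 : L1 P (fun t => `|Z t| * 1).
  by under eq_fun do rewrite mulr1; exact/L1_norm/L3_L1.
have := cauchy_schwarz_mean absZ2 one2 i1.
under [X in mean P X ^+ 2 <= _]eq_fun do rewrite mulr1.
rewrite mean_cst expr1n mulr1 Z2absE => h.
rewrite -[leLHS]ger0_norm; last exact: mean_ge0.
by rewrite -sqrtr_sqr ler_wsqrtr.
Qed.

Lemma second_le_fourth : mean P (fun t => Z t ^+ 2) ^+ 2 <= mean P (fun t => Z t ^+ 4).
Proof.
have i4 : L1 P (fun t => (Z t ^+ 2) ^+ 2) by under eq_fun do rewrite -exprM.
have i1 : L1 P (fun t => Z t ^+ 2 * 1) by under eq_fun do rewrite mulr1.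
have := cauchy_schwarz_mean i4 one2 i1.
under [X in mean P X ^+ 2 <= _]eq_fun do rewrite mulr1.
rewrite mean_cst expr1n mulr1 => h; apply: le_trans h _.
by under eq_fun do rewrite -exprM.
Qed.

Lemma third_le_second_fourth : mean P (fun t => `|Z t| ^+ 3) <=
  Num.sqrt (mean P (fun t => Z t ^+ 2)) * Num.sqrt (mean P (fun t => Z t ^+ 4)).
Proof.
have i4 : L1 P (fun t => (Z t ^+ 2) ^+ 2) by under eq_fun do rewrite -exprM.
have E3 t : `|Z t| * Z t ^+ 2 = `|Z t| ^+ 3.
  by rewrite -[Z t ^+ 2]ger0_norm ?sqr_ge0// normrX -exprS.
have i1 : L1 P (fun t => `|Z t| * Z t ^+ 2).
  by under eq_fun do rewrite E3; have [] := Z_L3.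
have := cauchy_schwarz_mean absZ2 i4 i1.
under [X in mean P X ^+ 2 <= _]eq_fun do rewrite E3.
under [X in _ <= _ * mean P X]eq_fun do rewrite -exprM.
rewrite Z2absE => h.
rewrite -sqrtrM; last by apply: mean_ge0 => t; exact: sqr_ge0.
rewrite -[leLHS]ger0_norm; last by apply: mean_ge0 => t; rewrite exprn_ge0.
by rewrite -sqrtr_sqr ler_wsqrtr.
Qed.

End MomentInequalities.

Section SameLaw.
Context {d d' : measure_display} {T : measurableType d} {T' : measurableType d'} {R : realType}.
Variables (P : probability T R) (Q : probability T' R).
Variables (X : {RV P >-> R}) (X' : {RV Q >-> R}).
Hypothesis same_law : forall A : set R, measurable A -> P (X @^-1` A) = Q (X' @^-1` A).

Lemma same_law_L1 (g : R -> R) : measurable_fun [set: R] g ->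
  L1 Q (fun t => g (X' t)) -> L1 P (fun t => g (X t)).
Proof.
move=> mg /integrableP[_ fin]; apply/integrableP; split.
  by apply/measurable_EFinP; exact: (@measurableT_comp _ _ _ _ _ _ g).
have mng : measurable_fun [set: R] (fun x => `|g x|%:E).
  by apply/measurable_EFinP/measurableT_comp => //; exact: normr_measurable.
apply: le_lt_trans fin; rewrite le_eqVlt; apply/orP; left; apply/eqP.
transitivity (\int[distribution P X]_x `|g x|%:E)%E.
  by rewrite /distribution ge0_integral_pushforward.
rewrite (eq_measure_integral (distribution Q X')); last first.
  by move=> A mA _; exact: same_law.
by rewrite /distribution ge0_integral_pushforward.
Qed.

Lemma same_law_mean (g : R -> R) : measurable_fun [set: R] g ->
  L1 Q (fun t => g (X' t)) -> mean P (fun t => g (X t)) = mean Q (fun t => g (X' t)).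
Proof.
move=> mg iQ; have iP := same_law_L1 mg iQ; rewrite /mean unlock; congr fine.
have mge : measurable_fun [set: R] (EFin \o g) by exact/measurable_EFinP.
transitivity (\int[distribution P X]_x (g x)%:E)%E.
  by rewrite /distribution integral_pushforward.
rewrite (eq_measure_integral (distribution Q X')); last first.
  by move=> A mA _; exact: same_law.
by rewrite /distribution integral_pushforward.
Qed.

End SameLaw.

Lemma wasserstein_le {d d' : measure_display} {T : measurableType d}
    {T' : measurableType d'} {R : realType} (P : probability T R) (X : T -> R)
    (Q : probability T' R) (Y : T' -> R) (B : R) :
  (forall h : R -> R, (forall x y, `|h x - h y| <= `|x - y|) ->
     (`| 'E_P[h \o X] - 'E_Q[h \o Y] | <= B%:E)%E) ->
  (wasserstein P X Q Y <= B%:E)%E.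
Proof.
move=> hB; apply: ge_ereal_sup => _ [h hl <-]; apply: hB => x y.
by have := hl (x, y) (conj I I); rewrite /= mul1r.
Qed.

(** Here s^2 is the variance of the weight, u the square root of its fourth
    central moment, m its mean and r^2 = 1 - p. The quantity A is the order of
    magnitude aimed at for the error terms. They are reduced to u tau or to
    r^2 m^2 tau by means of s <= tau, r m <= tau and r <= 1; a factor 1 / r is
    lost when m has a larger exponent than r. *)
Lemma error_terms_le (R : realType) (s m u r tau : R) :
  0 <= s -> 0 <= m -> s ^+ 2 <= u -> 0 < r <= 1 -> 0 < tau ->
  tau ^+ 2 = s ^+ 2 + r ^+ 2 * m ^+ 2 ->
  let A := (u + r ^+ 2 * m ^+ 2) * tau / r in
  [/\ s * u <= A, r ^+ 2 * (m * s ^+ 2) <= A, r ^+ 2 * (m ^+ 2 * s) <= A,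
      r ^+ 2 * m ^+ 3 <= A &
      (s ^+ 2 + 8 * (r ^+ 2 * (m * s)) + 4 * (r ^+ 2 * m ^+ 2)) * (s + 2 * (r ^+ 2 * m)) <= 39 * A].
Proof.
move=> s0 m0 su /andP[r0 r1] tau0 tauE A.
have u0 : 0 <= u by apply: le_trans su; exact: sqr_ge0.
have rm0 : 0 <= r * m by rewrite mulr_ge0// ltW.
have st : s <= tau.
  rewrite -(@ler_pXn2r _ 2)// ?nnegrE ?(ltW tau0)// tauE lerDl.
  by rewrite -exprMn sqr_ge0.
have rmt : r * m <= tau.
  rewrite -(@ler_pXn2r _ 2)// ?nnegrE ?(ltW tau0)// tauE exprMn lerDr.
  exact: sqr_ge0.
have r2 : r ^+ 2 <= 1 by rewrite expr_le1// ltW.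
have uA : u * tau <= A.
  rewrite /A ler_pdivlMr//; apply: (@le_trans _ _ (u * tau)).
    by rewrite ler_piMr// mulr_ge0// ltW.
  by rewrite ler_wpM2r ?(ltW tau0)// lerDl -exprMn sqr_ge0.
have mA : r * m ^+ 2 * tau <= A.
  have -> : r * m ^+ 2 * tau = (r ^+ 2 * m ^+ 2) * tau / r by field; rewrite gt_eqF.
  rewrite /A ler_wpM2r ?invr_ge0 ?(ltW r0)// ler_wpM2r ?(ltW tau0)//.
  by rewrite lerDr.
have h1 : s * u <= A by apply: le_trans uA; rewrite mulrC ler_wpM2l.
have h2 : r ^+ 2 * (m * s ^+ 2) <= A.
  apply: le_trans uA; have -> : r ^+ 2 * (m * s ^+ 2) = s ^+ 2 * (r * (r * m)) by ring.
  apply: ler_pM => //; [exact: sqr_ge0|by rewrite mulr_ge0// ltW|].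
  by apply: le_trans rmt; rewrite ler_piMl.
have h3 : r ^+ 2 * (m ^+ 2 * s) <= A.
  apply: le_trans mA; have -> : r ^+ 2 * (m ^+ 2 * s) = (r * m ^+ 2) * (r * s) by ring.
  rewrite ler_wpM2l ?mulr_ge0 ?sqr_ge0 ?(ltW r0)//.
  by apply: le_trans st; rewrite ler_piMl.
have h4 : r ^+ 2 * m ^+ 3 <= A.
  apply: le_trans mA; have -> : r ^+ 2 * m ^+ 3 = (r * m ^+ 2) * (r * m) by ring.
  by rewrite ler_wpM2l ?mulr_ge0 ?sqr_ge0 ?(ltW r0).
have t3 : tau ^+ 2 * tau <= A.
  rewrite tauE mulrDl; apply: (@le_trans _ _ ((u + r ^+ 2 * m ^+ 2) * tau)).
    by rewrite -mulrDl ler_wpM2r ?(ltW tau0)// lerD2r.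
  rewrite /A ler_pdivlMr// ler_piMr// mulr_ge0 ?(ltW tau0)// addr_ge0//.
  by rewrite -exprMn sqr_ge0.
split=> //; apply: (@le_trans _ _ ((13 * tau ^+ 2) * (3 * tau))); last first.
  have -> : 13 * tau ^+ 2 * (3 * tau) = 39 * (tau ^+ 2 * tau) by ring.
  by rewrite ler_wpM2l.
have g1 : s ^+ 2 <= tau ^+ 2 by rewrite tauE lerDl -exprMn sqr_ge0.
have g2 : r ^+ 2 * m ^+ 2 <= tau ^+ 2 by rewrite tauE lerDr sqr_ge0.
have g3 : r ^+ 2 * m <= tau.
  by apply: le_trans rmt; rewrite expr2 -mulrA ler_piMl.
have g4 : r ^+ 2 * (m * s) <= tau ^+ 2.
  by rewrite mulrA expr2; apply: ler_pM => //; rewrite mulr_ge0// sqr_ge0.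
have g5 : 0 <= r ^+ 2 * (m * s) := mulr_ge0 (sqr_ge0 r) (mulr_ge0 m0 s0).
have g6 : 0 <= r ^+ 2 * m := mulr_ge0 (sqr_ge0 r) m0.
have g7 : 0 <= r ^+ 2 * m ^+ 2 := mulr_ge0 (sqr_ge0 r) (sqr_ge0 m).
have g8 := sqr_ge0 s.
by apply: ler_pM; lra.
Qed.

Section ErrorArithmetic.
Variables (R : realType) (s m u r A k : R).
Hypotheses (s0 : 0 <= s) (m0 : 0 <= m) (su : s ^+ 2 <= u) (k1 : 1 <= k).

Let k0 : 0 <= k. Proof. exact: le_trans ler01 k1. Qed.
Let kpow a a' : (a <= a')%N -> k ^+ a <= k ^+ a'. Proof. by move=> aa'; exact: ler_weXn2l. Qed.

Lemma triple_error_le :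
  s * u <= A -> r ^+ 2 * (m * s ^+ 2) <= A -> r ^+ 2 * (m ^+ 2 * s) <= A ->
  r ^+ 2 * m ^+ 3 <= A ->
  k * k * k * (3 * (s * u)) + 8 * k * (r ^+ 2 * (3 * (k * m * (k * k * s ^+ 2)) +
    3 * ((k * m) ^+ 2 * (k * s)) + (k * m) ^+ 3)) <= 59 * k ^+ 5 * A.
Proof.
move=> e1 e2 e3 e4.
have -> : k * k * k * (3 * (s * u)) + 8 * k * (r ^+ 2 *
    (3 * (k * m * (k * k * s ^+ 2)) + 3 * ((k * m) ^+ 2 * (k * s)) + (k * m) ^+ 3)) =
  k ^+ 3 * (3 * (s * u)) + k ^+ 4 * (24 * (r ^+ 2 * (m * s ^+ 2)) +
     24 * (r ^+ 2 * (m ^+ 2 * s)) + 8 * (r ^+ 2 * m ^+ 3)) by ring.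
have -> : 59 * k ^+ 5 * A = k ^+ 5 * (3 * A) + k ^+ 5 * (56 * A) by ring.
have s2m : 0 <= r ^+ 2 * (m * s ^+ 2) := mulr_ge0 (sqr_ge0 r) (mulr_ge0 m0 (sqr_ge0 s)).
have sm2 : 0 <= r ^+ 2 * (m ^+ 2 * s) := mulr_ge0 (sqr_ge0 r) (mulr_ge0 (sqr_ge0 m) s0).
have m3 : 0 <= r ^+ 2 * m ^+ 3 := mulr_ge0 (sqr_ge0 r) (exprn_ge0 3 m0).
have su0 : 0 <= s * u by rewrite mulr_ge0//; apply: le_trans su; exact: sqr_ge0.
apply: lerD; apply: ler_pM.
- exact: exprn_ge0.
- by rewrite mulr_ge0.
- exact: kpow.
- by rewrite ler_wpM2l.
- exact: exprn_ge0.
- by move: s2m sm2 m3; lra.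
- exact: kpow.
- by move: e2 e3 e4; lra.
Qed.

Lemma pair_error_le :
  (s ^+ 2 + 8 * (r ^+ 2 * (m * s)) + 4 * (r ^+ 2 * m ^+ 2)) * (s + 2 * (r ^+ 2 * m)) <= 39 * A ->
  (k * k * s ^+ 2 + 4 * k * (r ^+ 2 * (2 * (k * m * (k * s)) + (k * m) ^+ 2))) *
  (k * s + 2 * k * (r ^+ 2 * (k * m))) <= 39 * k ^+ 5 * A.
Proof.
move=> e5.
have g5 : 0 <= r ^+ 2 * (m * s) := mulr_ge0 (sqr_ge0 r) (mulr_ge0 m0 s0).
have g7 : 0 <= r ^+ 2 * m ^+ 2 := mulr_ge0 (sqr_ge0 r) (sqr_ge0 m).
have g6 : 0 <= r ^+ 2 * m := mulr_ge0 (sqr_ge0 r) m0.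
have -> : (k * k * s ^+ 2 + 4 * k * (r ^+ 2 * (2 * (k * m * (k * s)) + (k * m) ^+ 2))) *
    (k * s + 2 * k * (r ^+ 2 * (k * m))) =
    (k ^+ 2 * s ^+ 2 + k ^+ 3 * (8 * (r ^+ 2 * (m * s)) + 4 * (r ^+ 2 * m ^+ 2))) *
    (k * s + k ^+ 2 * (2 * (r ^+ 2 * m))) by ring.
have -> : 39 * k ^+ 5 * A = k ^+ 5 * (39 * A) by ring.
have s2 := sqr_ge0 s.
have ms : 0 <= 8 * (r ^+ 2 * (m * s)) + 4 * (r ^+ 2 * m ^+ 2) by lra.
have rm : 0 <= 2 * (r ^+ 2 * m) by rewrite mulr_ge0.
have kn a : 0 <= k ^+ a by exact: exprn_ge0.
apply: (@le_trans _ _ ((k ^+ 3 * (s ^+ 2 + 8 * (r ^+ 2 * (m * s)) + 4 * (r ^+ 2 * m ^+ 2))) *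
    (k ^+ 2 * (s + 2 * (r ^+ 2 * m))))).
  apply: ler_pM.
  - by apply: addr_ge0; apply: mulr_ge0.
  - by apply: addr_ge0; apply: mulr_ge0.
  - by rewrite -addrA [leRHS]mulrDr lerD2r ler_wpM2r// kpow.
  - by rewrite [leRHS]mulrDr lerD2r ler_wpM2r// -[leLHS]expr1 kpow.
have -> : k ^+ 3 * (s ^+ 2 + 8 * (r ^+ 2 * (m * s)) + 4 * (r ^+ 2 * m ^+ 2)) *
    (k ^+ 2 * (s + 2 * (r ^+ 2 * m))) = k ^+ 5 *
    ((s ^+ 2 + 8 * (r ^+ 2 * (m * s)) + 4 * (r ^+ 2 * m ^+ 2)) * (s + 2 * (r ^+ 2 * m))) by ring.
by rewrite ler_wpM2l.
Qed.

End ErrorArithmetic.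

(** Here q is the square root of psi and sd is the standard deviation of the sum
    over the copies, bounded below by tau N / (q B). *)
Lemma rate_le (R : realType) (K D E N q tau B r sd : R) :
  0 <= K -> 0 <= D -> 0 <= E -> 0 < N -> 0 < q -> 0 < tau -> 0 < B -> 0 < r ->
  tau * N / (q * B) <= sd ->
  K / sd ^+ 3 * (D * (E * tau / r) * (N ^+ 3 / q ^+ 4)) <=
  K * D * B ^+ 3 * (E / tau ^+ 2) * (r * q)^-1.
Proof.
move=> K0 D0 E0 N0 q0 tau0 B0 r0 sdge.
have l0 : 0 < tau * N / (q * B) by rewrite divr_gt0 ?mulr_gt0.
have sd0 := lt_le_trans l0 sdge.
have inv3 : (sd ^+ 3)^-1 <= ((tau * N / (q * B)) ^+ 3)^-1.
  by rewrite lef_pV2 ?posrE ?exprn_gt0// ler_pXn2r// nnegrE ltW.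
apply: (@le_trans _ _ (K * ((tau * N / (q * B)) ^+ 3)^-1 * (D * (E * tau / r) * (N ^+ 3 / q ^+ 4)))).
  apply: ler_wpM2r; last by rewrite ler_wpM2l.
  have /ltW t0 := tau0; have /ltW l0' := r0; have /ltW n0 := N0; have /ltW q0' := q0.
  apply: mulr_ge0; last by apply: divr_ge0; exact: exprn_ge0.
  by apply: mulr_ge0 => //; apply: divr_ge0 => //; exact: mulr_ge0.
rewrite le_eqVlt; apply/orP; left; apply/eqP; field.
by rewrite !gt_eqF.
Qed.

(** * The sum over all copies *)

Section CopyWeights.
Context {R : realType} {V : finType} {G : sgraph V} {n : nat}.
Context {d : measure_display} {T : measurableType d} {P : probability T R}.
Variables (F : edge 'I_n + edge 'I_n -> set (set T)).
Hypothesis F_sigma : forall i, sigma_algebra setT (F i).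
Hypothesis F_meas : forall i, F i `<=` measurable.
Hypothesis F_indep : mutually_independent P F.
Variables (b : edge 'I_n -> T -> bool) (Y : edge 'I_n -> T -> R) (p m u r : R).
Variable s : R.
Hypothesis r01 : 0 < r <= 1.
Hypothesis p_def : 1 - p = r ^+ 2.
Hypothesis p0 : 0 < p.
Hypothesis s_ge0 : 0 <= s.
Hypothesis m_ge0 : 0 <= m.
Hypothesis su : s ^+ 2 <= u.
Hypothesis b_event : forall e, F (inl e) [set t | b e t].
Hypothesis b_prob : forall e, P [set t | b e t] = p%:E.
Hypothesis Y_F : forall e (A : set R), measurable A -> F (inr e) (Y e @^-1` A).
Hypothesis Y_L3 : forall e, L3 P (Y e).
Hypothesis Y_mean : forall e, mean P (Y e) = 0.
Hypothesis Y_var : forall e, mean P (fun t => Y e t ^+ 2) = s ^+ 2.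
Hypothesis Y_abs : forall e, mean P (fun t => `|Y e t|) <= s.
Hypothesis Y_abs3 : forall e, mean P (fun t => `|Y e t| ^+ 3) <= s * u.
Hypothesis vn : (#|verts G| <= n)%N.
Variable x0 : 'I_n.


Variables k v : nat.
Hypothesis G_k : #|edges G| = k.
Hypothesis G_v : #|verts G| = v.
Hypothesis k_gt0 : (0 < k)%N.
Hypothesis v_gt0 : (0 < v)%N.
Let c : R := k%:R * m.
Let N : R := n%:R ^+ v * p ^+ k.
Let psi : R := min_subgraph_count G n p.
Let tau := Num.sqrt (s ^+ 2 + r ^+ 2 * m ^+ 2).
Hypothesis tau2_gt0 : 0 < s ^+ 2 + r ^+ 2 * m ^+ 2.

Let p01 : 0 < p <= 1.
Proof. by rewrite p0/= -subr_ge0 p_def sqr_ge0. Qed.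
Let G_edge : (0 < #|edges G|)%N. Proof. by rewrite G_k. Qed.
Let n_gt0 : (0 < n)%N. Proof. by case: n x0 => [[]|]. Qed.
Let psi_gt0 : 0 < psi. Proof. exact: min_subgraph_count_gt0. Qed.
Let tau_gt0 : 0 < tau. Proof. by rewrite sqrtr_gt0. Qed.
Let tau2 : tau ^+ 2 = s ^+ 2 + r ^+ 2 * m ^+ 2.
Proof. by rewrite sqr_sqrtr// ltW. Qed.
Let c_ge0 : 0 <= c. Proof. by rewrite mulr_ge0. Qed.
Let k1 : 1 <= k%:R :> R. Proof. by rewrite ler1n. Qed.

Let card_copy (H : sgraph 'I_n) : graph_iso G H -> #|edges H| = k.
Proof. by move=> iH; rewrite (card_copy_edges x0 iH). Qed.

(** The sum ranges over all subgraphs of the complete graph, those that are not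
    copies contributing 0, so that the index type is a finite type. *)
Definition copy_contrib (H : sgraph 'I_n) (t : T) : R :=
  if graph_iso G H then contrib b Y p (k%:R * m) (edges H) t else 0.

Definition copies_sum (t : T) : R := \sum_(H : sgraph 'I_n) copy_contrib H t.

Local Notation xi := copy_contrib.
Local Notation S := copies_sum.

Let supp (H : sgraph 'I_n) : {set edge 'I_n + edge 'I_n} :=
  [set inl e | e in edges H]%SET :|: [set inr e | e in edges H]%SET.

Let touchesE i j : touches supp i j -> edges i :&: edges j != finset.set0.
Proof.
move=> /set0Pn[e]; rewrite !inE => /andP[].
move=> /orP[/imsetP[a ai ->]|/imsetP[a ai ->]] /orP[] /imsetP[a' aj] // [aa'];
  by apply/set0Pn; exists a; rewrite inE ai aa'.
Qed.

Let xi_supp H : depends_on F (supp H) (xi H).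
Proof.
rewrite /copy_contrib; case: (graph_iso G H); last exact: depends_on_cst.
exact: contrib_depends.
Qed.

Let xi_L3 H : L3 P (xi H).
Proof.
by rewrite /copy_contrib; case: (graph_iso G H); [exact: contrib_L3|exact: L3_cst].
Qed.

Let xi_mean H : mean P (xi H) = 0.
Proof.
by rewrite /copy_contrib; case: (graph_iso G H); [exact: contrib_mean|exact: mean_cst].
Qed.



(** Two copies that meet have a covariance of at least tau^2 p^a, for a the
    number of edges of their union: every shared edge contributes p^a s^2, and,
    since a < 2 k, p^a - p^(2k) is at least p^a (1 - p). The other covariances
    are nonnegative. *)
Let variance_ge : (v%:R ^+ (2 * v))^-1 * (tau ^+ 2 * (N ^+ 2 / psi)) <= mean P (fun t => S t ^+ 2).
Proof.
have -> : (fun t => S t ^+ 2) = (fun t => \sum_i \sum_j xi i t * xi j t).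
  apply/funext => t; rewrite expr2 /copies_sum mulr_suml; apply: eq_bigr => i _.
  by rewrite mulr_sumr.
rewrite mean_sum; last by move=> i _; apply: L1_sum => j _; exact: L1_mul2.
have pairs := sum_pairs_ge p01 n_gt0 G_edge x0 vn; rewrite G_k G_v -/psi -/N in pairs.
rewrite mulrCA; apply: le_trans (ler_wpM2l (sqr_ge0 tau) pairs) _.
rewrite mulr_sumr [leLHS]big_mkcond; apply: ler_sum => i _.
rewrite mean_sum; last by move=> j _; exact: L1_mul2.
case: ifP => [iG|iG]; last first.
  by apply: sumr_ge0 => j _; rewrite /copy_contrib iG; under eq_fun do rewrite mul0r; rewrite mean_cst.
rewrite mulr_sumr [leLHS]big_mkcond; apply: ler_sum => j _.
case jG: (graph_iso G j) => /=; last first.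
  by rewrite [in leRHS]/copy_contrib jG; under eq_fun do rewrite mulr0; rewrite mean_cst.
have -> : mean P (fun t => xi i t * xi j t) =
    p ^+ #|edges i :|: edges j| * (#|edges i :&: edges j|%:R * s ^+ 2) +
    c ^+ 2 * (p ^+ #|edges i :|: edges j| - p ^+ (k + k)).
  have := contrib_cov F_sigma F_meas F_indep b_event b_prob Y_F Y_L3 Y_mean Y_var c (edges i) (edges j).
  by rewrite (card_copy iG) (card_copy jG) /copy_contrib iG jG.
have UI := cardsUI (edges i) (edges j); rewrite (card_copy iG) (card_copy jG) in UI.
rewrite -card_gt0; move: UI.
move: #|edges i :|: edges j| #|edges i :&: edges j| => a a' UI.
have pa0 : 0 <= p ^+ a by rewrite exprn_ge0// ltW.
have s20 := sqr_ge0 s; have c20 := sqr_ge0 c; have m20 := sqr_ge0 m.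
have pp (l : nat) : (l <= k + k)%N -> p ^+ (k + k) <= p ^+ l.
  by move=> lk; apply: ler_wiXn2l => //; [exact: ltW|case/andP: p01].
case: ifP => [a'0|_]; last first.
  apply: addr_ge0; apply: mulr_ge0 => //; first exact: mulr_ge0.
  by rewrite subr_ge0; apply: pp; rewrite -UI leq_addr.
rewrite tau2 mulrDl; apply: lerD.
  by rewrite mulrC ler_wpM2l// ler_peMl// ler1n.
apply: (@le_trans _ _ (m ^+ 2 * (p ^+ a * (1 - p)))).
  by rewrite p_def le_eqVlt; apply/orP; left; apply/eqP; ring.
apply: ler_pM => //.
- by apply: mulr_ge0 => //; rewrite p_def; exact: sqr_ge0.
- by rewrite /c exprMn ler_peMl// expr_ge1// ler0n.
rewrite mulrBr mulr1 lerD2l lerN2 -exprSr; apply: pp.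
by rewrite -UI -addn1 leq_add2l.
Qed.

Let A := (u + r ^+ 2 * m ^+ 2) * tau / r.

(** The constant 157 is 2 * 59 + 39, from the triple and the pair terms. *)
Let error_term_le i j l : graph_iso G i -> graph_iso G j -> graph_iso G l ->
  2 * mean P (fun t => `|xi i t * xi j t * xi l t|) +
  mean P (fun t => `|xi i t * xi j t|) * mean P (fun t => `|xi l t|)
  <= (157 * k%:R ^+ 5 * A) * p ^+ #|edges i :|: edges j :|: edges l|.
Proof.
move=> iG jG lG.
have ik := card_copy iG; have jk := card_copy jG; have lk := card_copy lG.
have h3 := mean_abs_contrib3 F_sigma F_meas F_indep p01 b_event b_prob Y_F Y_L3 Y_var Y_abs Y_abs3 c_ge0 ik jk lk.
have h2 := mean_abs_contrib2 F_sigma F_meas F_indep p01 b_event b_prob Y_F Y_L3 Y_var Y_abs c_ge0 ik jk.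
have h1 := mean_abs_contrib F_sigma F_meas F_indep p01 b_event b_prob Y_F Y_L3 Y_abs c_ge0 lk.
have h2' : 0 <= mean P (fun t => `|contrib b Y p c (edges i) t * contrib b Y p c (edges j) t|).
  exact: mean_ge0.
have h1' : 0 <= mean P (fun t => `|contrib b Y p c (edges l) t|) by exact: mean_ge0.
have := ler_pM h2' h1' h2 h1; move: h3 {h2 h1 h2' h1'}.
rewrite /copy_contrib iG jG lG p_def.
have [e1 e2 e3 e4 e5] := error_terms_le s_ge0 m_ge0 su r01 tau_gt0 tau2.
rewrite -/A in e1 e2 e3 e4 e5.
have t3 := triple_error_le s_ge0 m_ge0 su k1 e1 e2 e3 e4.
have t2 := pair_error_le s_ge0 m_ge0 k1 e5.
have A0 : 0 <= A by apply: le_trans e4; rewrite mulr_ge0 ?sqr_ge0 ?exprn_ge0.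
have ple : p ^+ #|edges i :|: edges j| * p ^+ k <= p ^+ #|edges i :|: edges j :|: edges l|.
  rewrite -exprD; apply: ler_wiXn2l; [exact: ltW|by case/andP: p01|].
  by apply: leq_trans (leq_card_setU _ _) _; rewrite lk.
have pu0 : 0 <= p ^+ #|edges i :|: edges j :|: edges l| by rewrite exprn_ge0// ltW.
have pij0 : 0 <= p ^+ #|edges i :|: edges j| * p ^+ k.
  by rewrite mulr_ge0// exprn_ge0// ltW.
move: ple pu0 pij0.
move: (p ^+ #|edges i :|: edges j :|: edges l|) (p ^+ #|edges i :|: edges j|) (p ^+ k).
move=> pu pij pl ple pu0 pij0; rewrite !natrM -/c.
move: t3 t2; rewrite -/c.
move: (k%:R : R) (ler0n R k) A0 => kk kk0 A0 t3 t2 h3 h21.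
have B0 : 0 <= 39 * kk ^+ 5 * A.
  by apply: mulr_ge0 => //; apply: mulr_ge0 => //; exact: exprn_ge0.
have g3 := le_trans h3 (ler_wpM2l pu0 t3).
have g2 : pij * pl * (39 * kk ^+ 5 * A) <= pu * (39 * kk ^+ 5 * A) by rewrite ler_wpM2r.
have g1 := le_trans h21 _; move: g1; rewrite mulrACA => g1.
have {}g1 := le_trans (g1 _ (ler_wpM2l pij0 t2)) g2.
by apply: le_trans (lerD (ler_wpM2l _ g3) g1) _ => //; lra.
Qed.

(** Copies that are indexed by intersecting sets of variables share an edge, so
    the sum is over the triples counted by [sum_triples_le]. *)
Let sum_error_le :
  \sum_i \sum_(j | touches supp i j) \sum_(l | touches supp i l || touches supp j l)
    (2 * mean P (fun t => `|xi i t * xi j t * xi l t|) +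
     mean P (fun t => `|xi i t * xi j t|) * mean P (fun t => `|xi l t|)) <=
  157 * k%:R ^+ 5 * A * (((2 ^ k * (4 * k).+1 ^ v) ^ 2)%:R * (N ^+ 3 / psi ^+ 2)).
Proof.
have := sum_triples_le p01 n_gt0 G_edge x0; rewrite G_k G_v -/psi -/N => tr.
have A0 : 0 <= A.
  apply: divr_ge0; last by apply: ltW; case/andP: r01.
  apply: mulr_ge0; last exact: ltW.
  by apply: addr_ge0; [apply: le_trans su|apply: mulr_ge0]; exact: sqr_ge0.
have B0 : 0 <= 157 * k%:R ^+ 5 * A.
  by apply: mulr_ge0 => //; apply: mulr_ge0 => //; exact: exprn_ge0.
apply: le_trans (ler_wpM2l B0 tr) => {tr}.
pose e (i j l : sgraph 'I_n) := 2 * mean P (fun t => `|xi i t * xi j t * xi l t|) +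
     mean P (fun t => `|xi i t * xi j t|) * mean P (fun t => `|xi l t|).
have zero_mean (f : T -> R) : (forall t, f t = 0) -> mean P (fun t => `|f t|) = 0.
  by move=> f0; under eq_fun do rewrite f0 normr0; exact: mean_cst.
have e0 i j l : ~~ [&& graph_iso G i, graph_iso G j & graph_iso G l] -> e i j l = 0.
  move=> nijl; rewrite /e (zero_mean (fun t => xi i t * xi j t * xi l t)); last first.
    move=> t; rewrite /copy_contrib; move: nijl.
    case: (graph_iso G i); last by rewrite !mul0r.
    case: (graph_iso G j); last by rewrite mulr0 mul0r.
    by case: (graph_iso G l); rewrite ?mulr0.
  have [lG|lG] := boolP (graph_iso G l); last first.
    by rewrite (zero_mean (fun t => xi l t)) ?mulr0 ?addr0// => t; rewrite /copy_contrib (negbTE lG).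
  rewrite (zero_mean (fun t => xi i t * xi j t)) ?mulr0 ?mul0r ?addr0// => t; move: nijl; rewrite lG /copy_contrib.
  case: (graph_iso G i); last by rewrite mul0r.
  by case: (graph_iso G j); rewrite ?mulr0.
have e_ge0 i j l : 0 <= e i j l.
  by apply: addr_ge0; apply: mulr_ge0 => //; exact: mean_ge0.
rewrite mulr_sumr [leRHS]big_mkcond; apply: ler_sum => i _.
case: ifPn => iG; last first.
  by rewrite big1// => j _; rewrite big1// => l _; apply: e0; rewrite (negbTE iG).
rewrite mulr_sumr [leLHS]big_mkcond [leRHS]big_mkcond; apply: ler_sum => j _.
case: ifPn => ij; last first.
  case: ifP => // _; apply: mulr_ge0 => //; apply: sumr_ge0 => l _.
  by apply: exprn_ge0; exact: ltW.
case: ifPn => [/andP[jG _]|]; last first.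
  rewrite (touchesE ij) andbT => jG.
  by rewrite big1// => l _; apply: e0; rewrite (negbTE jG) andbF.
rewrite mulr_sumr [leLHS]big_mkcond [leRHS]big_mkcond; apply: ler_sum => l _.
have [lG|lG] := boolP (graph_iso G l); last first.
  by rewrite -/(e i j l) e0 ?(negbTE lG) ?andbF//=; case: ifP.
case: ifPn => [ijl|_]; last first.
  case: ifP => // _; apply: mulr_ge0 => //.
  by apply: exprn_ge0; exact: ltW.
rewrite ifT; first exact: error_term_le.
rewrite finset.setIUl /=; case/orP: ijl => /touchesE/set0Pn[a al];
  by apply/set0Pn; exists a; rewrite inE al ?orbT.
Qed.

Lemma copies_sum_L3 : L3 P S.
Proof. by apply: L3_sum => i _. Qed.

Lemma mean_copies_sum : mean P S = 0.
Proof. by rewrite mean_sum => [|i _]; [rewrite big1|exact: L3_L1]. Qed.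

Let N_gt0 : 0 < N.
Proof. by rewrite mulr_gt0// exprn_gt0// ltr0n. Qed.

Lemma mean_sqr_copies_sum_gt0 : 0 < mean P (fun t => S t ^+ 2).
Proof.
apply: lt_le_trans variance_ge; rewrite mulr_gt0 ?invr_gt0 ?exprn_gt0 ?ltr0n//.
by rewrite mulr_gt0 ?exprn_gt0// divr_gt0// exprn_gt0.
Qed.

Definition normalized_copies_sum t := S t / Num.sqrt (mean P (fun t => S t ^+ 2)).

Local Notation W := normalized_copies_sum.

Lemma copies_sum_stein_bound (f f' : R -> R) (K : R) : 0 <= K ->
  (forall x : R, is_derive x (1 : R) f (f' x)) ->
  (forall x, `|f x| <= K) -> (forall x, `|f' x| <= K) ->
  (forall x y, `|f' x - f' y| <= K * `|x - y|) ->
  `|mean P (fun t => f' (W t)) - mean P (fun t => W t * f (W t))| <=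
  K * (157 * k%:R ^+ 5 * ((2 ^ k * (4 * k).+1 ^ v) ^ 2)%:R) * (v%:R ^+ v) ^+ 3 *
   ((u + r ^+ 2 * m ^+ 2) / (s ^+ 2 + r ^+ 2 * m ^+ 2)) * (r * Num.sqrt psi)^-1.
Proof.
move=> K0 fd fK f'K f'lip.
have := stein_local_dependence F_sigma F_meas F_indep xi_supp xi_L3 xi_mean fd fK f'K f'lip mean_sqr_copies_sum_gt0.
rewrite /normalized_copies_sum => h; apply: (le_trans h) => {h}.
rewrite -[fun t => (\sum_i xi i t) ^+ 2]/(fun t => S t ^+ 2); set sd := Num.sqrt _.
have v0 : 0 < v%:R :> R by rewrite ltr0n.
have q0 : 0 < Num.sqrt psi by rewrite sqrtr_gt0.
have B0 : 0 < v%:R ^+ v :> R by rewrite exprn_gt0.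
have sd0 : 0 < sd by rewrite sqrtr_gt0 mean_sqr_copies_sum_gt0.
have sd2 : sd ^+ 2 = mean P (fun t => S t ^+ 2).
  by rewrite sqr_sqrtr// ltW// mean_sqr_copies_sum_gt0.
have psi2 : Num.sqrt psi ^+ 2 = psi by rewrite sqr_sqrtr// ltW.
have sdge : tau * N / (Num.sqrt psi * v%:R ^+ v) <= sd.
  rewrite -(@ler_pXn2r _ 2)// ?nnegrE ?(ltW sd0)//; last first.
    by apply: divr_ge0; apply: mulr_ge0; exact: ltW.
  rewrite sd2; apply: le_trans variance_ge; rewrite le_eqVlt; apply/orP; left; apply/eqP.
  rewrite !exprMn exprVn exprMn psi2 -!(exprM _ v 2) (mulnC v) invfM.
  by move: (_ ^- _) psi^-1 => x y; ring.
apply: le_trans (ler_wpM2l _ sum_error_le) _.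
  by rewrite divr_ge0// exprn_ge0// ltW.
set K3 : R := (_ ^ 2)%:R.
have D0 : 0 <= 157 * k%:R ^+ 5 * K3.
  by apply: mulr_ge0; rewrite ?ler0n//; apply: mulr_ge0 => //; exact: exprn_ge0.
have E0 : 0 <= u + r ^+ 2 * m ^+ 2.
  by apply: addr_ge0; [apply: le_trans su|apply: mulr_ge0]; exact: sqr_ge0.
have r0 : 0 < r by case/andP: r01.
have := rate_le K0 D0 E0 N_gt0 q0 tau_gt0 B0 r0 sdge.
rewrite tau2 (exprM _ 2 2) psi2; apply: le_trans.
rewrite le_eqVlt; apply/orP; left; apply/eqP; rewrite /A.
by move: (K / sd ^+ 3) (N ^+ 3 / psi ^+ 2) (k%:R ^+ 5) => a1 a2 a3; ring.
Qed.

End CopyWeights.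

(** * From Stein's equation to the theorem *)

Lemma wasserstein_normal_le (R : realType) : exists2 K : R, 0 < K &
  forall (d : measure_display) (T : measurableType d) (P : probability T R) (W : T -> R) (B : R),
    L3 P W ->
    (forall f f' : R -> R, (forall x : R, is_derive x (1 : R) f (f' x)) ->
       (forall x, `|f x| <= K) -> (forall x, `|f' x| <= K) ->
       (forall x y, `|f' x - f' y| <= K * `|x - y|) ->
       `|mean P (fun t => f' (W t)) - mean P (fun t => W t * f (W t))| <= B) ->
    (wasserstein P W (normal_prob (0 : R) (1 : R)) id <= B%:E)%E.
Proof.
have [K K0 HK] := stein_solution R; exists K => // d T P W B W3 HB.
apply: wasserstein_le => h hl; have [ih [f [f' [fd fE fK f'K f'l]]]] := HK h hl.
have mh : measurable_fun [set: R] h := L1_measurable ih.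
have mf := measurable_is_derive fd.
have mW := L3_measurable W3.
have mhW : measurable_fun [set: T] (fun t => h (W t)).
  exact: (@measurableT_comp _ _ _ _ _ _ h).
have ihW : L1 P (fun t => h (W t)).
  apply: (L1_dom mhW (g := fun t => `|h 0| + `|W t|)) => [t|].
    rewrite -[h (W t)](subrK (h 0)) addrC; apply: le_trans (ler_normD _ _) _.
    by rewrite lerD2l; apply: le_trans (hl _ _) _; rewrite subr0.
  by apply: L1D; [exact: L1_cst|exact/L1_norm/L3_L1].
have ifW : L1 P (fun t => W t * f (W t)).
  apply: L1_mul2 => //; apply: (L3_bounded P _ (fun t => fK (W t))).
  exact: (@measurableT_comp _ _ _ _ _ _ f).
set c := fine _ in fE.
have f'WE : (fun t => f' (W t)) = (fun t => h (W t) - c + W t * f (W t)).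
  by apply/funext => t; rewrite -fE subrK.
have ihc : L1 P (fun t => h (W t) - c) by apply: L1B => //; exact: L1_cst.
have := HB f f' fd fK f'K f'l; rewrite f'WE meanD// addrK meanB//; last exact: L1_cst.
rewrite mean_cst => hB.
have -> : ('E_P[h \o W] = (mean P (fun t => h (W t)))%:E)%E by exact: mean_EFin.
have -> : ('E_(normal_prob (0 : R) (1 : R))[h \o id] = c%:E)%E by exact: (mean_EFin ih).
by rewrite -EFinB abse_EFin lee_fin.
Qed.

Lemma renormalized_shift {d : measure_display} {T : measurableType d} {R : realType}
    (P : probability T R) (W S : T -> R) (a : R) :
  L1 P S -> mean P S = 0 -> (forall t, W t = S t + a) ->
  renormalized P W = (fun t => S t / Num.sqrt (mean P (fun t => S t ^+ 2))).
Proof.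
move=> iS S0 WE; have WE' : W = (fun t => S t + a) by exact/funext.
have mW : mean P W = a by rewrite WE' meanD//; [rewrite S0 mean_cst add0r|exact: L1_cst].
have vW : var P W = mean P (fun t => S t ^+ 2).
  rewrite /var /variance unlock -/(mean P W) mW /mean; congr (fine 'E_P[_])%E.
  apply/funext => t; transitivity ((W t - a) * (W t - a)) => //.
  by rewrite WE addrK expr2.
by apply/funext => t; rewrite /renormalized mW vW WE addrK.
Qed.

Section CopiesOfCenteredWeights.
Context {R : realType} {V : finType} {G : sgraph V} {n : nat}.
Context {d : measure_display} {T : measurableType d}.
Variables (b : edge 'I_n -> T -> bool) (Xe : edge 'I_n -> T -> R) (p m : R) (k : nat).
Hypothesis G_k : #|edges G| = k.
Variable x0 : 'I_n.

Lemma subgraph_weightE t : subgraph_weight G b Xe t =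
  copies_sum (G := G) b (fun e t => Xe e t - m) p m k t +
  \sum_(H : sgraph 'I_n | graph_iso G H) k%:R * m * p ^+ k.
Proof.
rewrite /subgraph_weight /copies_sum /copy_contrib -big_mkcond -big_split/=.
apply: eq_bigr => H HG; have Hk := card_copy_edges x0 HG; rewrite G_k in Hk.
have -> : (subgraph H (random_graph b t))%:R = ind b (edges H) t :> R.
  congr (nat_of_bool _)%:R; rewrite /subgraph finset.subsetT/=.
  apply/fintype.subsetP/forall_inP => bH e eH; first by have := bH e eH; rewrite inE.
  by rewrite inE; exact: bH.
rewrite /contrib /weight Hk sumrB (sumr_const (mem (edges H))) Hk -[m *+ k]mulr_natl.
by move: (p ^+ k) (\sum_(i in _) _) (ind _ _ _) (k%:R : R) => a x y z; ring.
Qed.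

End CopiesOfCenteredWeights.

Section NonnegativeWeights.
Context {d : measure_display} {T : measurableType d} {R : realType}.
Variable P : probability T R.

Lemma L1_of_lty (f : T -> R) : measurable_fun [set: T] f -> (forall t, 0 <= f t) ->
  ('E_P[f] < +oo)%E -> L1 P f.
Proof.
move=> mf f0; rewrite unlock => fin; apply/integrableP; split; first exact/measurable_EFinP.
by under eq_integral do rewrite /= ger0_norm//.
Qed.

Lemma mean_gt0 (f : T -> R) : L1 P f -> (forall t, 0 <= f t) ->
  ~ {ae P, forall t, f t = 0} -> 0 < mean P f.
Proof.
move=> f1 f0 nf; rewrite lt_neqAle mean_ge0// andbT; apply/eqP => mf; apply: nf.
have mfE : measurable_fun [set: T] (EFin \o f) by exact/measurable_EFinP/(L1_measurable f1).
have [+ _] := ae_eq_integral_abs P measurableT mfE => H.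
have {}H : ae_eq P setT (EFin \o f) (cst 0%E).
  apply: H; transitivity ('E_P[f])%E; last by rewrite mean_EFin// -mf.
  by rewrite unlock; apply: eq_integral => t _; rewrite /= ger0_norm.
by apply: filterS H => t /(_ I) [].
Qed.

End NonnegativeWeights.

Lemma graph_has_edge (V : finType) (G : sgraph V) :
  (0 < #|verts G|)%N -> no_isolated G -> (0 < #|edges G|)%N.
Proof.
rewrite card_gt0 => /set0Pn[x xG] /forall_inP/(_ x xG)/exists_inP[e eG _].
by rewrite card_gt0; apply/set0Pn; exists e.
Qed.

Lemma powR_inv_sqrt (R : realType) (x y : R) : 0 <= x -> 0 <= y ->
  (x * y) `^ (- 2^-1) = (Num.sqrt x * Num.sqrt y)^-1.
Proof. by move=> x0 y0; rewrite powRN powR12_sqrt ?mulr_ge0// sqrtrM. Qed.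

Theorem theorem4p3 (R : realType) (V : finType) (G : sgraph V)
    (G_nonempty : (0 < #|verts G|)%N) (G_no_isolated : no_isolated G) :
  exists C : R, 0 < C /\
    forall (dX : measure_display) (TX : measurableType dX)
      (PX : probability TX R) (X : {RV PX >-> R}),
    (forall w, 0 <= X w) ->
    ('E_PX[(fun w => X w ^+ 2)%R] < +oo)%E ->
    ~ {ae PX, forall w, X w = 0%R} ->
    forall p : nat -> R, (forall n, 0 < p n < 1) ->
    forall n : nat, (#|verts G| <= n)%N ->
    forall (d : measure_display) (T : measurableType d) (P : probability T R)
      (b : edge 'I_n -> {RV P >-> bool}) (Xe : edge 'I_n -> {RV P >-> R}),
    (forall e, P [set t | b e t] = (p n)%:E) ->
    (forall e (A : set R), measurable A ->
       P (Xe e @^-1` A) = PX (X @^-1` A)) ->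
    mutually_independent P
      (fun i : edge 'I_n + edge 'I_n =>
         match i with
         | inl e => sigma_rv (b e)
         | inr e => sigma_rv (Xe e)
         end) ->
    (wasserstein P (renormalized P (subgraph_weight G b Xe))
                 (normal_prob (0 : R) (1 : R)) id
     <= C%:E
        * ((sqrte 'E_PX[(fun w => (X w - mean PX X) ^+ 4)%R]
            + ((1 - p n) * mean PX X ^+ 2)%R%:E)
           / (var PX X + (1 - p n) * mean PX X ^+ 2)%R%:E)
        * (((1 - p n) * min_subgraph_count G n (p n)) `^ (- 2^-1))%R%:E)%E.
Proof.
have [K K0 wasserstein_le_K] := wasserstein_normal_le R.
have k_gt0 := graph_has_edge G_nonempty G_no_isolated.
(* Naming these numbers prevents their unfolding in exponents. *)
move E : #|edges G| k_gt0 => k k_gt0.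
move E' : #|verts G| G_nonempty => v v_gt0.
exists (K * (157 * k%:R ^+ 5 * ((2 ^ k * (4 * k).+1 ^ v) ^ 2)%:R) * (v%:R ^+ v) ^+ 3); split.
  by rewrite !mulr_gt0 ?exprn_gt0 ?ltr0n// expn_gt0 muln_gt0 !expn_gt0.
set C : R := (_ * _).
have C0 : 0 < C.
  by rewrite !mulr_gt0 ?exprn_gt0 ?ltr0n// expn_gt0 muln_gt0 !expn_gt0.
move=> dX TX PX X X0 X2 Xn0 p' p'01 n vn d T P b Xe b_prob Xe_law Findep.
move: (p' n) (p'01 n) b_prob => p /andP[p0 p1] b_prob {p' p'01}.
have n_gt0 : (0 < n)%N by exact: leq_trans v_gt0 vn.
pose x0 : 'I_n := Ordinal n_gt0.
have mX : measurable_fun [set: TX] X by [].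
have X2L : L1 PX (fun w => X w ^+ 2).
  by apply: L1_of_lty => // [|w]; [exact: measurable_funX|exact: sqr_ge0].
have XL : L1 PX X.
  apply: (L1_dom mX (g := fun w => 1 + X w ^+ 2)) => [w|]; last first.
    by apply: L1D => //; exact: L1_cst.
  rewrite ger0_norm//; have := sqr_ge0 (X w - 1); have := X0 w.
  by rewrite sqrrB; lra.
set m := mean PX X.
(* This makes the denominator of the bound positive even for a constant X. *)
have m_gt0 : 0 < m by exact: mean_gt0.
have vX0 : 0 <= var PX X by rewrite fine_ge0// variance_ge0.
have q0 : 0 < 1 - p by rewrite subr_gt0.
have qm0 : 0 < (1 - p) * m ^+ 2 by rewrite mulr_gt0// exprn_gt0.
have den0 : 0 < var PX X + (1 - p) * m ^+ 2 by rewrite ltr_wpDl.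
have p01 : 0 < p <= 1 by rewrite p0/= ltW.
have psi0 : 0 < min_subgraph_count G n p.
  by apply: min_subgraph_count_gt0 => //; rewrite E.
have mZ : measurable_fun [set: R] (fun x : R => x - m) by exact: measurable_funB.
have mZX : measurable_fun [set: TX] (fun w => X w - m) by exact: measurable_funB.
have Z40 w : 0 <= (X w - m) ^+ 4 by rewrite exprn_even_ge0.
rewrite inver gt_eqF//.
(* The right-hand side is infinite when the fourth moment is. *)
have [|Z4fin] := leP +oo%E ('E_PX[(fun w => (X w - m) ^+ 4)%R])%E.
  rewrite leye_eq => /eqP ->.
  rewrite /sqrte addye// (gt0_mulye (x := (_^-1)%:E)) ?lte_fin ?invr_gt0//.
  by rewrite gt0_muley ?lte_fin// gt0_mulye ?leey// lte_fin powR_gt0// mulr_gt0.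
have Z4L : L1 PX (fun w => (X w - m) ^+ 4).
  by apply: L1_of_lty => //; exact: measurable_funX.
rewrite (mean_EFin Z4L).
pose Y (e : edge 'I_n) t := Xe e t - m.
pose s := Num.sqrt (mean PX (fun w => (X w - m) ^+ 2)).
pose u := Num.sqrt (mean PX (fun w => (X w - m) ^+ 4)).
pose r := Num.sqrt (1 - p).
have Z2_ge0 : 0 <= mean PX (fun w => (X w - m) ^+ 2) by apply: mean_ge0 => w; exact: sqr_ge0.
have s2 : s ^+ 2 = mean PX (fun w => (X w - m) ^+ 2) by rewrite sqr_sqrtr.
have varXE : var PX X = s ^+ 2 by rewrite s2 /var /variance unlock -/(mean PX X).
have r2 : 1 - p = r ^+ 2 by rewrite sqr_sqrtr// ltW.
have ZL3 := fourth_moment_L3 mZX Z4L.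
have ZL1 := L3_L1 ZL3.
have Z2L : L1 PX (fun w => (X w - m) ^+ 2).
  by under eq_fun do rewrite expr2; exact: L1_mul2.
have same k' e : L1 PX (fun w => (X w - m) ^+ k') ->
    L1 P (fun t => Y e t ^+ k') /\
    mean P (fun t => Y e t ^+ k') = mean PX (fun w => (X w - m) ^+ k').
  have mg : measurable_fun [set: R] (fun x : R => (x - m) ^+ k') by exact: measurable_funX.
  by move=> ik; split; [exact: (same_law_L1 (Xe_law e) mg ik)|exact: (same_law_mean (Xe_law e) mg ik)].
have mY e : measurable_fun [set: T] (Y e) by exact: measurable_funB.
have Y4 e := (same 4%N e Z4L).1.
have Y_L3 e := fourth_moment_L3 (mY e) (Y4 e).
have Y_mean e : mean P (Y e) = 0.
  rewrite (same 1%N e ZL1).2 (_ : (fun w => _) = (fun w => X w - m))//.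
  by rewrite meanB// ?mean_cst ?subrr//; exact: L1_cst.
have s0 : 0 <= s by exact: sqrtr_ge0.
have Y_var e : mean P (fun t => Y e t ^+ 2) = s ^+ 2 by rewrite (same 2%N e Z2L).2 s2.
have Y_abs e : mean P (fun t => `|Y e t|) <= s.
  apply: le_trans (abs_mean_le_sqrt (mY e) (Y4 e)) _.
  by rewrite Y_var sqrtr_sqr ger0_norm.
have Y_abs3 e : mean P (fun t => `|Y e t| ^+ 3) <= s * u.
  apply: le_trans (third_le_second_fourth (mY e) (Y4 e)) _.
  by rewrite Y_var sqrtr_sqr ger0_norm// (same 4%N e Z4L).2.
have su : s ^+ 2 <= u.
  rewrite s2 -[leLHS]ger0_norm// -sqrtr_sqr; apply: ler_wsqrtr.
  exact: second_le_fourth mZX Z4L.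
have r01 : 0 < r <= 1.
  by rewrite sqrtr_gt0 q0/= -sqrtr1 ler_wsqrtr// gerBl ltW.
have tau2 : 0 < s ^+ 2 + r ^+ 2 * m ^+ 2 by rewrite -r2 -varXE.
move: Findep; set F := (F in mutually_independent _ F) => Findep.
have F_sigma i : sigma_algebra setT (F i).
  by case: i => e; apply: sigma_algebra_preimage; exact: sigma_algebra_measurable.
have F_meas i : F i `<=` measurable.
  by case: i => e _ [A mA <-]; exact: measurable_funP.
have b_event e : F (inl e) [set t | b e t].
  by exists [set true] => //; apply/seteqP; split=> t //= [].
have Y_F e (A : set R) : measurable A -> F (inr e) (Y e @^-1` A).
  move=> mA; exists ((fun x => x - m) @^-1` A); last by rewrite setTI.
  by rewrite -[X in measurable X]setTI; exact: mZ.
have E1 : (#|verts G| <= n)%N by rewrite E'.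
have S3 := copies_sum_L3 (G := G) F_meas p m b_event Y_L3 k.
have S0 := mean_copies_sum (G := G) F_sigma F_meas Findep m b_event b_prob Y_F Y_L3 Y_mean k.
rewrite (renormalized_shift (L3_L1 S3) S0 (subgraph_weightE b Xe p m E x0)).
apply: le_trans (wasserstein_le_K _ _ P (normalized_copies_sum (G := G) b Y p m k) _ _ _) _.
- rewrite /normalized_copies_sum; under eq_fun do rewrite mulrC.
  exact: L3Z.
- move=> f f' fd fK f'K f'l.
  exact: (copies_sum_stein_bound F_sigma F_meas Findep r01 r2 p0 s0 (ltW m_gt0) su
    b_event b_prob Y_F Y_L3 Y_mean Y_var Y_abs Y_abs3 E1 x0 E E' k_gt0 v_gt0 tau2 (ltW K0) fd fK f'K f'l).
by rewrite /sqrte -/u varXE (powR_inv_sqrt (ltW q0) (ltW psi0)) -/r r2 -EFinD -!EFinM lexx.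
Qed.
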